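(* Let $g\in H(\mathbb{D})$ and let $\nu$ be a weight. Then: (1) $S_g: H^{\infty}_\nu\rightarrow H^{\infty}$ is compact if and only if $g=0$; (2) if $\nu$ satisfies property (U) and $\mu$ is a quasi-normal weight, then the following are equivalent: (2.1) $S_g: H^{\infty}_\nu\rightarrow H^{\infty}_\mu$ is compact; (2.2) $\lim_{|z|\rightarrow1^-}\frac{\mu(z)}{\nu(z)}|g(z)|=0$. If, in addition, $\nu$ is a typical weight, then (2.1) and (2.2) are also equivalent to (2.3) $S_g: H^{0}_\nu\rightarrow H^{0}_\mu$ is compact.
   Context: $\mathbb{D}$ is the open unit disk and $H(\mathbb{D})$ the space of analytic functions on $\mathbb{D}$; $H^\infty$ is the space of bounded analytic functions on $\mathbb{D}$ with the sup norm. A weight is a non-negative continuous function $\nu$ on $\mathbb{D}$ with $\nu(z)=\nu(|z|)$ for all $z$, which is decreasing in $|z|$. For a weight $\nu$: $H^{\infty}_\nu=\{f\in H(\mathbb{D}): \|f\|_{H^\infty_\nu}=\sup_{z}\nu(z)|f(z)|<\infty\}$, $H^{0}_\nu=\{f\in H(\mathbb{D}): \lim_{|z|\to1^-}\nu(z)|f(z)|=0\}$ (with the norm of $H^\infty_\nu$), $\mathcal{B}^{0}_\nu=\{f\in H(\mathbb{D}): \lim_{|z|\to1^-}\nu(z)|f'(z)|=0\}$. A weight $\nu$ is typical if $\lim_{|z|\to1^-}\nu(z)=0$. A weight $\nu$ satisfies property (U) if there is $\alpha>0$ such that $r\mapsto \nu(r)/(1-r^2)^\alpha$ is almost increasing on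 $[0,1)$ (i.e. there is $C>0$ with $h(r)\le C h(s)$ whenever $r\le s$), equivalently $\inf_n \nu(1-2^{-(n+1)})/\nu(1-2^{-n})>0$. A weight $\mu$ is quasi-normal if $H^0_{\mu}=\mathcal{B}^0_{\mu_1}$ where $\mu_1(z)=\mu(z)(1-|z|^2)$. For $g\in H(\mathbb{D})$, $(S_gf)(z)=\int_0^z f'(\omega)g(\omega)\,d\omega$.
   Formalization: Weights ν and μ are taken strictly positive on the disk rather than merely non-negative; otherwise the zero weight ν satisfies (U) and the quotient μ/ν in (2.2) is undefined. *)

(* Defs.v *)
From Stdlib Require Import Reals ClassicalEpsilon.
From Coquelicot Require Import Coquelicot.
Open Scope R_scope.

Definition inD (z : C) : Prop := Cmod z < 1.

Definition cdiffble (f : C -> C) (z : C) : Prop :=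
  @ex_derive C_AbsRing C_NormedModule f z.

Definition analytic (f : C -> C) : Prop := forall z, inD z -> cdiffble f z.

(* the complex derivative f'(z) (a chosen value l with f'(z) = l when it exists) *)
Definition cderiv (f : C -> C) (z : C) : C :=
  epsilon (inhabits (RtoC 0)) (fun l => @is_derive C_AbsRing C_NormedModule f z l).

(* S_g f (z) = int_0^z f'(w) g(w) dw, computed along the segment [0,z]:
   z * int_0^1 f'(tz) g(tz) dt, the integral taken componentwise. *)
Definition Sg (g f : C -> C) (z : C) : C :=
  let F := fun t : R => Cmult (cderiv f (Cmult (RtoC t) z)) (g (Cmult (RtoC t) z)) in
  Cmult z (RInt (fun t => fst (F t)) 0 1, RInt (fun t => snd (F t)) 0 1).

(* A weight: radial function nu(z) = nu(|z|), given by its profile nu on [0,1);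
   (strictly) positive, continuous on [0,1), nonincreasing in |z|. *)
Definition weight (nu : R -> R) : Prop :=
  (forall r, 0 <= r < 1 -> 0 < nu r) /\
  (forall r, 0 <= r < 1 -> forall eps, 0 < eps -> exists delta, 0 < delta /\
      forall s, 0 <= s < 1 -> Rabs (s - r) < delta -> Rabs (nu s - nu r) < eps) /\
  (forall r s, 0 <= r -> r <= s -> s < 1 -> nu s <= nu r).

Definition wt (nu : R -> R) (z : C) : R := nu (Cmod z).

(* constant weight 1 : H^infty_1 = H^infty *)
Definition one_w (_ : R) : R := 1.

Definition Hinf (nu : R -> R) (f : C -> C) : Prop :=
  analytic f /\ exists M, forall z, inD z -> wt nu z * Cmod (f z) <= M.

Definition lim_bdry0 (phi : C -> R) : Prop :=
  forall eps, 0 < eps -> exists r, r < 1 /\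
    forall z, inD z -> r < Cmod z -> Rabs (phi z) < eps.

Definition H0 (nu : R -> R) (f : C -> C) : Prop :=
  analytic f /\ lim_bdry0 (fun z => wt nu z * Cmod (f z)).

Definition B0 (nu : R -> R) (f : C -> C) : Prop :=
  analytic f /\ lim_bdry0 (fun z => wt nu z * Cmod (cderiv f z)).

Definition typical (nu : R -> R) : Prop :=
  forall eps, 0 < eps -> exists r, r < 1 /\ forall s, r < s < 1 -> Rabs (nu s) < eps.

Definition propU (nu : R -> R) : Prop :=
  exists alpha, 0 < alpha /\ exists K, 0 < K /\
    forall r s, 0 <= r -> r <= s -> s < 1 ->
      nu r / Rpower (1 - r ^ 2) alpha <= K * (nu s / Rpower (1 - s ^ 2) alpha).

Definition w1 (mu : R -> R) (r : R) : R := mu r * (1 - r ^ 2).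

Definition quasi_normal (mu : R -> R) : Prop :=
  forall f : C -> C, H0 mu f <-> B0 (w1 mu) f.

(* Compactness of S_g : X -> Y, where X, Y are spaces of analytic functions
   normed by the weighted sup norms with weights nu, mu:
   S_g maps X into Y, and the image of the closed unit ball of X is relatively
   (sequentially) compact in Y: every sequence in the unit ball of X has a
   subsequence whose images converge in the norm of Y to an element of Y. *)
Definition Sg_compact (g : C -> C) (X : (C -> C) -> Prop) (nu : R -> R)
    (Y : (C -> C) -> Prop) (mu : R -> R) : Prop :=
  (forall f, X f -> Y (Sg g f)) /\
  forall fs : nat -> C -> C,
    (forall n, X (fs n)) ->
    (forall n z, inD z -> wt nu z * Cmod (fs n z) <= 1) ->
    exists (phi : nat -> nat) (h : C -> C),
      (forall n, (phi n < phi (S n))%nat) /\ Y h /\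
      forall eps, 0 < eps -> exists N, forall n, (N <= n)%nat ->
        forall z, inD z -> wt mu z * Cmod (Sg g (fs (phi n)) z - h z) <= eps.

(* Main.v *)
(** The derivative of [S_g f] is [f' g], so compactness is read off from the
    quantity [mu (1 - |z|^2) |f' g|].  If [mu] is quasi-normal, the equality of
    sets [H0 mu = B0 mu_1] upgrades to norm estimates in both directions along
    null sequences, by a gliding hump argument; no closed graph theorem is needed.
    Property (U) and Cauchy's estimate give [nu (1 - |z|^2) |f'| <= C ||f||_nu];
    hence under (2.2) Montel's theorem yields a subsequence along which
    [mu (1 - |z|^2) |(S_g f_n - S_g f)'|] tends to zero uniformly, and so does
    [mu |S_g f_n - S_g f|].  Conversely, [S_g] is tested on the functions
    [(1 / nu a) ((1 - |a|^2) / (1 - conj a z)) ^ N], which are bounded in norm,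
    tend to zero locally uniformly as [|a| -> 1], and whose derivatives are of
    the maximal size [1 / (nu a (1 - |a|^2))] at [a].  They are bounded functions,
    so they lie in [H0 nu] when [nu] is typical.  For (1), where [nu] is arbitrary,
    the monomials [z ^ n] serve as test functions.

    Analyticity only means pointwise complex differentiability, so the classical
    function theory in the disk is derived from Goursat's lemma, applied in the
    coordinate [log w]. *)

(* Quasi-normality compares little spaces, whereas compactness produces functions of [Hinf mu] with
   no decay at the circle. Passing from [mu |G|] to [mu (1 - |z|^2) |G'|] therefore goes through
   dilations of [G]: they lie in [H0 mu] because the constant [1], having derivative zero, forces
   [mu] to vanish at the boundary. In the opposite direction membership comes for free, since the
   symbol condition puts [S_g f] in the little Bloch-type space for every [f] in [Hinf nu]. The hump
   is built from locally uniformly null sequences only; for images under [S_g] the normalisation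
   [S_g f (0) = 0] derives this from smallness of the derivatives. Both implications are stated for
   an arbitrary domain [X] and target [Y]: necessity asks that [X] contain the bounded test
   functions, sufficiency that [X] lie in [Hinf nu] and [Y] contain [H0 mu]. The pairs of big and of
   little spaces are then two instances of the same lemmas. *)
Require Import Defs.
From Stdlib Require Import Reals Lra Lia ClassicalEpsilon Classical.
From Coquelicot Require Import Coquelicot.
Open Scope R_scope.

(** * Complex differentiability *)

(* An epsilon-delta form of [is_derive] with [Cmod] on both sides: Coquelicot puts different
   uniform structures on [C] as a domain and as a codomain of a derivative. *)
Definition cdl (f : C -> C) (z l : C) : Prop :=
  forall eps, 0 < eps -> exists d, 0 < d /\ forall w, Cmod (w - z) < d ->
    Cmod (f w - f z - l * (w - z)) <= eps * Cmod (w - z).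

Lemma is_derive_cdl f z l :
  @is_derive C_AbsRing C_NormedModule f z l <-> cdl f z l.
Proof.
  split.
  - intros [_ H] eps Heps.
    destruct (H z (fun P HP => HP) (mkposreal eps Heps)) as [d Hd].
    exists d; split; [apply cond_pos|]. intros w Hw.
    specialize (Hd w Hw).
    change (Cmod (f w - f z - (w - z) * l) <= eps * Cmod (w - z)) in Hd.
    now rewrite (Cmult_comm l).
  - intros H. split; [apply is_linear_scal_l|].
    (* Domination is demanded at every limit point [x] of the neighbourhood filter of [z];
       separation identifies [x] with [z]. *)
    intros x Hx. apply (@is_filter_lim_locally_unique C_AbsRing (AbsRing_NormedModule C_AbsRing)) in Hx. subst x.
    intros [eps Heps]. destruct (H eps Heps) as [d [Hd1 Hd]].
    exists (mkposreal d Hd1). intros w Hw.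
    specialize (Hd w Hw).
    change (Cmod (f w - f z - (w - z) * l) <= eps * Cmod (w - z)).
    now rewrite (Cmult_comm _ l).
Qed.

Lemma Cmod_sym (a b : C) : Cmod (a - b) = Cmod (b - a).
Proof. rewrite <- Cmod_opp. f_equal. ring. Qed.

Lemma Cmod_triang_sub (a b : C) : Cmod (a - b) <= Cmod a + Cmod b.
Proof. rewrite <- (Cmod_opp b). apply Cmod_triangle. Qed.

Lemma Cmod_triang_rev (a b : C) : Cmod a - Cmod b <= Cmod (a - b).
Proof.
  pose proof (Cmod_triangle (a - b) b) as H.
  replace (a - b + b)%C with a in H by ring. lra.
Qed.

Lemma Cmod_dist_triang (a b c : C) : Cmod (a - c) <= Cmod (a - b) + Cmod (b - c).
Proof. replace (a - c)%C with ((a - b) + (b - c))%C by ring. apply Cmod_triangle. Qed.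

Lemma Cmod_eps_0 (z : C) : (forall eps, 0 < eps -> Cmod z <= eps) -> z = 0.
Proof.
  intros H. apply Cmod_eq_0. apply Rle_antisym; [|apply Cmod_ge_0].
  apply le_epsilon. intros e He. rewrite Rplus_0_l. now apply H.
Qed.

Definition ccont (f : C -> C) (z : C) : Prop :=
  forall eps, 0 < eps -> exists d, 0 < d /\ forall w, Cmod (w - z) < d ->
    Cmod (f w - f z) < eps.

Lemma cdl_ccont f z l : cdl f z l -> ccont f z.
Proof.
  intros H eps Heps. destruct (H 1 Rlt_0_1) as [d [Hd1 Hd]].
  set (K := 1 + Cmod l).
  assert (HK : 0 < K) by (unfold K; pose proof (Cmod_ge_0 l); lra).
  exists (Rmin d (eps / K)). split.
  { apply Rmin_pos; auto. now apply Rdiv_lt_0_compat. }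
  intros w Hw.
  assert (H1 := Hd w (Rlt_le_trans _ _ _ Hw (Rmin_l _ _))).
  assert (H2 := Rlt_le_trans _ _ _ Hw (Rmin_r _ _)).
  replace (f w - f z)%C with ((f w - f z - l * (w - z)) + l * (w - z))%C by ring.
  eapply Rle_lt_trans; [apply Cmod_triangle|]. rewrite Cmod_mult.
  apply Rle_lt_trans with (K * Cmod (w - z)); [unfold K; lra|].
  apply Rlt_le_trans with (K * (eps / K)); [now apply Rmult_lt_compat_l|].
  right. field. lra.
Qed.

Lemma cdl_affine c l z : cdl (fun w => c + l * w)%C z l.
Proof.
  intros eps Heps. exists 1. split; [lra|]. intros w _.
  replace (c + l * w - (c + l * z) - l * (w - z))%C with (RtoC 0) by ring.
  rewrite Cmod_0. pose proof (Cmod_ge_0 (w - z)). nra.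
Qed.

Lemma cdl_plus f g z l m : cdl f z l -> cdl g z m -> cdl (fun w => f w + g w)%C z (l + m).
Proof. rewrite <- !is_derive_cdl. apply @is_derive_plus. Qed.

Lemma cdl_minus f g z l m : cdl f z l -> cdl g z m -> cdl (fun w => f w - g w)%C z (l - m).
Proof. rewrite <- !is_derive_cdl. apply @is_derive_minus. Qed.

Lemma cdl_eq f z l m : cdl f z l -> l = m -> cdl f z m.
Proof. now intros ? <-. Qed.

Lemma cdl_ext_loc f g z l d : 0 < d -> (forall w, Cmod (w - z) < d -> f w = g w) ->
  cdl f z l -> cdl g z l.
Proof.
  intros Hd H. rewrite <- !is_derive_cdl. apply is_derive_ext_loc.
  exists (mkposreal d Hd). exact H.
Qed.

Lemma cdl_ext f g z l : (forall w, f w = g w) -> cdl f z l -> cdl g z l.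
Proof. intros H. apply (cdl_ext_loc f g z l 1); [lra|auto]. Qed.

Lemma cdl_const c z : cdl (fun _ => c) z 0.
Proof. apply (cdl_ext (fun w => c + 0 * w)%C); [intros; ring|apply cdl_affine]. Qed.

Lemma cdl_id z : cdl (fun w => w) z 1.
Proof. apply (cdl_ext (fun w => 0 + 1 * w)%C); [intros; ring|apply cdl_affine]. Qed.

Lemma cdl_mult f g z l m : cdl f z l -> cdl g z m ->
  cdl (fun w => f w * g w)%C z (l * g z + f z * m).
Proof.
  intros Hf Hg eps Heps.
  (* The four error terms below carry the coefficients [1], [|g z|], [|f z|] and [|l|]; the
     denominator is their sum plus a spare [1]. *)
  set (e := Rmin 1 (eps / (2 + Cmod (g z) + Cmod (f z) + Cmod l))).
  assert (HKp : 0 < 2 + Cmod (g z) + Cmod (f z) + Cmod l)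
    by (pose proof (Cmod_ge_0 (g z)); pose proof (Cmod_ge_0 (f z)); pose proof (Cmod_ge_0 l); lra).
  assert (He : 0 < e) by (apply Rmin_pos; [lra|now apply Rdiv_lt_0_compat]).
  destruct (Hf e He) as [d1 [Hd1 H1]]. destruct (Hg e He) as [d2 [Hd2 H2]].
  destruct (cdl_ccont g z m Hg e He) as [d3 [Hd3 H3]].
  exists (Rmin d1 (Rmin d2 d3)). split; [repeat apply Rmin_pos; auto|].
  intros w Hw.
  pose proof (Rmin_l d1 (Rmin d2 d3)). pose proof (Rmin_r d1 (Rmin d2 d3)).
  pose proof (Rmin_l d2 d3). pose proof (Rmin_r d2 d3).
  specialize (H1 w ltac:(lra)). specialize (H2 w ltac:(lra)). specialize (H3 w ltac:(lra)).
  replace (f w * g w - f z * g z - (l * g z + f z * m) * (w - z))%C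
    with ((f w - f z - l * (w - z)) * (g w - g z) + (f w - f z - l * (w - z)) * g z
       + f z * (g w - g z - m * (w - z)) + l * (w - z) * (g w - g z))%C by ring.
  set (A := (f w - f z - l * (w - z))%C) in *.
  set (B := (g w - g z - m * (w - z))%C) in *.
  set (D := (g w - g z)%C) in *. set (h := Cmod (w - z)) in *.
  pose proof (Cmod_ge_0 A). pose proof (Cmod_ge_0 B). pose proof (Cmod_ge_0 D).
  assert (0 <= h) by apply Cmod_ge_0.
  eapply Rle_trans; [apply Cmod_triangle|].
  apply Rle_trans with ((Cmod (A * D) + Cmod (A * g z)) + Cmod (f z * B) + Cmod (l * (w - z) * D)).
  { apply Rplus_le_compat_r. eapply Rle_trans; [apply Cmod_triangle|].
    apply Rplus_le_compat_r. apply Cmod_triangle. }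
  rewrite !Cmod_mult. fold h.
  pose proof (Cmod_ge_0 (g z)). pose proof (Cmod_ge_0 (f z)). pose proof (Cmod_ge_0 l).
  assert (e1 : e <= 1) by apply Rmin_l.
  assert (e2 : e * (2 + Cmod (g z) + Cmod (f z) + Cmod l) <= eps).
  { apply Rle_trans with (eps / (2 + Cmod (g z) + Cmod (f z) + Cmod l) * (2 + Cmod (g z) + Cmod (f z) + Cmod l)).
    - apply Rmult_le_compat_r; [lra|apply Rmin_r].
    - right; field; lra. }
  assert (Cmod A * Cmod D <= e * h * 1) by (apply Rmult_le_compat; lra).
  assert (Cmod A * Cmod (g z) <= e * h * Cmod (g z)) by (apply Rmult_le_compat_r; lra).
  assert (Cmod (f z) * Cmod B <= Cmod (f z) * (e * h)) by (apply Rmult_le_compat_l; lra).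
  assert (Cmod l * h * Cmod D <= Cmod l * h * e).
  { apply Rmult_le_compat_l; [now apply Rmult_le_pos|lra]. }
  assert (0 <= e * h) by (apply Rmult_le_pos; lra).
  assert (e * (2 + Cmod (g z) + Cmod (f z) + Cmod l) * h <= eps * h) by (apply Rmult_le_compat_r; lra).
  nra.
Qed.

Lemma cdl_scal c f z l : cdl f z l -> cdl (fun w => c * f w)%C z (c * l).
Proof.
  intros H. eapply cdl_eq; [apply (cdl_mult _ _ _ _ _ (cdl_const c z) H)|]. simpl; ring.
Qed.

Lemma cdl_comp f g z l m : cdl f (g z) l -> cdl g z m -> cdl (fun w => f (g w)) z (l * m).
Proof.
  intros Hf Hg eps Heps.
  set (K := 1 + Cmod m + Cmod l).
  assert (HK : 0 < K) by (unfold K; pose proof (Cmod_ge_0 m); pose proof (Cmod_ge_0 l); lra).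
  set (e := Rmin 1 (eps / K)).
  assert (He : 0 < e) by (apply Rmin_pos; [lra|now apply Rdiv_lt_0_compat]).
  assert (e1 : e <= 1) by apply Rmin_l.
  assert (e2 : e * K <= eps).
  { apply Rle_trans with (eps / K * K).
    - apply Rmult_le_compat_r; [lra|apply Rmin_r].
    - right; field; lra. }
  destruct (Hf e He) as [d1 [Hd1 H1]]. destruct (Hg e He) as [d2 [Hd2 H2]].
  destruct (cdl_ccont g z m Hg d1 Hd1) as [d3 [Hd3 H3]].
  exists (Rmin d2 d3). split; [apply Rmin_pos; auto|].
  intros w Hw. pose proof (Rmin_l d2 d3). pose proof (Rmin_r d2 d3).
  specialize (H2 w ltac:(lra)). specialize (H1 (g w) (H3 w ltac:(lra))).
  replace (f (g w) - f (g z) - l * m * (w - z))%C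
    with ((f (g w) - f (g z) - l * (g w - g z)) + l * (g w - g z - m * (w - z)))%C by ring.
  eapply Rle_trans; [apply Cmod_triangle|]. rewrite Cmod_mult.
  assert (Hg' : Cmod (g w - g z) <= (e + Cmod m) * Cmod (w - z)).
  { replace (g w - g z)%C with ((g w - g z - m * (w - z)) + m * (w - z))%C by ring.
    eapply Rle_trans; [apply Cmod_triangle|]. rewrite Cmod_mult. lra. }
  pose proof (Cmod_ge_0 (w - z)). pose proof (Cmod_ge_0 l). pose proof (Cmod_ge_0 m).
  assert (e * Cmod (g w - g z) <= e * ((1 + Cmod m) * Cmod (w - z))).
  { apply Rmult_le_compat_l; [lra|]. eapply Rle_trans; [exact Hg'|].
    apply Rmult_le_compat_r; lra. }
  assert (Cmod l * Cmod (g w - g z - m * (w - z)) <= Cmod l * (e * Cmod (w - z)))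
    by (apply Rmult_le_compat_l; lra).
  assert (e * K * Cmod (w - z) <= eps * Cmod (w - z)) by (apply Rmult_le_compat_r; lra).
  unfold K in *. nra.
Qed.

Lemma cdl_inv (z : C) : z <> 0 -> cdl Cinv z (- / (z * z)).
Proof.
  intros Hz eps Heps.
  assert (Hm : 0 < Cmod z) by exact (proj1 (Cmod_gt_0 z) Hz).
  set (m := Cmod z) in *.
  (* The radius [m / 2] keeps [|w| >= m / 2], hence [1 / |w z^2| <= 2 / m^3]; the second radius
     makes [|w - z|] times this at most [eps]. *)
  exists (Rmin (m / 2) (eps * (m * m * m) / 2)).
  split. { apply Rmin_pos; [lra|]. assert (0 < m * m) by nra. assert (0 < m * m * m) by nra.
    assert (0 < eps * (m * m * m)) by now apply Rmult_lt_0_compat. lra. }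
  intros w Hw. pose proof (Rmin_l (m / 2) (eps * (m * m * m) / 2)).
  pose proof (Rmin_r (m / 2) (eps * (m * m * m) / 2)).
  assert (Hw2 : m / 2 <= Cmod w).
  { pose proof (Cmod_triang_rev z (z - w)) as H2. rewrite (Cmod_sym z w) in H2.
    replace (z - (z - w))%C with w in H2 by ring. fold m in H2. lra. }
  assert (Hw0 : w <> 0) by (apply (proj2 (Cmod_gt_0 w)); lra).
  replace (/ w - / z - - / (z * z) * (w - z))%C
    with ((w - z) * ((w - z) * (/ w * / (z * z))))%C by (field; auto).
  rewrite Cmod_mult, (Rmult_comm eps). apply Rmult_le_compat_l; [apply Cmod_ge_0|].
  rewrite !Cmod_mult, !Cmod_inv, Cmod_mult by (auto; now apply Cmult_neq_0). fold m.
  apply Rle_trans with ((eps * (m * m * m) / 2) * (2 / m * / (m * m))).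
  - apply Rmult_le_compat; [apply Cmod_ge_0| |lra|].
    + apply Rmult_le_pos; left; apply Rinv_0_lt_compat; nra.
    + apply Rmult_le_compat_r; [left; apply Rinv_0_lt_compat; nra|].
      replace (2 / m) with (/ (m / 2)) by (field; lra).
      apply Rinv_le_contravar; lra.
  - right. field. lra.
Qed.

Lemma cdl_pow n (z : C) : cdl (fun w => w ^ n)%C z (INR n * z ^ (n - 1)).
Proof.
  induction n as [|n IH].
  - eapply cdl_eq; [apply (cdl_const 1)|]. simpl. ring.
  - eapply cdl_eq; [apply (cdl_mult _ _ _ _ _ (cdl_id z) IH)|].
    rewrite S_INR, RtoC_plus. destruct n as [|n]; [simpl; ring|].
    replace (S n - 1)%nat with n by lia. replace (S (S n) - 1)%nat with (S n) by lia.
    rewrite Cpow_S. ring.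
Qed.

Lemma cdl_unique f z l m : cdl f z l -> cdl f z m -> l = m.
Proof.
  intros H1 H2.
  assert (H : (l - m)%C = 0).
  { apply Cmod_eps_0. intros eps Heps.
    destruct (H1 (eps / 2) ltac:(lra)) as [d1 [Hd1 K1]].
    destruct (H2 (eps / 2) ltac:(lra)) as [d2 [Hd2 K2]].
    set (d := Rmin d1 d2 / 2). assert (Hd : 0 < d) by (unfold d; pose proof (Rmin_pos d1 d2 Hd1 Hd2); lra).
    pose proof (Rmin_l d1 d2). pose proof (Rmin_r d1 d2).
    assert (E : (z + RtoC d - z)%C = d) by ring.
    assert (Em : Cmod d = d) by (rewrite Cmod_R; apply Rabs_pos_eq; lra).
    specialize (K1 (z + RtoC d)%C). specialize (K2 (z + RtoC d)%C).
    rewrite E, Em in K1, K2. specialize (K1 ltac:(unfold d in *; lra)). specialize (K2 ltac:(unfold d in *; lra)).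
    apply Rmult_le_reg_r with d; auto. rewrite <- Em at 1. rewrite <- Cmod_mult.
    replace ((l - m) * d)%C with ((f (z + d) - f z - m * d) - (f (z + d) - f z - l * d))%C by ring.
    eapply Rle_trans; [apply Cmod_triang_sub|]. lra. }
  replace l with ((l - m) + m)%C by ring. rewrite H. ring.
Qed.

(** The value chosen by [cderiv] is pinned down by uniqueness of derivatives; every derivative below
    is computed through this. *)
Lemma cderiv_unique f z l : cdl f z l -> cderiv f z = l.
Proof.
  intros H. apply (cdl_unique f z); auto. apply is_derive_cdl. unfold cderiv.
  apply epsilon_spec. exists l. now apply is_derive_cdl.
Qed.

Lemma analytic_cdl f : analytic f <-> (forall z, inD z -> cdl f z (cderiv f z)).
Proof.
  split; intros H z Hz.
  - destruct (H z Hz) as [l Hl]. apply is_derive_cdl in Hl.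
    now rewrite (cderiv_unique f z l Hl).
  - exists (cderiv f z). apply is_derive_cdl. auto.
Qed.

Lemma analytic_intro f d : (forall z, inD z -> cdl f z (d z)) ->
  analytic f /\ forall z, inD z -> cderiv f z = d z.
Proof.
  intros H. split; [|intros z Hz; now apply cderiv_unique, H].
  apply analytic_cdl. intros z Hz. rewrite (cderiv_unique f z (d z)); auto.
Qed.

(** * Integrals of complex-valued functions *)

(** The invariant [P] may depend on the stage and [Q] links consecutive stages. This drives the
    subdivision in Goursat's lemma, the diagonal extraction, Montel's theorem and the gliding
    hump. *)
Lemma dependent_choice (A : Type) (P : nat -> A -> Prop) (Q : nat -> A -> A -> Prop) (x0 : A) :
  P 0%nat x0 ->
  (forall n x, P n x -> exists y, P (S n) y /\ Q n x y) ->
  exists u : nat -> A, u 0%nat = x0 /\ forall n, P n (u n) /\ Q n (u n) (u (S n)).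
Proof.
  intros H0 Hs.
  set (step n x := epsilon (inhabits x0) (fun y => P (S n) y /\ Q n x y)).
  set (u := fix u n := match n with O => x0 | S n => step n (u n) end).
  assert (HP : forall n, P n (u n)).
  { induction n as [|n IH]; [exact H0|]. simpl.
    apply (epsilon_spec (inhabits x0) (fun y => P (S n) y /\ Q n (u n) y) (Hs n _ IH)). }
  exists u. split; [reflexivity|]. intros n. split; [apply HP|].
  apply (epsilon_spec (inhabits x0) (fun y => P (S n) y /\ Q n (u n) y) (Hs n _ (HP n))).
Qed.

Definition rcont (f : R -> C) (t : R) : Prop :=
  forall eps, 0 < eps -> exists d, 0 < d /\ forall s, Rabs (s - t) < d ->
    Cmod (f s - f t) < eps.

(** Componentwise, so that [Sg g f z] is by definition [z] times such an integral. *)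
Definition CInt (f : R -> C) (a b : R) : C :=
  (RInt (fun t => fst (f t)) a b, RInt (fun t => snd (f t)) a b).

Lemma Rabs_fst_le z : Rabs (fst z) <= Cmod z.
Proof. eapply Rle_trans; [apply Rmax_l|apply Rmax_Cmod]. Qed.

Lemma Rabs_snd_le z : Rabs (snd z) <= Cmod z.
Proof. eapply Rle_trans; [apply Rmax_r|apply Rmax_Cmod]. Qed.

Lemma Cmod_le_abs z : Cmod z <= Rabs (fst z) + Rabs (snd z).
Proof.
  destruct z as [x y]. simpl.
  replace ((x, y) : C) with (RtoC x + Ci * RtoC y)%C by (unfold RtoC, Ci, Cmult, Cplus; simpl; f_equal; ring).
  eapply Rle_trans; [apply Cmod_triangle|]. rewrite Cmod_mult, Cmod_Ci, !Cmod_R. lra.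
Qed.

Lemma rcont_fst f t : rcont f t -> continuous (fun t => fst (f t)) t.
Proof.
  intros H. apply continuity_pt_filterlim. intros eps Heps. destruct (H eps Heps) as [d [Hd1 Hd]].
  exists d. split; auto. intros x [_ Hx]. specialize (Hd x Hx).
  eapply Rle_lt_trans; [|exact Hd]. apply (Rabs_fst_le (f x - f t)%C).
Qed.

Lemma rcont_snd f t : rcont f t -> continuous (fun t => snd (f t)) t.
Proof.
  intros H. apply continuity_pt_filterlim. intros eps Heps. destruct (H eps Heps) as [d [Hd1 Hd]].
  exists d. split; auto. intros x [_ Hx]. specialize (Hd x Hx).
  eapply Rle_lt_trans; [|exact Hd]. apply (Rabs_snd_le (f x - f t)%C).
Qed.

Definition rcont_on f a b := forall t, a <= t <= b -> rcont f t.

Lemma rcont_on_ex f a b : a <= b -> rcont_on f a b ->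
  ex_RInt (fun t => fst (f t)) a b /\ ex_RInt (fun t => snd (f t)) a b.
Proof.
  intros Hab H. split; apply @ex_RInt_continuous; intros t Ht;
  rewrite Rmin_left, Rmax_right in Ht by auto; [apply rcont_fst|apply rcont_snd]; auto.
Qed.

(** Bounding the two components separately would lose a factor. The pair is also the integral in the
    product module, whose norm is [Cmod], and this gives the sharp constant. *)
Lemma CInt_bound f a b M : a <= b -> rcont_on f a b ->
  (forall t, a <= t <= b -> Cmod (f t) <= M) -> Cmod (CInt f a b) <= (b - a) * M.
Proof.
  intros Hab Hf HM. destruct (rcont_on_ex f a b Hab Hf) as [E1 E2].
  assert (Hn : forall z : C, @norm R_AbsRing C_R_NormedModule z = Cmod z).
  { intros z. unfold norm. simpl. unfold prod_norm, Cmod. simpl. unfold norm. simpl. unfold abs. simpl.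
    f_equal. rewrite !Rmult_1_r, <- !Rabs_mult, !Rabs_pos_eq by nra. ring. }
  rewrite <- Hn.
  apply (@norm_RInt_le_const C_R_NormedModule f a b (CInt f a b) M Hab).
  - intros x Hx. rewrite Hn. auto.
  - apply (@is_RInt_fct_extend_pair R_NormedModule R_NormedModule f).
    + exact (RInt_correct _ _ _ E1).
    + exact (RInt_correct _ _ _ E2).
Qed.

Lemma CInt_ext f g a b : a <= b -> (forall t, a <= t <= b -> f t = g t) -> CInt f a b = CInt g a b.
Proof.
  intros Hab H. unfold CInt. f_equal; apply RInt_ext; intros t Ht;
  rewrite Rmin_left, Rmax_right in Ht by auto; rewrite H; auto; lra.
Qed.

Lemma CInt_minus f g a b : a <= b -> rcont_on f a b -> rcont_on g a b ->
  CInt (fun t => f t - g t)%C a b = (CInt f a b - CInt g a b)%C.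
Proof.
  intros Hab Hf Hg. destruct (rcont_on_ex f a b Hab Hf). destruct (rcont_on_ex g a b Hab Hg).
  unfold CInt, Cminus, Cplus, Copp. simpl. f_equal; now apply (RInt_minus (V := R_CompleteNormedModule)).
Qed.

Lemma CInt_scal c f a b : a <= b -> rcont_on f a b ->
  CInt (fun t => c * f t)%C a b = (c * CInt f a b)%C.
Proof.
  intros Hab Hf. destruct (rcont_on_ex f a b Hab Hf) as [E1 E2].
  unfold CInt, Cmult. simpl. f_equal.
  - rewrite <- !(RInt_scal (V := R_CompleteNormedModule)) by auto.
    apply (RInt_minus (V := R_CompleteNormedModule)); now apply (ex_RInt_scal (V := R_CompleteNormedModule)).
  - rewrite <- !(RInt_scal (V := R_CompleteNormedModule)) by auto.
    apply (RInt_plus (V := R_CompleteNormedModule)); now apply (ex_RInt_scal (V := R_CompleteNormedModule)).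
Qed.

Lemma CInt_split f a b c : a <= b -> b <= c -> rcont_on f a c ->
  CInt f a c = (CInt f a b + CInt f b c)%C.
Proof.
  intros Hab Hbc Hf.
  destruct (rcont_on_ex f a b Hab) as [E1 E2]; [intros t Ht; apply Hf; lra|].
  destruct (rcont_on_ex f b c Hbc) as [E3 E4]; [intros t Ht; apply Hf; lra|].
  unfold CInt, Cplus. simpl. f_equal; symmetry; now apply (RInt_Chasles (V := R_CompleteNormedModule)).
Qed.

Lemma RInt_shift (f : R -> R) (a b v : R) : ex_RInt f (a + v) (b + v) ->
  RInt (fun t => f (t + v)) a b = RInt f (a + v) (b + v).
Proof.
  intros H. pose proof (RInt_comp_lin (V := R_CompleteNormedModule) f 1 v a b) as K.
  rewrite !Rmult_1_l in K. rewrite <- K; auto. apply RInt_ext. intros x _.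
  unfold scal; simpl; unfold mult; simpl. now rewrite !Rmult_1_l.
Qed.

Lemma CInt_shift f a b v : a <= b -> rcont_on f (a + v) (b + v) ->
  CInt (fun t => f (t + v)) a b = CInt f (a + v) (b + v).
Proof.
  intros Hab H. destruct (rcont_on_ex f (a + v) (b + v) ltac:(lra) H) as [E1 E2].
  unfold CInt. f_equal; [now apply (RInt_shift (fun t => fst (f t)))|now apply (RInt_shift (fun t => snd (f t)))].
Qed.

Definition rdl (f : R -> C) (t : R) (l : C) : Prop :=
  forall eps, 0 < eps -> exists d, 0 < d /\ forall s, Rabs (s - t) < d ->
    Cmod (f s - f t - l * RtoC (s - t)) <= eps * Rabs (s - t).

Lemma rdl_fst f t l : rdl f t l -> is_derive (fun t => fst (f t)) t (fst l).
Proof.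
  intros H. apply is_derive_Reals. intros eps Heps.
  destruct (H (eps / 2) ltac:(lra)) as [d [Hd1 Hd]]. exists (mkposreal d Hd1). intros h Hh0 Hh. simpl in Hh.
  specialize (Hd (t + h)). replace (t + h - t) with h in Hd by ring. specialize (Hd Hh).
  pose proof (Rle_trans _ _ _ (Rabs_fst_le _) Hd) as K. simpl in K.
  replace ((fst (f (t + h)) - fst (f t)) / h - fst l)
    with ((fst (f (t + h)) + - fst (f t) + - (fst l * h - snd l * 0)) / h) by (field; auto).
  rewrite Rabs_div by auto. assert (0 < Rabs h) by now apply Rabs_pos_lt.
  apply Rmult_lt_reg_r with (Rabs h); auto. unfold Rdiv at 1. rewrite Rmult_assoc, Rinv_l by lra. nra.
Qed.

Lemma rdl_snd f t l : rdl f t l -> is_derive (fun t => snd (f t)) t (snd l).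
Proof.
  intros H. apply is_derive_Reals. intros eps Heps.
  destruct (H (eps / 2) ltac:(lra)) as [d [Hd1 Hd]]. exists (mkposreal d Hd1). intros h Hh0 Hh. simpl in Hh.
  specialize (Hd (t + h)). replace (t + h - t) with h in Hd by ring. specialize (Hd Hh).
  pose proof (Rle_trans _ _ _ (Rabs_snd_le _) Hd) as K. simpl in K.
  replace ((snd (f (t + h)) - snd (f t)) / h - snd l)
    with ((snd (f (t + h)) + - snd (f t) + - (fst l * 0 + snd l * h)) / h) by (field; auto).
  rewrite Rabs_div by auto. assert (0 < Rabs h) by now apply Rabs_pos_lt.
  apply Rmult_lt_reg_r with (Rabs h); auto. unfold Rdiv at 1. rewrite Rmult_assoc, Rinv_l by lra. nra.
Qed.

Lemma CInt_derive f df a b : a <= b -> (forall t, a <= t <= b -> rdl f t (df t)) -> rcont_on df a b ->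
  CInt df a b = (f b - f a)%C.
Proof.
  intros Hab Hf Hdf. unfold CInt, Cminus, Cplus, Copp. simpl. f_equal.
  - apply is_RInt_unique. apply (is_RInt_derive (V := R_CompleteNormedModule) (fun t => fst (f t)));
    intros x Hx; rewrite Rmin_left, Rmax_right in Hx by auto; [apply rdl_fst|apply rcont_fst]; auto.
  - apply is_RInt_unique. apply (is_RInt_derive (V := R_CompleteNormedModule) (fun t => snd (f t)));
    intros x Hx; rewrite Rmin_left, Rmax_right in Hx by auto; [apply rdl_snd|apply rcont_snd]; auto.
Qed.

Lemma cdl_rdl_line f (p v l : C) (t : R) : cdl f (p + v * t)%C l ->
  rdl (fun t => f (p + v * RtoC t)%C) t (v * l)%C.
Proof.
  intros H.
  assert (K : cdl (fun w => f (p + v * w)%C) t (l * v)%C).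
  { apply (cdl_comp f (fun w => p + v * w)%C); auto. apply cdl_affine. }
  intros eps Heps. destruct (K eps Heps) as [d [Hd1 Hd]]. exists d. split; auto.
  intros s Hs. specialize (Hd (RtoC s)). rewrite <- RtoC_minus, Cmod_R in Hd.
  rewrite (Cmult_comm v l). auto.
Qed.

Lemma ccont_rcont_line f (p v : C) (t : R) : ccont f (p + v * t)%C -> rcont (fun t => f (p + v * RtoC t)%C) t.
Proof.
  intros H eps Heps. destruct (H eps Heps) as [d [Hd1 Hd]].
  assert (Hk : 0 < 1 + Cmod v) by (pose proof (Cmod_ge_0 v); lra).
  exists (d / (1 + Cmod v)). split; [now apply Rdiv_lt_0_compat|].
  intros s Hs. apply Hd. replace (p + v * s - (p + v * t))%C with (v * RtoC (s - t))%C by (rewrite RtoC_minus; ring).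
  rewrite Cmod_mult, Cmod_R. pose proof (Rabs_pos (s - t)).
  apply Rle_lt_trans with ((1 + Cmod v) * Rabs (s - t)); [pose proof (Cmod_ge_0 v); nra|].
  apply Rlt_le_trans with ((1 + Cmod v) * (d / (1 + Cmod v))); [now apply Rmult_lt_compat_l|].
  right; field; lra.
Qed.

Lemma rcont_scal c f t : rcont f t -> rcont (fun t => c * f t)%C t.
Proof.
  intros H eps Heps. assert (Hk : 0 < 1 + Cmod c) by (pose proof (Cmod_ge_0 c); lra).
  destruct (H (eps / (1 + Cmod c))) as [d [Hd1 Hd]]; [now apply Rdiv_lt_0_compat|].
  exists d. split; auto. intros s Hs. specialize (Hd s Hs).
  replace (c * f s - c * f t)%C with (c * (f s - f t))%C by ring. rewrite Cmod_mult.
  pose proof (Cmod_ge_0 (f s - f t)). pose proof (Cmod_ge_0 c).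
  apply Rle_lt_trans with ((1 + Cmod c) * Cmod (f s - f t)); [nra|].
  apply Rlt_le_trans with ((1 + Cmod c) * (eps / (1 + Cmod c))); [now apply Rmult_lt_compat_l|].
  right; field; lra.
Qed.

Lemma CInt_line f df (p v : C) a b : a <= b ->
  (forall t : R, a <= t <= b -> cdl f (p + v * t)%C (df (p + v * t)%C)) ->
  (forall t : R, a <= t <= b -> ccont df (p + v * t)%C) ->
  (v * CInt (fun t => df (p + v * t)%C) a b)%C = (f (p + v * b) - f (p + v * a))%C.
Proof.
  intros Hab Hf Hdf.
  assert (H1 : rcont_on (fun t => df (p + v * t)%C) a b) by (intros t Ht; apply (ccont_rcont_line df); auto).
  rewrite <- CInt_scal by auto.
  rewrite (CInt_derive (fun t => f (p + v * t)%C)); auto.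
  - intros t Ht. apply (cdl_rdl_line f). auto.
  - intros t Ht. apply rcont_scal. auto.
Qed.

(** * Goursat's lemma *)

Definition line_int (f : C -> C) (p v : C) (h : R) : C :=
  (v * CInt (fun t => f (p + v * RtoC t)%C) 0 h)%C.

(** The counterclockwise boundary integral: the top and left sides are parametrised forwards and
    subtracted. *)
Definition rect_int (f : C -> C) (p : C) (A B : R) : C :=
  (line_int f p 1 A + line_int f (p + A) Ci B
   - line_int f (p + Ci * B) 1 A - line_int f p Ci B)%C.

Definition in_rect (p : C) (A B : R) (w : C) : Prop :=
  exists x y, 0 <= x <= A /\ 0 <= y <= B /\ w = (p + RtoC x + Ci * RtoC y)%C.

Definition line_cont (f : C -> C) (p v : C) (h : R) : Prop :=
  forall t, 0 <= t <= h -> ccont f (p + v * RtoC t)%C.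

Lemma line_cont_rcont f p v h : line_cont f p v h -> rcont_on (fun t => f (p + v * RtoC t)%C) 0 h.
Proof. intros H t Ht. apply ccont_rcont_line. auto. Qed.

Lemma line_int_split f p v a b : 0 <= a -> 0 <= b -> line_cont f p v (a + b) ->
  line_int f p v (a + b) = (line_int f p v a + line_int f (p + v * a) v b)%C.
Proof.
  intros Ha Hb H. unfold line_int.
  rewrite (CInt_split _ 0 a (a + b)); [|lra|lra|now apply line_cont_rcont].
  replace (CInt (fun t => f (p + v * a + v * t)%C) 0 b) with (CInt (fun t => f (p + v * t)%C) a (a + b)); [ring|].
  pose proof (CInt_shift (fun t => f (p + v * RtoC t)%C) 0 b a Hb) as K.
  rewrite Rplus_0_l, (Rplus_comm b a) in K. rewrite <- K.
  - apply CInt_ext; auto. intros t _. f_equal. rewrite RtoC_plus. ring.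
  - intros t Ht. apply (line_cont_rcont _ _ _ _ H). lra.
Qed.

Lemma line_int_bound f p v h M : 0 <= h -> line_cont f p v h ->
  (forall t, 0 <= t <= h -> Cmod (f (p + v * RtoC t)%C) <= M) ->
  Cmod (line_int f p v h) <= Cmod v * (h * M).
Proof.
  intros Hh Hc HM. unfold line_int. rewrite Cmod_mult.
  apply Rmult_le_compat_l; [apply Cmod_ge_0|].
  replace h with (h - 0) at 2 by ring. apply CInt_bound; auto. now apply line_cont_rcont.
Qed.

Lemma line_int_minus f g p v h : 0 <= h -> line_cont f p v h -> line_cont g p v h ->
  line_int (fun w => f w - g w)%C p v h = (line_int f p v h - line_int g p v h)%C.
Proof.
  intros Hh Hf Hg. unfold line_int. rewrite CInt_minus; auto; [ring| |]; now apply line_cont_rcont.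
Qed.

Definition rect_cont (f : C -> C) (p : C) (A B : R) : Prop :=
  forall w, in_rect p A B w -> ccont f w.

Lemma in_rect_intro p A B x y w : 0 <= x <= A -> 0 <= y <= B ->
  w = (p + RtoC x + Ci * RtoC y)%C -> in_rect p A B w.
Proof. intros Hx Hy H. exists x, y. auto. Qed.

Lemma rect_edge_1 p A B t : 0 <= t <= A -> 0 <= B -> in_rect p A B (p + 1 * RtoC t)%C.
Proof. intros. apply (in_rect_intro p A B t 0); [lra|lra|ring]. Qed.
Lemma rect_edge_2 p A B t : 0 <= A -> 0 <= t <= B -> in_rect p A B (p + A + Ci * RtoC t)%C.
Proof. intros. apply (in_rect_intro p A B A t); [lra|lra|ring]. Qed.
Lemma rect_edge_3 p A B t : 0 <= t <= A -> 0 <= B -> in_rect p A B (p + Ci * B + 1 * RtoC t)%C.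
Proof. intros. apply (in_rect_intro p A B t B); [lra|lra|ring]. Qed.
Lemma rect_edge_4 p A B t : 0 <= A -> 0 <= t <= B -> in_rect p A B (p + Ci * RtoC t)%C.
Proof. intros. apply (in_rect_intro p A B 0 t); [lra|lra|ring]. Qed.

Lemma rect_int_bound f p A B M : 0 <= A -> 0 <= B -> rect_cont f p A B ->
  (forall w, in_rect p A B w -> Cmod (f w) <= M) ->
  Cmod (rect_int f p A B) <= 2 * (A + B) * M.
Proof.
  intros HA HB Hc HM.
  assert (K1 : Cmod (line_int f p 1 A) <= Cmod 1 * (A * M)).
  { apply line_int_bound; auto; intros t Ht; [apply Hc|apply HM]; now apply rect_edge_1. }
  assert (K2 : Cmod (line_int f (p + A) Ci B) <= Cmod Ci * (B * M)).
  { apply line_int_bound; auto; intros t Ht; [apply Hc|apply HM]; now apply rect_edge_2. }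
  assert (K3 : Cmod (line_int f (p + Ci * B) 1 A) <= Cmod 1 * (A * M)).
  { apply line_int_bound; auto; intros t Ht; [apply Hc|apply HM]; now apply rect_edge_3. }
  assert (K4 : Cmod (line_int f p Ci B) <= Cmod Ci * (B * M)).
  { apply line_int_bound; auto; intros t Ht; [apply Hc|apply HM]; now apply rect_edge_4. }
  rewrite Cmod_1 in K1, K3. rewrite Cmod_Ci in K2, K4.
  unfold rect_int.
  eapply Rle_trans; [apply Cmod_triang_sub|].
  eapply Rle_trans; [apply Rplus_le_compat_r, Cmod_triang_sub|].
  eapply Rle_trans; [apply Rplus_le_compat_r, Rplus_le_compat_r, Cmod_triangle|]. lra.
Qed.

Lemma rect_int_minus f g p A B : 0 <= A -> 0 <= B -> rect_cont f p A B -> rect_cont g p A B ->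
  rect_int (fun w => f w - g w)%C p A B = (rect_int f p A B - rect_int g p A B)%C.
Proof.
  intros HA HB Hf Hg. unfold rect_int.
  rewrite !line_int_minus; auto; [ring|..]; intros t Ht; first [apply Hf|apply Hg];
  first [now apply rect_edge_1|now apply rect_edge_2|now apply rect_edge_3|now apply rect_edge_4].
Qed.

(** Each side contributes the difference of the values of [Q] at its ends, and these cancel around
    the rectangle. *)
Lemma rect_int_derivative Q q p A B : 0 <= A -> 0 <= B ->
  (forall w, cdl Q w (q w)) -> (forall w, ccont q w) -> rect_int q p A B = 0.
Proof.
  intros HA HB H1 H2. unfold rect_int, line_int.
  rewrite !(CInt_line Q) by auto.
  replace (p + A + Ci * B)%C with (p + Ci * B + 1 * A)%C by ring.
  replace (p + A + Ci * 0)%C with (p + 1 * A)%C by ring.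
  replace (p + Ci * B + 1 * 0)%C with (p + Ci * B)%C by ring.
  replace (p + 1 * 0)%C with (p + Ci * 0)%C by ring. ring.
Qed.

Lemma rect_int_affine (c l : C) p A B : 0 <= A -> 0 <= B -> rect_int (fun w => c + l * w)%C p A B = 0.
Proof.
  intros HA HB.
  apply (rect_int_derivative (fun w => c * w + RtoC (/ 2) * l * (w * w))%C); auto.
  - intros w. eapply cdl_eq.
    + apply cdl_plus; [apply cdl_scal, cdl_id|]. apply cdl_scal, cdl_mult; apply cdl_id.
    + transitivity (c + l * w * RtoC (/ 2 + / 2))%C; [rewrite RtoC_plus; ring|].
      replace (/ 2 + / 2) with 1 by field. ring.
  - intros w. eapply cdl_ccont, cdl_affine.
Qed.

Lemma rect_int_quarter f p a b : 0 <= a -> 0 <= b -> rect_cont f p (a + a) (b + b) ->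
  rect_int f p (a + a) (b + b) =
   (rect_int f p a b + rect_int f (p + a) a b + rect_int f (p + Ci * b) a b + rect_int f (p + a + Ci * b) a b)%C.
Proof.
  intros Ha Hb Hc. unfold rect_int.
  rewrite !line_int_split; auto.
  - replace (p + RtoC (a + a) + Ci * b)%C with (p + a + Ci * b + a)%C by (rewrite RtoC_plus; ring).
    replace (p + RtoC (a + a))%C with (p + a + a)%C by (rewrite RtoC_plus; ring).
    replace (p + Ci * RtoC (b + b) + 1 * a)%C with (p + a + Ci * b + Ci * b)%C by (rewrite RtoC_plus; ring).
    replace (p + Ci * RtoC (b + b))%C with (p + Ci * b + Ci * b)%C by (rewrite RtoC_plus; ring).
    replace (p + Ci * b + a)%C with (p + a + Ci * b)%C by ring.
    replace (p + 1 * a)%C with (p + a)%C by ring.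
    ring.
  - intros t Ht. apply Hc. apply rect_edge_4; auto; lra.
  - intros t Ht. apply Hc. apply rect_edge_3; auto; lra.
  - intros t Ht. apply Hc. apply rect_edge_2; auto; lra.
  - intros t Ht. apply Hc. apply rect_edge_1; auto; lra.
Qed.

Lemma in_rect_sub p A B a b x y w : 0 <= x -> 0 <= y -> x + a <= A -> y + b <= B ->
  in_rect (p + RtoC x + Ci * RtoC y)%C a b w -> in_rect p A B w.
Proof.
  intros Hx Hy Ha Hb [s [t [Hs [Ht ->]]]].
  apply (in_rect_intro p A B (x + s) (y + t)); [lra|lra|]. rewrite !RtoC_plus. ring.
Qed.

Lemma in_rect_dist p A B w z : in_rect p A B w -> in_rect p A B z -> Cmod (w - z) <= A + B.
Proof.
  intros [s [t [Hs [Ht ->]]]] [s' [t' [Hs' [Ht' ->]]]].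
  replace (p + s + Ci * t - (p + s' + Ci * t'))%C with (RtoC (s - s') + Ci * RtoC (t - t'))%C
    by (rewrite !RtoC_minus; ring).
  eapply Rle_trans; [apply Cmod_triangle|]. rewrite Cmod_mult, Cmod_Ci, !Cmod_R.
  assert (Rabs (s - s') <= A) by (apply Rabs_le; lra).
  assert (Rabs (t - t') <= B) by (apply Rabs_le; lra). lra.
Qed.

(** The left ends increase and lie below every right end, so their supremum belongs to all the
    intervals. *)
Lemma nested_intervals (x : nat -> R) (A : R) : 0 <= A ->
  (forall n, x n <= x (S n) /\ x (S n) + A / 2 ^ S n <= x n + A / 2 ^ n) ->
  exists q, forall n, x n <= q <= x n + A / 2 ^ n.
Proof.
  intros HA H.
  assert (Hmon : forall n k, x n <= x (n + k)%nat /\ x (n + k)%nat + A / 2 ^ (n + k) <= x n + A / 2 ^ n).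
  { intros n k. induction k as [|k IH]; [rewrite Nat.add_0_r; lra|].
    rewrite Nat.add_succ_r. specialize (H (n + k)%nat). lra. }
  assert (Hpos : forall n, 0 <= A / 2 ^ n).
  { intros n. apply Rle_mult_inv_pos; auto. apply pow_lt. lra. }
  assert (Hall : forall m n, x m <= x n + A / 2 ^ n).
  { intros m n. destruct (Nat.le_ge_cases m n) as [Hmn|Hmn].
    - replace n with (m + (n - m))%nat by lia. destruct (Hmon m (n - m)%nat). pose proof (Hpos (m + (n - m))%nat). lra.
    - replace m with (n + (m - n))%nat by lia. destruct (Hmon n (m - n)%nat). pose proof (Hpos (n + (m - n))%nat). lra. }
  destruct (completeness (fun y => exists n, y = x n)) as [q [Hq1 Hq2]].
  - exists (x 0%nat + A / 2 ^ 0). intros y [n ->]. apply Hall.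
  - exists (x 0%nat), 0%nat. reflexivity.
  - exists q. intros n. split; [apply Hq1; now exists n|].
    apply Hq2. intros y [m ->]. apply Hall.
Qed.

(** Suppose the integral exceeds [eps (A + B)^2] in modulus. Halving the sides divides this bound by
    four, so one of the four quarters violates it again, and the nested violators shrink to a point
    [q]. Near [q] the function is affine up to [eps / 2] times the distance; the affine part
    integrates to zero and the error is too small for a violation. *)
Lemma rect_int_goursat f p A B : 0 <= A -> 0 <= B ->
  (forall w, in_rect p A B w -> exists l, cdl f w l) -> rect_int f p A B = 0.
Proof.
  intros HA HB Hd.
  assert (Hc : rect_cont f p A B).
  { intros w Hw. destruct (Hd w Hw) as [l Hl]. eapply cdl_ccont; eauto. }
  apply Cmod_eps_0. intros eps0 Heps0.
  (* The summand [1] covers the rectangle with both sides zero. *)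
  set (eps := eps0 / (1 + (A + B) * (A + B))).
  assert (Hk : 0 < 1 + (A + B) * (A + B)) by nra.
  assert (Heps : 0 < eps) by now apply Rdiv_lt_0_compat.
  apply Rle_trans with (eps * ((A + B) * (A + B))).
  2:{ apply Rle_trans with (eps * (1 + (A + B) * (A + B))); [nra|]. unfold eps. right. field. lra. }
  apply Rnot_lt_le. intros Hbad.
  set (An n := A / 2 ^ n). set (Bn n := B / 2 ^ n).
  assert (H2n : forall n, 0 < 2 ^ n) by (intros; apply pow_lt; lra).
  assert (HAn : forall n, 0 <= An n) by (intros; apply Rle_mult_inv_pos; auto).
  assert (HBn : forall n, 0 <= Bn n) by (intros; apply Rle_mult_inv_pos; auto).
  assert (EA : forall n, An n = An (S n) + An (S n)).
  { intros n. unfold An. simpl. field. pose proof (H2n n). lra. }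
  assert (EB : forall n, Bn n = Bn (S n) + Bn (S n)).
  { intros n. unfold Bn. simpl. field. pose proof (H2n n). lra. }
  set (pt (u : R * R) := (p + RtoC (fst u) + Ci * RtoC (snd u))%C).
  (* The state is the offset from [p] of the lower left corner of the rectangle at stage [n], whose
     sides are [An n] and [Bn n]. *)
  destruct (dependent_choice (R * R)
    (fun n u => 0 <= fst u /\ fst u + An n <= A /\ 0 <= snd u /\ snd u + Bn n <= B /\
        eps * ((An n + Bn n) * (An n + Bn n)) < Cmod (rect_int f (pt u) (An n) (Bn n)))
    (fun n u v => (fst v = fst u \/ fst v = fst u + An (S n)) /\ (snd v = snd u \/ snd v = snd u + Bn (S n)))
    (0, 0)) as [u [_ Hu]].
  { simpl. unfold An, Bn, pt. simpl. rewrite !Rdiv_1_r. repeat split; try lra.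
    replace (p + 0 + Ci * 0)%C with p by ring. lra. }
  { intros n [x y] [Hx [HxA [Hy [HyB Hb]]]]. simpl in *.
    rewrite (EA n), (EB n) in Hb. rewrite (EA n) in HxA. rewrite (EB n) in HyB.
    set (a := An (S n)) in *. set (b := Bn (S n)) in *.
    assert (Ha0 : 0 <= a) by apply HAn. assert (Hb0 : 0 <= b) by apply HBn.
    rewrite rect_int_quarter in Hb; auto.
    2:{ intros w Hw. apply Hc. eapply in_rect_sub; [| | | |exact Hw]; simpl; lra. }
    assert (E1 : (pt (x, y) + a)%C = pt ((x + a)%R, y)) by (unfold pt, fst, snd; rewrite RtoC_plus; ring).
    assert (E2 : (pt (x, y) + Ci * b)%C = pt (x, (y + b)%R)) by (unfold pt, fst, snd; rewrite RtoC_plus; ring).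
    assert (E3 : (pt ((x + a)%R, y) + Ci * b)%C = pt ((x + a)%R, (y + b)%R)) by (unfold pt, fst, snd; rewrite (RtoC_plus y b); ring).
    rewrite E1, E2, E3 in Hb.
    destruct (Rlt_le_dec (eps * ((a + b) * (a + b))) (Cmod (rect_int f (pt (x, y)) a b))) as [L1|L1].
    { exists (x, y). simpl. split; [repeat split; lra|auto]. }
    destruct (Rlt_le_dec (eps * ((a + b) * (a + b))) (Cmod (rect_int f (pt ((x + a)%R, y)) a b))) as [L2|L2].
    { exists ((x + a)%R, y). simpl. split; [repeat split; lra|auto]. }
    destruct (Rlt_le_dec (eps * ((a + b) * (a + b))) (Cmod (rect_int f (pt (x, (y + b)%R)) a b))) as [L3|L3].
    { exists (x, (y + b)%R). simpl. split; [repeat split; lra|auto]. }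
    destruct (Rlt_le_dec (eps * ((a + b) * (a + b))) (Cmod (rect_int f (pt ((x + a)%R, (y + b)%R)) a b))) as [L4|L4].
    { exists ((x + a)%R, (y + b)%R). simpl. split; [repeat split; lra|auto]. }
    exfalso. revert Hb. apply Rle_not_lt.
    eapply Rle_trans; [apply Cmod_triangle|].
    eapply Rle_trans; [apply Rplus_le_compat_r, Cmod_triangle|].
    eapply Rle_trans; [apply Rplus_le_compat_r, Rplus_le_compat_r, Cmod_triangle|]. nra. }
  destruct (nested_intervals (fun n => fst (u n)) A HA) as [qx Hqx].
  { intros n. destruct (Hu n) as [_ [[-> | ->] _]]; fold (An n) (An (S n)); rewrite (EA n); pose proof (HAn (S n)); lra. }
  destruct (nested_intervals (fun n => snd (u n)) B HB) as [qy Hqy].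
  { intros n. destruct (Hu n) as [_ [_ [-> | ->]]]; fold (Bn n) (Bn (S n)); rewrite (EB n); pose proof (HBn (S n)); lra. }
  set (q := pt (qx, qy)).
  assert (Hqin : forall n, in_rect (pt (u n)) (An n) (Bn n) q).
  { intros n. specialize (Hqx n). specialize (Hqy n). fold (An n) in Hqx. fold (Bn n) in Hqy.
    apply (in_rect_intro _ _ _ (qx - fst (u n)) (qy - snd (u n))); [lra|lra|].
    unfold q, pt. simpl. rewrite !RtoC_minus. ring. }
  assert (Hsub : forall n w, in_rect (pt (u n)) (An n) (Bn n) w -> in_rect p A B w).
  { intros n w Hw. destruct (Hu n) as [[? [? [? [? ?]]]] _]. eapply in_rect_sub; [| | | |exact Hw]; auto. }
  destruct (Hd q (Hsub 0%nat q (Hqin 0%nat))) as [l Hl].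
  (* Half of [eps], because the perimeter is [2 (An N + Bn N)] while distances to [q] are at most
     [An N + Bn N]. *)
  destruct (Hl (eps / 2) ltac:(lra)) as [d [Hd1 Hdd]].
  destruct (pow_lt_1_zero (/2) ltac:(rewrite Rabs_pos_eq; lra) (d / (1 + A + B))) as [N HN].
  { apply Rdiv_lt_0_compat; lra. }
  specialize (HN N (Nat.le_refl N)). rewrite Rabs_pos_eq in HN by (apply pow_le; lra).
  assert (Hsmall : An N + Bn N < d).
  { unfold An, Bn, Rdiv. rewrite <- Rmult_plus_distr_r, <- pow_inv.
    apply Rle_lt_trans with ((1 + A + B) * (/2) ^ N).
    - apply Rmult_le_compat_r; [apply pow_le; lra|lra].
    - apply Rlt_le_trans with ((1 + A + B) * (d / (1 + A + B))); [apply Rmult_lt_compat_l; lra|].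
      right; field; lra. }
  destruct (Hu N) as [[_ [_ [_ [_ Hb]]]] _].
  revert Hb. apply Rle_not_lt.
  assert (HcN : rect_cont f (pt (u N)) (An N) (Bn N)) by (intros w Hw; apply Hc; eauto).
  pose proof (rect_int_affine (f q - l * q) l (pt (u N)) (An N) (Bn N) (HAn N) (HBn N)) as Haff.
  assert (Hca : rect_cont (fun w => f q - l * q + l * w)%C (pt (u N)) (An N) (Bn N)).
  { intros w _. eapply cdl_ccont, cdl_affine. }
  replace (rect_int f (pt (u N)) (An N) (Bn N))
    with (rect_int (fun w => f w - (f q - l * q + l * w))%C (pt (u N)) (An N) (Bn N)).
  2:{ rewrite rect_int_minus; auto. rewrite Haff. ring. }
  replace (eps * ((An N + Bn N) * (An N + Bn N))) with (2 * (An N + Bn N) * (eps / 2 * (An N + Bn N))) by field.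
  apply rect_int_bound; auto.
  - intros w Hw. destruct (Hd w (Hsub N w Hw)) as [l' Hl'].
    eapply cdl_ccont. apply cdl_minus; [exact Hl'|apply cdl_affine].
  - intros w Hw. pose proof (in_rect_dist _ _ _ _ _ Hw (Hqin N)) as Hdist.
    specialize (Hdd w ltac:(lra)).
    replace (f w - (f q - l * q + l * w))%C with (f w - f q - l * (w - q))%C by ring.
    eapply Rle_trans; [exact Hdd|]. apply Rmult_le_compat_l; lra.
Qed.

(** * Circle integrals *)

Definition cis (t : R) : C := (cos t, sin t).

Lemma Cmod_cis t : Cmod (cis t) = 1.
Proof.
  unfold Cmod, cis. simpl. rewrite !Rmult_1_r.
  replace (cos t * cos t + sin t * sin t) with 1; [apply sqrt_1|].
  pose proof (sin2_cos2 t) as H. unfold Rsqr in H. lra.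
Qed.

Lemma Cmod_circle r t : 0 <= r -> Cmod (RtoC r * cis t) = r.
Proof. intros Hr. rewrite Cmod_mult, Cmod_cis, Cmod_R, Rmult_1_r. now apply Rabs_pos_eq. Qed.

Lemma cis_lipschitz s t : Cmod (cis s - cis t) <= 2 * Rabs (s - t).
Proof.
  eapply Rle_trans; [apply Cmod_le_abs|]. simpl.
  assert (H1 : Rabs (cos s - cos t) <= 1 * Rabs (s - t)).
  { apply bounded_variation with (fun x => - sin x). intros x _. split.
    - apply is_derive_Reals, derivable_pt_lim_cos.
    - rewrite Rabs_Ropp. apply Rabs_le. apply SIN_bound. }
  assert (H2 : Rabs (sin s - sin t) <= 1 * Rabs (s - t)).
  { apply bounded_variation with cos. intros x _. split.
    - apply is_derive_Reals, derivable_pt_lim_sin.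
    - apply Rabs_le. apply COS_bound. }
  unfold Rminus in *. lra.
Qed.

(** * The complex exponential and integrals over concentric circles *)

Definition cexp (z : C) : C := (RtoC (exp (fst z)) * cis (snd z))%C.

Lemma cexp_plus z w : cexp (z + w) = (cexp z * cexp w)%C.
Proof.
  destruct z as [a b], w as [c d]. unfold cexp, cis, RtoC, Cmult, Cplus. simpl.
  rewrite exp_plus, cos_plus, sin_plus. f_equal; ring.
Qed.

Lemma real_small_deriv (f : R -> R) (l eps : R) : derivable_pt_lim f 0 l -> 0 < eps ->
  exists d, 0 < d /\ forall h, Rabs h < d -> Rabs (f h - f 0 - l * h) <= eps * Rabs h.
Proof.
  intros H Heps. destruct (H eps Heps) as [d Hd]. exists d. split; [apply cond_pos|].
  intros h Hh. destruct (Req_dec h 0) as [->|Hn].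
  - replace (f 0 - f 0 - l * 0) with 0 by ring. rewrite Rabs_R0. lra.
  - specialize (Hd h Hn Hh). rewrite Rplus_0_l in Hd.
    replace (f h - f 0 - l * h) with (((f h - f 0) / h - l) * h) by (field; auto).
    rewrite Rabs_mult. apply Rmult_le_compat_r; [apply Rabs_pos|lra].
Qed.

Lemma cexp_cdl_0 : cdl cexp 0 1.
Proof.
  (* The error terms below add up to at most [7 e h]. Besides the first order errors there is one
     product, [(exp x - 1) y], which is small because [d <= e]. *)
  intros eps Heps. set (e := eps / 8). assert (He : 0 < e) by (unfold e; lra).
  destruct (real_small_deriv exp 1 e) as [d1 [Hd1 H1]]; auto.
  { rewrite <- exp_0. apply derivable_pt_lim_exp. }
  destruct (real_small_deriv cos 0 e) as [d2 [Hd2 H2]]; auto.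
  { replace 0 with (- sin 0) at 2 by (rewrite sin_0; ring). apply derivable_pt_lim_cos. }
  destruct (real_small_deriv sin 1 e) as [d3 [Hd3 H3]]; auto.
  { rewrite <- cos_0. apply derivable_pt_lim_sin. }
  destruct (real_small_deriv exp 1 1) as [d4 [Hd4 H4]]; [|lra|].
  { rewrite <- exp_0. apply derivable_pt_lim_exp. }
  set (d := Rmin (Rmin d1 d2) (Rmin (Rmin d3 d4) (Rmin (1/2) e))).
  exists d. split; [unfold d; repeat apply Rmin_pos; lra|].
  intros w Hw. replace (w - 0)%C with w in * by ring.
  assert (Hdl : d <= d1 /\ d <= d2 /\ d <= d3 /\ d <= d4 /\ d <= 1/2 /\ d <= e).
  { unfold d. repeat split; repeat (apply Rle_refl || (eapply Rle_trans; [apply Rmin_l|apply Rle_refl]) ||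
     (eapply Rle_trans; [apply Rmin_l|]; (apply Rmin_l || apply Rmin_r)) || (eapply Rle_trans; [apply Rmin_r|])). }
  destruct Hdl as (L1 & L2 & L3 & L4 & L5 & L6).
  pose proof (Rabs_fst_le w) as Hx. pose proof (Rabs_snd_le w) as Hy.
  destruct w as [x y]. cbn [fst snd] in Hx, Hy. set (h := Cmod (x, y)) in *.
  specialize (H1 x ltac:(lra)). specialize (H2 y ltac:(lra)). specialize (H3 y ltac:(lra)). specialize (H4 x ltac:(lra)).
  rewrite exp_0 in H1, H4. rewrite cos_0 in H2. rewrite sin_0 in H3.
  eapply Rle_trans; [apply Cmod_le_abs|].
  unfold cexp, cis. simpl. rewrite exp_0, cos_0, sin_0.
  assert (B0 : Rabs (cos y) <= 1) by (apply Rabs_le, COS_bound).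
  assert (B4 : Rabs (exp x - 1) <= 2 * Rabs x).
  { replace (exp x - 1) with ((exp x - 1 - 1 * x) + x) by ring.
    eapply Rle_trans; [apply Rabs_triang|]. lra. }
  assert (B1 : Rabs (exp x) <= 2).
  { replace (exp x) with ((exp x - 1) + 1) by ring. eapply Rle_trans; [apply Rabs_triang|].
    rewrite Rabs_R1. lra. }
  match goal with |- Rabs ?X + Rabs ?Y <= _ =>
    replace X with ((exp x - 1 - 1 * x) + exp x * (cos y - 1 - 0 * y)) by ring;
    replace Y with (exp x * (sin y - 0 - 1 * y) + (exp x - 1) * y) by ring end.
  assert (0 <= h) by apply Cmod_ge_0.
  pose proof (Rabs_pos x). pose proof (Rabs_pos y).
  pose proof (Rabs_triang (exp x - 1 - 1 * x) (exp x * (cos y - 1 - 0 * y))) as T1.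
  pose proof (Rabs_triang (exp x * (sin y - 0 - 1 * y)) ((exp x - 1) * y)) as T2.
  rewrite !Rabs_mult in T1, T2.
  assert (K1 : e * Rabs x <= e * h) by (apply Rmult_le_compat_l; lra).
  assert (K2 : e * Rabs y <= e * h) by (apply Rmult_le_compat_l; lra).
  assert (K3 : Rabs (exp x) * Rabs (cos y - 1 - 0 * y) <= 2 * (e * h)).
  { apply Rmult_le_compat; try apply Rabs_pos; lra. }
  assert (K4 : Rabs (exp x) * Rabs (sin y - 0 - 1 * y) <= 2 * (e * h)).
  { apply Rmult_le_compat; try apply Rabs_pos; lra. }
  assert (K5 : Rabs (exp x - 1) * Rabs y <= 2 * e * h).
  { apply Rmult_le_compat; try apply Rabs_pos; lra. }
  rewrite (Rabs_mult (exp x - 1) y) in T2. assert (E8 : eps * h = 8 * (e * h)) by (unfold e; field). rewrite E8. clear E8. clearbody e h. set (eh := e * h) in *. assert (K5' : Rabs (exp x - 1) * Rabs y <= 2 * eh) by (unfold eh; lra). clear K5. assert (0 <= eh) by (apply Rmult_le_pos; lra). lra.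
Qed.

(** The addition formula carries the derivative at [0] to any point. *)
Lemma cexp_cdl z : cdl cexp z (cexp z).
Proof.
  apply (cdl_ext (fun w => cexp z * cexp ((- z) + 1 * w))%C).
  { intros w. rewrite <- cexp_plus. f_equal. ring. }
  eapply cdl_eq.
  - apply cdl_scal, (cdl_comp cexp); [|apply cdl_affine].
    replace (- z + 1 * z)%C with (RtoC 0) by ring. apply cexp_cdl_0.
  - ring.
Qed.

Lemma cexp_ln_cis r t : 0 < r -> cexp (ln r, t) = (RtoC r * cis t)%C.
Proof. intros Hr. unfold cexp. simpl. now rewrite exp_ln. Qed.

Lemma cexp_period s t : cexp (s, t + 2 * PI) = cexp (s, t).
Proof.
  unfold cexp, cis. simpl. rewrite <- (sin_period t 1), <- (cos_period t 1). simpl.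
  now rewrite Rmult_1_r.
Qed.

Lemma Cmod_cexp z : Cmod (cexp z) = exp (fst z).
Proof. apply Cmod_circle. left. apply exp_pos. Qed.

Definition cdiff (f : C -> C) (z : C) : Prop := exists l, cdl f z l.

Lemma cdiff_ccont f z : cdiff f z -> ccont f z.
Proof. intros [l H]. eapply cdl_ccont, H. Qed.
Lemma cdiff_const c z : cdiff (fun _ => c) z.
Proof. eexists. apply cdl_const. Qed.
Lemma cdiff_id z : cdiff (fun w => w) z.
Proof. eexists. apply cdl_id. Qed.
Lemma cdiff_plus f g z : cdiff f z -> cdiff g z -> cdiff (fun w => f w + g w)%C z.
Proof. intros [l Hl] [m Hm]. eexists. apply cdl_plus; eauto. Qed.
Lemma cdiff_minus f g z : cdiff f z -> cdiff g z -> cdiff (fun w => f w - g w)%C z.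
Proof. intros [l Hl] [m Hm]. eexists. apply cdl_minus; eauto. Qed.
Lemma cdiff_mult f g z : cdiff f z -> cdiff g z -> cdiff (fun w => f w * g w)%C z.
Proof. intros [l Hl] [m Hm]. eexists. apply cdl_mult; eauto. Qed.
Lemma cdiff_inv f z : cdiff f z -> f z <> 0 -> cdiff (fun w => / f w)%C z.
Proof. intros [l Hl] H. eexists. apply (cdl_comp Cinv); [now apply cdl_inv|eauto]. Qed.
Lemma cdiff_pow f n z : cdiff f z -> cdiff (fun w => f w ^ n)%C z.
Proof. intros [l Hl]. eexists. apply (cdl_comp (fun w => w ^ n)%C); [apply cdl_pow|eauto]. Qed.
Lemma cdiff_ext_loc f g z d : 0 < d -> (forall w, Cmod (w - z) < d -> f w = g w) -> cdiff f z -> cdiff g z.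
Proof. intros Hd H [l Hl]. exists l. eapply cdl_ext_loc; eauto. Qed.

(** The integral is over the angle, without the factor [i w] of [dw]. This is why the Cauchy kernel
    appears as [w / (w - z)] and the coefficient integrand as [f w / w ^ n]. *)
Definition circ_int (k : C -> C) (r : R) : C := CInt (fun t => k (RtoC r * cis t)%C) 0 (2 * PI).

Lemma two_PI_pos : 0 < 2 * PI.
Proof. pose proof PI_RGT_0. lra. Qed.

(* In the coordinate [log w] the annulus becomes a rectangle whose horizontal
   sides cancel by periodicity. *)
Lemma circ_int_annulus k r1 r2 : 0 < r1 -> r1 <= r2 ->
  (forall w, r1 <= Cmod w <= r2 -> cdiff k w) -> circ_int k r1 = circ_int k r2.
Proof.
  intros H1 H2 Hk.
  assert (Hln : ln r1 <= ln r2).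
  { destruct (Req_dec r1 r2) as [->|Hn]; [lra|]. left. apply ln_increasing; lra. }
  pose proof two_PI_pos as HPI.
  pose proof (rect_int_goursat (fun w => k (cexp w)) (ln r1, 0) (ln r2 - ln r1) (2 * PI) ltac:(lra) ltac:(lra)) as HG.
  assert (E0 : forall t : R, ((ln r1, 0) + Ci * t)%C = (ln r1, t)).
  { intros t. unfold Cplus, Cmult, Ci, RtoC. simpl. f_equal; ring. }
  assert (E1 : forall t : R, ((ln r1, 0) + (ln r2 - ln r1)%R + Ci * t)%C = (ln r2, t)).
  { intros t. unfold Cplus, Cmult, Ci, RtoC. simpl. f_equal; ring. }
  unfold rect_int, line_int in HG.
  assert (Eh : CInt (fun t => k (cexp ((ln r1, 0) + Ci * (2 * PI)%R + 1 * t)%C)) 0 (ln r2 - ln r1)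
     = CInt (fun t => k (cexp ((ln r1, 0) + 1 * t)%C)) 0 (ln r2 - ln r1)).
  { apply CInt_ext; [lra|]. intros t _. f_equal.
    replace ((ln r1, 0) + Ci * (2 * PI)%R + 1 * t)%C with ((ln r1 + t)%R, (0 + 2 * PI)%R)
      by (unfold Cplus, Cmult, Ci, RtoC; simpl; f_equal; ring).
    rewrite cexp_period. f_equal. unfold Cplus, Cmult, RtoC; simpl; f_equal; ring. }
  rewrite Eh in HG. clear Eh.
  assert (Ea : CInt (fun t => k (cexp ((ln r1, 0) + (ln r2 - ln r1)%R + Ci * t)%C)) 0 (2 * PI) = circ_int k r2).
  { apply CInt_ext; [lra|]. intros t _. rewrite E1, cexp_ln_cis; auto; lra. }
  assert (Eb : CInt (fun t => k (cexp ((ln r1, 0) + Ci * t)%C)) 0 (2 * PI) = circ_int k r1).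
  { apply CInt_ext; [lra|]. intros t _. rewrite E0, cexp_ln_cis; auto; lra. }
  rewrite Ea, Eb in HG.
  assert (HG0 : forall X : C, (1 * X + Ci * circ_int k r2 - 1 * X - Ci * circ_int k r1)%C = 0 -> circ_int k r1 = circ_int k r2).
  { intros X HX. replace (circ_int k r1) with (circ_int k r2 + Ci * (1 * X + Ci * circ_int k r2 - 1 * X - Ci * circ_int k r1)
      + (1 + Ci * Ci) * (circ_int k r1 - circ_int k r2))%C by ring.
    rewrite HX. replace (1 + Ci * Ci)%C with (RtoC 0) by (unfold Ci, Cmult, Cplus, RtoC; simpl; f_equal; ring). ring. }
  eapply HG0, HG. clear HG Ea Eb HG0.
  intros w [x [y [Hx [Hy ->]]]].
  destruct (Hk (cexp ((ln r1, 0) + x + Ci * y))%C) as [l Hl].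
  { rewrite Cmod_cexp. simpl. rewrite Rmult_0_l, Rmult_0_r, Rminus_0_r, Rplus_0_r.
    split.
    - rewrite <- (exp_ln r1) at 1 by auto. destruct (Req_dec x 0) as [->|Hn]; [rewrite Rplus_0_r; lra|]. left. apply exp_increasing; lra.
    - rewrite <- (exp_ln r2) at 1 by lra. destruct (Req_dec (ln r1 + x) (ln r2)) as [->|Hn]; [lra|]. left. apply exp_increasing; lra. }
  eexists. apply (cdl_comp k); [exact Hl|apply cexp_cdl].
Qed.

Lemma circle_dist r t s u : 0 <= s ->
  Cmod (RtoC r * cis t - RtoC s * cis u) <= Rabs (r - s) + 2 * s * Rabs (t - u).
Proof.
  intros Hs.
  replace (RtoC r * cis t - RtoC s * cis u)%C with (RtoC (r - s) * cis t + RtoC s * (cis t - cis u))%C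
    by (rewrite RtoC_minus; ring).
  eapply Rle_trans; [apply Cmod_triangle|].
  rewrite !Cmod_mult, Cmod_cis, !Cmod_R, (Rabs_pos_eq s) by auto.
  pose proof (cis_lipschitz t u). assert (s * Cmod (cis t - cis u) <= s * (2 * Rabs (t - u))) by (now apply Rmult_le_compat_l).
  lra.
Qed.

Lemma ccont_circle_2d k s u : 0 <= s -> ccont k (RtoC s * cis u)%C ->
  forall eps, 0 < eps -> exists d, 0 < d /\ forall t r, Rabs (t - u) < d -> Rabs (r - s) < d ->
    Cmod (k (RtoC r * cis t)%C - k (RtoC s * cis u)%C) < eps.
Proof.
  intros Hs Hk eps Heps. destruct (Hk eps Heps) as [d [Hd1 Hd]].
  exists (d / (2 + 2 * s)). assert (0 < d / (2 + 2 * s)) by (apply Rdiv_lt_0_compat; lra).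
  split; auto. intros t r Ht Hr. apply Hd. eapply Rle_lt_trans; [now apply circle_dist|].
  assert (2 * s * Rabs (t - u) <= 2 * s * (d / (2 + 2 * s))) by (apply Rmult_le_compat_l; lra).
  assert (d = (2 + 2 * s) * (d / (2 + 2 * s))) by (field; lra). lra.
Qed.

Lemma ccont_rcont_circle k r t : 0 <= r -> ccont k (RtoC r * cis t)%C -> rcont (fun t => k (RtoC r * cis t)%C) t.
Proof.
  intros Hr Hk eps Heps. destruct (ccont_circle_2d k r t Hr Hk eps Heps) as [d [Hd1 Hd]].
  exists d. split; auto. intros s Hs. apply Hd; auto. unfold Rminus. rewrite Rplus_opp_r, Rabs_R0. auto.
Qed.

Lemma circ_rcont_on k r : 0 <= r -> (forall w, Cmod w = r -> ccont k w) ->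
  rcont_on (fun t => k (RtoC r * cis t)%C) 0 (2 * PI).
Proof. intros Hr H t _. apply ccont_rcont_circle; auto. apply H. now apply Cmod_circle. Qed.

Lemma circ_int_bound k r M : 0 <= r -> (forall w, Cmod w = r -> ccont k w) ->
  (forall t, 0 <= t <= 2 * PI -> Cmod (k (RtoC r * cis t)%C) <= M) -> Cmod (circ_int k r) <= 2 * PI * M.
Proof.
  intros Hr Hc HM. pose proof two_PI_pos. replace (2 * PI) with (2 * PI - 0) by ring.
  apply CInt_bound; [lra|now apply circ_rcont_on|exact HM].
Qed.

Lemma circ_int_minus f g r : 0 <= r -> (forall w, Cmod w = r -> ccont f w) -> (forall w, Cmod w = r -> ccont g w) ->
  circ_int (fun w => f w - g w)%C r = (circ_int f r - circ_int g r)%C.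
Proof. intros. pose proof two_PI_pos. unfold circ_int. apply CInt_minus; [lra| |]; now apply circ_rcont_on. Qed.

Lemma circ_int_scal c f r : 0 <= r -> (forall w, Cmod w = r -> ccont f w) ->
  circ_int (fun w => c * f w)%C r = (c * circ_int f r)%C.
Proof. intros. pose proof two_PI_pos. unfold circ_int. apply CInt_scal; [lra|]; now apply circ_rcont_on. Qed.

Lemma circ_int_ext f g r : 0 <= r -> (forall w, Cmod w = r -> f w = g w) -> circ_int f r = circ_int g r.
Proof. intros Hr H. pose proof two_PI_pos. apply CInt_ext; [lra|]. intros t _. apply H. now apply Cmod_circle. Qed.

Lemma circ_int_const c r : circ_int (fun _ => c) r = (RtoC (2 * PI) * c)%C.
Proof.
  unfold circ_int, CInt. rewrite !(RInt_const (V := R_CompleteNormedModule)).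
  unfold scal; simpl; unfold mult; simpl. unfold RtoC, Cmult. simpl. f_equal; ring.
Qed.

Lemma circ_int_0 k : circ_int k 0 = (RtoC (2 * PI) * k 0)%C.
Proof.
  rewrite <- (circ_int_const (k 0) 0). pose proof two_PI_pos. apply CInt_ext; [lra|].
  intros t _. f_equal. ring.
Qed.

(** Continuity of [k] at the points of the circle [|w| = s] is uniform over the compact interval of
    angles. It is used for each component with [eps / (4 PI)], to be summed over two components and
    a length [2 PI]. *)
Lemma circ_int_continuous k s : (forall w, inD w -> ccont k w) -> 0 <= s < 1 ->
  forall eps, 0 < eps -> exists d, 0 < d /\ forall r, 0 <= r < 1 -> Rabs (r - s) < d ->
    Cmod (circ_int k r - circ_int k s) <= eps.
Proof.
  intros Hk Hs eps Heps. pose proof two_PI_pos as HPI.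
  assert (Hin : forall r w, 0 <= r < 1 -> Cmod w = r -> ccont k w).
  { intros r w Hr Hw. apply Hk. unfold inD. lra. }
  set (e := eps / (4 * PI)). assert (He : 0 < e) by (apply Rdiv_lt_0_compat; lra).
  assert (H2d : forall t, ccont k (RtoC s * cis t)%C) by (intros t; apply (Hin s); [lra|apply Cmod_circle; lra]).
  destruct (uniform_continuity_2d_1d (fun u v => fst (k (RtoC v * cis u)%C)) 0 (2 * PI) s) with (eps := mkposreal e He) as [d1 H1].
  { intros x _ [ep Hep]. destruct (ccont_circle_2d k s x (proj1 Hs) (H2d x) ep Hep) as [d [Hd1 Hd]].
    exists (mkposreal d Hd1). intros u v Hu Hv. simpl. eapply Rle_lt_trans; [|apply (Hd u v Hu Hv)].
    apply (Rabs_fst_le (_ - _)%C). }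
  destruct (uniform_continuity_2d_1d (fun u v => snd (k (RtoC v * cis u)%C)) 0 (2 * PI) s) with (eps := mkposreal e He) as [d2 H2].
  { intros x _ [ep Hep]. destruct (ccont_circle_2d k s x (proj1 Hs) (H2d x) ep Hep) as [d [Hd1 Hd]].
    exists (mkposreal d Hd1). intros u v Hu Hv. simpl. eapply Rle_lt_trans; [|apply (Hd u v Hu Hv)].
    apply (Rabs_snd_le (_ - _)%C). }
  exists (Rmin d1 d2). split; [apply Rmin_pos; apply cond_pos|].
  intros r Hr Hrs. pose proof (Rmin_l d1 d2). pose proof (Rmin_r d1 d2).
  pose proof (cond_pos d1). pose proof (cond_pos d2).
  unfold circ_int. rewrite <- CInt_minus; [|lra| |].
  2, 3: apply circ_rcont_on; [lra|intros w Hw; eapply Hin; [|exact Hw]; lra].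
  replace eps with ((2 * PI - 0) * (2 * e)) by (unfold e; field; lra).
  assert (Hr' : forall d, Rabs (r - s) < d -> s - d <= r <= s + d).
  { intros d Hd. apply Rabs_def2 in Hd. lra. }
  apply CInt_bound; [lra| |].
  - intros t _ ep Hep.
    destruct (ccont_rcont_circle k r t (proj1 Hr)) with (eps := ep / 2) as [da [Hda1 Hda]]; [|lra|].
    { apply (Hin r); [lra|apply Cmod_circle; lra]. }
    destruct (ccont_rcont_circle k s t (proj1 Hs)) with (eps := ep / 2) as [db [Hdb1 Hdb]]; [auto|lra|].
    exists (Rmin da db). split; [now apply Rmin_pos|]. intros x Hx.
    pose proof (Rmin_l da db). pose proof (Rmin_r da db).
    specialize (Hda x ltac:(lra)). specialize (Hdb x ltac:(lra)).
    match goal with |- Cmod (?a - ?b - (?c - ?d)) < _ => replace (a - b - (c - d))%C with ((a - c) - (b - d))%C by ring end.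
    eapply Rle_lt_trans; [apply Cmod_triang_sub|]. lra.
  - intros t Ht. eapply Rle_trans; [apply Cmod_le_abs|].
    assert (R0 : Rabs (t - t) = 0) by (unfold Rminus; rewrite Rplus_opp_r; apply Rabs_R0).
    specialize (H1 t s t r Ht ltac:(lra) Ht (Hr' d1 ltac:(lra)) ltac:(lra)). simpl in H1.
    specialize (H2 t s t r Ht ltac:(lra) Ht (Hr' d2 ltac:(lra)) ltac:(lra)). simpl in H2.
    unfold Cminus, Cplus, Copp. cbn [fst snd]. unfold Rminus in *. lra.
Qed.

(** The integral is constant in the radius on [(0, |z|)] and on [(|z|, 1)], by comparison over
    annuli that avoid [z]. Continuity in the radius joins the two ranges and reaches radius [0],
    where the integrand is constant. *)
Lemma circ_int_punctured k z : (forall w, inD w -> ccont k w) ->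
  (forall w, inD w -> w <> z -> cdiff k w) -> forall r, 0 <= r < 1 -> circ_int k r = (RtoC (2 * PI) * k 0)%C.
Proof.
  intros Hc Hd r Hr. rewrite <- circ_int_0.
  assert (Hcst : forall r1 r2, 0 < r1 -> r1 <= r2 -> r2 < 1 -> (r2 < Cmod z \/ Cmod z < r1) -> circ_int k r1 = circ_int k r2).
  { intros r1 r2 H1 H2 H3 H4. apply circ_int_annulus; auto. intros w Hw. apply Hd; [unfold inD; lra|].
    intros ->. lra. }
  assert (Heq : forall a b : C, (forall eps, 0 < eps -> Cmod (a - b) <= eps) -> a = b).
  { intros a b H. apply Ceq_minus. now apply Cmod_eps_0. }
  (* The annulus from [b] to [a] avoids [z] even when [s = |z|]; continuity at [s] and at [0]
     absorbs the two gaps. *)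
  assert (Hbelow : forall s, 0 <= s < 1 -> s <= Cmod z -> circ_int k s = circ_int k 0).
  { intros s Hs Hsz. destruct (Req_dec s 0) as [->|Hs0]; [reflexivity|].
    apply Heq. intros eps Heps.
    destruct (circ_int_continuous k s Hc Hs (eps / 2) ltac:(lra)) as [d1 [Hd1 K1]].
    destruct (circ_int_continuous k 0 Hc ltac:(lra) (eps / 2) ltac:(lra)) as [d2 [Hd2 K2]].
    set (a := s - Rmin d1 s / 2). set (b := Rmin d2 a / 2).
    assert (0 < Rmin d1 s) by (apply Rmin_pos; lra). pose proof (Rmin_l d1 s). pose proof (Rmin_r d1 s).
    assert (Ha : 0 < a < s) by (unfold a; lra).
    assert (0 < Rmin d2 a) by (apply Rmin_pos; lra). pose proof (Rmin_l d2 a). pose proof (Rmin_r d2 a).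
    assert (Hb : 0 < b < a) by (unfold b; lra).
    specialize (K1 a ltac:(lra) ltac:(rewrite Rabs_left; unfold a in *; lra)).
    specialize (K2 b ltac:(lra) ltac:(rewrite Rabs_right; unfold b in *; lra)).
    rewrite (Hcst b a) in K2 by lra. rewrite Cmod_sym in K1.
    eapply Rle_trans; [apply (Cmod_dist_triang _ (circ_int k a))|]. lra. }
  destruct (Rle_lt_dec r (Cmod z)) as [Hrz|Hrz]; [now apply Hbelow|].
  rewrite <- (Hbelow (Cmod z)); [|pose proof (Cmod_ge_0 z); lra|lra].
  pose proof (Cmod_ge_0 z). apply Heq. intros eps Heps.
  destruct (circ_int_continuous k (Cmod z) Hc ltac:(lra) eps Heps) as [d1 [Hd1 K1]].
  set (m := Rmin d1 (r - Cmod z)). assert (0 < m) by (apply Rmin_pos; lra).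
  assert (m <= d1) by apply Rmin_l. assert (m <= r - Cmod z) by apply Rmin_r.
  rewrite <- (Hcst (Cmod z + m / 2) r) by lra.
  apply K1; [lra|]. rewrite Rabs_right; lra.
Qed.

(** * The Cauchy kernel and Cauchy's integral formula *)

Lemma Cmod_sub_pos (w z : C) : Cmod z < Cmod w -> (w - z)%C <> 0.
Proof. intros H. apply (proj2 (Cmod_gt_0 _)). pose proof (Cmod_triang_rev w z). lra. Qed.

Lemma Cmod_pos_nz (w : C) : 0 < Cmod w -> w <> 0.
Proof. apply (proj2 (Cmod_gt_0 _)). Qed.

Lemma cauchy_kernel_bound (w z : C) : Cmod z < Cmod w -> Cmod (w / (w - z)) <= Cmod w / (Cmod w - Cmod z).
Proof.
  intros H. rewrite Cmod_div by now apply Cmod_sub_pos. pose proof (Cmod_triang_rev w z).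
  apply Rmult_le_compat_l; [apply Cmod_ge_0|]. apply Rinv_le_contravar; lra.
Qed.

Lemma cauchy_kernel_cdiff z w : Cmod z < Cmod w -> cdiff (fun w => w / (w - z))%C w.
Proof.
  intros H. apply cdiff_mult; [apply cdiff_id|]. apply (cdiff_inv (fun w => w - z)%C).
  - apply cdiff_minus; [apply cdiff_id|apply cdiff_const].
  - now apply Cmod_sub_pos.
Qed.

(** Outside [|z|] the circle may be enlarged at will, and [w / (w - z)] tends to [1] at infinity.
    The radius [T] is so large that [2 PI |z| / (T - |z|) <= eps]. *)
Lemma circ_int_kernel z r : Cmod z < r -> circ_int (fun w => w / (w - z))%C r = 2 * PI.
Proof.
  intros Hr. pose proof (Cmod_ge_0 z) as Hz0. pose proof two_PI_pos as HPI.
  apply Ceq_minus. apply Cmod_eps_0. intros eps Heps.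
  set (T := r + 2 * PI * Cmod z / eps).
  assert (0 <= 2 * PI * Cmod z / eps) by (apply Rle_mult_inv_pos; [apply Rmult_le_pos|]; lra).
  rewrite (circ_int_annulus _ r T); [|lra|unfold T; lra|intros w Hw; apply cauchy_kernel_cdiff; lra].
  assert (HT : r <= T) by (unfold T; lra).
  assert (Hc : forall w, Cmod w = T -> ccont (fun w => w / (w - z))%C w).
  { intros w Hw. apply cdiff_ccont, cauchy_kernel_cdiff. lra. }
  replace (RtoC (2 * PI)) with (circ_int (fun _ => 1) T) by (rewrite circ_int_const; ring).
  rewrite <- circ_int_minus; [|lra|auto|intros; apply cdiff_ccont, cdiff_const].
  apply Rle_trans with (2 * PI * (Cmod z / (T - Cmod z))).
  - apply circ_int_bound; [lra| |].
    + intros w Hw. apply cdiff_ccont. apply cdiff_minus; [apply cauchy_kernel_cdiff; lra|apply cdiff_const].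
    + intros t _. pose proof (Cmod_circle T t ltac:(lra)) as Hw. set (w := (RtoC T * cis t)%C) in *.
      pose proof (Cmod_sub_pos w z ltac:(lra)) as Hn.
      replace (w / (w - z) - 1)%C with (z / (w - z))%C by (field; auto).
      rewrite Cmod_div by auto. pose proof (Cmod_triang_rev w z).
      apply Rmult_le_compat_l; [lra|]. apply Rinv_le_contravar; lra.
  - unfold Rdiv. rewrite <- Rmult_assoc.
    apply Rmult_le_reg_r with (T - Cmod z); [lra|]. rewrite Rmult_assoc, Rinv_l by lra.
    rewrite Rmult_1_r.
    apply Rle_trans with (eps * (2 * PI * Cmod z / eps)); [right; field; lra|].
    apply Rmult_le_compat_l; [lra|]. unfold T. lra.
Qed.

(* The quotient [(f w - f z) / (w - z)] is only known to be continuous at [z]: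
   the circle integral is constant on either side of [|w| = |z|] and continuous there. *)
Lemma cauchy_formula f z r : analytic f -> Cmod z < r -> r < 1 ->
  circ_int (fun w => f w * (w / (w - z)))%C r = (RtoC (2 * PI) * f z)%C.
Proof.
  intros Hf Hzr Hr. pose proof (Cmod_ge_0 z) as Hz0. rewrite analytic_cdl in Hf.
  assert (Hzd : inD z) by (unfold inD; lra).
  set (q := fun w => if Ceq_dec w z then cderiv f z else ((f w - f z) / (w - z))%C).
  assert (Hq1 : forall w, inD w -> w <> z -> cdiff q w).
  { intros w Hw Hn. apply (cdiff_ext_loc (fun w => (f w - f z) * / (w - z))%C _ _ (Cmod (w - z))).
    - apply Cmod_gt_0. intros H. apply Hn. now apply Ceq_minus.
    - intros v Hv. unfold q. destruct (Ceq_dec v z) as [->|_]; [|reflexivity].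
      rewrite Cmod_sym in Hv. lra.
    - apply cdiff_mult.
      + apply cdiff_minus; [exists (cderiv f w); now apply Hf|apply cdiff_const].
      + apply (cdiff_inv (fun w => w - z)%C); [apply cdiff_minus; [apply cdiff_id|apply cdiff_const]|].
        intros H. apply Hn. now apply Ceq_minus. }
  assert (Hq2 : forall w, inD w -> ccont q w).
  { intros w Hw. destruct (Ceq_dec w z) as [->|Hn]; [|now apply cdiff_ccont, Hq1].
    intros eps Heps. destruct (Hf z Hzd (eps / 2) ltac:(lra)) as [d [Hd1 Hd]].
    exists d. split; auto. intros v Hv. unfold q. destruct (Ceq_dec z z) as [_|]; [|congruence].
    destruct (Ceq_dec v z) as [->|Hvz]; [replace (cderiv f z - cderiv f z)%C with (RtoC 0) by ring; rewrite Cmod_0; lra|].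
    assert (Hnz : (v - z)%C <> 0) by (intros H; apply Hvz; now apply Ceq_minus).
    replace ((f v - f z) / (v - z) - cderiv f z)%C with ((f v - f z - cderiv f z * (v - z)) / (v - z))%C by (field; auto).
    rewrite Cmod_div by auto. pose proof (proj1 (Cmod_gt_0 _) Hnz).
    apply Rle_lt_trans with (eps / 2); [|lra]. apply Rmult_le_reg_r with (Cmod (v - z)); auto.
    unfold Rdiv at 1. rewrite Rmult_assoc, Rinv_l by lra. rewrite Rmult_1_r. now apply Hd. }
  (* The factor [w] makes the value at the centre vanish, and on the circle [w q(w)] is the
     difference of the kernel integrands for [f] and for the constant [f z]. *)
  assert (HI : circ_int (fun w => w * q w)%C r = (RtoC (2 * PI) * (0 * q 0))%C).
  { apply (circ_int_punctured (fun w => w * q w)%C z); [| |lra].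
    - intros w Hw. destruct (Ceq_dec w z) as [->|Hn].
      + intros eps Heps.
        assert (HK : 0 < 1 + Cmod z + Cmod (q z)) by (pose proof (Cmod_ge_0 (q z)); lra).
        set (e := Rmin 1 (eps / (2 * (1 + Cmod z + Cmod (q z))))).
        assert (He : 0 < e) by (apply Rmin_pos; [lra|apply Rdiv_lt_0_compat; lra]).
        assert (He1 : e <= 1) by apply Rmin_l.
        assert (He2 : e * (1 + Cmod z + Cmod (q z)) < eps).
        { apply Rle_lt_trans with (eps / (2 * (1 + Cmod z + Cmod (q z))) * (1 + Cmod z + Cmod (q z))).
          - apply Rmult_le_compat_r; [lra|apply Rmin_r].
          - replace (eps / (2 * (1 + Cmod z + Cmod (q z))) * (1 + Cmod z + Cmod (q z))) with (eps / 2) by (field; lra). lra. }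
        destruct (Hq2 z Hzd e He) as [d [Hd1 Hd]]. exists (Rmin d e). split; [now apply Rmin_pos|].
        intros v Hv. pose proof (Rmin_l d e). pose proof (Rmin_r d e). specialize (Hd v ltac:(lra)).
        replace (v * q v - z * q z)%C with ((v - z) * (q v - q z) + z * (q v - q z) + (v - z) * q z)%C by ring.
        eapply Rle_lt_trans; [apply Cmod_triangle|].
        eapply Rle_lt_trans; [apply Rplus_le_compat_r, Cmod_triangle|]. rewrite !Cmod_mult.
        pose proof (Cmod_ge_0 (q v - q z)). pose proof (Cmod_ge_0 (v - z)). pose proof (Cmod_ge_0 (q z)).
        assert (Cmod (v - z) * Cmod (q v - q z) <= e * 1) by (apply Rmult_le_compat; lra).
        assert (Cmod z * Cmod (q v - q z) <= Cmod z * e) by (apply Rmult_le_compat_l; lra).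
        assert (Cmod (v - z) * Cmod (q z) <= e * Cmod (q z)) by (apply Rmult_le_compat_r; lra). lra.
      + apply cdiff_ccont, cdiff_mult; [apply cdiff_id|now apply Hq1].
    - intros w Hw Hn. apply cdiff_mult; [apply cdiff_id|now apply Hq1]. }
  assert (Hkc : forall w, Cmod w = r -> ccont (fun w => f w * (w / (w - z)))%C w).
  { intros w Hw. apply cdiff_ccont, cdiff_mult; [exists (cderiv f w); apply Hf; unfold inD; lra|apply cauchy_kernel_cdiff; lra]. }
  rewrite (circ_int_ext _ (fun w => f w * (w / (w - z)) - f z * (w / (w - z)))%C) in HI; [|lra|].
  2:{ intros w Hw. unfold q. destruct (Ceq_dec w z) as [->|_]; [lra|].
      field. apply Cmod_sub_pos. lra. }
  rewrite circ_int_minus in HI; [|lra|auto|].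
  2:{ intros w Hw. apply cdiff_ccont, cdiff_mult; [apply cdiff_const|apply cauchy_kernel_cdiff; lra]. }
  rewrite circ_int_scal in HI; [|lra|intros w Hw; apply cdiff_ccont, cauchy_kernel_cdiff; lra].
  rewrite circ_int_kernel in HI by auto.
  apply Ceq_minus. rewrite (Cmult_comm (RtoC (2 * PI))).
  rewrite HI. ring.
Qed.

(** * Taylor expansion and Cauchy's estimate *)

Fixpoint csum (a : nat -> C) (z : C) (N : nat) : C :=
  match N with O => 0 | S n => (csum a z n + a n * z ^ n)%C end.

(** Cauchy's coefficient integral on one fixed circle, so that no higher derivatives are involved;
    comparison over annuli allows any radius in [(0, 1)]. *)
Definition taylor (f : C -> C) (n : nat) : C :=
  (RtoC (/ (2 * PI)) * circ_int (fun w => f w * / w ^ n)%C (1 / 2))%C.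

Lemma coef_cdiff f n w : analytic f -> inD w -> 0 < Cmod w -> cdiff (fun w => f w * / w ^ n)%C w.
Proof.
  intros Hf Hw H0. rewrite analytic_cdl in Hf. apply cdiff_mult; [exists (cderiv f w); auto|].
  apply (cdiff_inv (fun w => w ^ n)%C); [apply cdiff_pow, cdiff_id|]. apply Cpow_nz. now apply Cmod_pos_nz.
Qed.

Lemma taylor_circ f n r : analytic f -> 0 < r < 1 ->
  (RtoC (2 * PI) * taylor f n)%C = circ_int (fun w => f w * / w ^ n)%C r.
Proof.
  intros Hf Hr. unfold taylor. pose proof two_PI_pos.
  rewrite Cmult_assoc, <- RtoC_mult, Rinv_r, Cmult_1_l by lra.
  destruct (Rle_lt_dec r (1 / 2)); [symmetry|]; apply circ_int_annulus; try lra;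
  intros w Hw; apply coef_cdiff; auto; unfold inD; lra.
Qed.

Lemma Cmod_2PI_cancel (a : C) M : Cmod (RtoC (2 * PI) * a) <= 2 * PI * M -> Cmod a <= M.
Proof.
  pose proof two_PI_pos. rewrite Cmod_mult, Cmod_R, Rabs_pos_eq by lra. intros HH.
  eapply Rmult_le_reg_l; eauto.
Qed.

Lemma taylor_bound f n r M : analytic f -> 0 < r < 1 -> (forall w, Cmod w = r -> Cmod (f w) <= M) ->
  Cmod (taylor f n) * r ^ n <= M.
Proof.
  intros Hf Hr HM. assert (Hp : 0 < r ^ n) by (apply pow_lt; lra).
  apply Rmult_le_reg_r with (/ r ^ n); [now apply Rinv_0_lt_compat|].
  rewrite Rmult_assoc, Rinv_r, Rmult_1_r by lra.
  apply Cmod_2PI_cancel. rewrite (taylor_circ f n r) by auto.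
  apply circ_int_bound; [lra| |].
  - intros w Hw. apply cdiff_ccont, coef_cdiff; auto; unfold inD; lra.
  - intros t _. pose proof (Cmod_circle r t ltac:(lra)) as Hw. set (w := (RtoC r * cis t)%C) in *.
    rewrite Cmod_mult, Cmod_inv, Cmod_pow, Hw by (apply Cpow_nz, Cmod_pos_nz; lra).
    apply Rmult_le_compat_r; [left; now apply Rinv_0_lt_compat|auto].
Qed.

(** Cauchy's formula is the case [N = 0]. The induction step is the identity
    [w / (w - z) - 1 = (z / w) (w / (w - z))], multiplied by [(z / w)^N]. *)
Lemma taylor_remainder f z r N : analytic f -> Cmod z < r -> r < 1 ->
  (RtoC (2 * PI) * (f z - csum (taylor f) z N))%C =
  circ_int (fun w => z ^ N * (f w * / w ^ N) * (w / (w - z)))%C r.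
Proof.
  intros Hf Hz Hr. pose proof (Cmod_ge_0 z).
  assert (Hcd : forall n w, Cmod w = r -> ccont (fun w => z ^ n * (f w * / w ^ n) * (w / (w - z)))%C w).
  { intros n w Hw. apply cdiff_ccont, cdiff_mult; [|apply cauchy_kernel_cdiff; lra].
    apply cdiff_mult; [apply cdiff_const|]. apply coef_cdiff; auto; unfold inD; lra. }
  induction N as [|N IH].
  - simpl csum. replace (f z - 0)%C with (f z) by ring. rewrite <- (cauchy_formula f z r) by auto.
    apply circ_int_ext; [lra|]. intros w Hw. simpl. field. apply Cmod_sub_pos; lra.
  - simpl csum. replace (RtoC (2 * PI) * (f z - (csum (taylor f) z N + taylor f N * z ^ N)))%C
      with (RtoC (2 * PI) * (f z - csum (taylor f) z N) - z ^ N * (RtoC (2 * PI) * taylor f N))%C by ring.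
    rewrite IH, (taylor_circ f N r) by (auto; lra).
    assert (Hcf : forall w, Cmod w = r -> ccont (fun w => f w * / w ^ N)%C w)
      by (intros w Hw; apply cdiff_ccont, coef_cdiff; auto; unfold inD; lra).
    rewrite <- circ_int_scal, <- circ_int_minus; auto; try lra.
    2:{ intros w Hw. apply cdiff_ccont, cdiff_mult; [apply cdiff_const|]. apply coef_cdiff; auto; unfold inD; lra. }
    apply circ_int_ext; [lra|]. intros w Hw. simpl.
    assert (w <> 0) by (apply Cmod_pos_nz; lra).
    field. repeat split; first [apply Cmod_sub_pos; lra|apply Cpow_nz; auto|auto].
Qed.

(** The bound is asked in terms of the angle in [[0, 2 PI]], the form in which the extreme value
    theorem on an interval supplies it. *)
Lemma taylor_approx_param f z r M N : analytic f -> Cmod z < r -> r < 1 ->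
  (forall t, 0 <= t <= 2 * PI -> Cmod (f (RtoC r * cis t)%C) <= M) ->
  Cmod (f z - csum (taylor f) z N) <= M * (Cmod z / r) ^ N * (r / (r - Cmod z)).
Proof.
  intros Hf Hz Hr HM. pose proof (Cmod_ge_0 z).
  apply Cmod_2PI_cancel. rewrite (taylor_remainder f z r) by auto.
  apply circ_int_bound; [lra| |].
  - intros w Hw. apply cdiff_ccont, cdiff_mult; [|apply cauchy_kernel_cdiff; lra].
    apply cdiff_mult; [apply cdiff_const|]. apply coef_cdiff; auto; unfold inD; lra.
  - intros t Ht. specialize (HM t Ht). pose proof (Cmod_circle r t ltac:(lra)) as Hw.
    set (w := (RtoC r * cis t)%C) in *.
    rewrite Cmod_mult. apply Rmult_le_compat; try apply Cmod_ge_0.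
    + assert (Hw0 : w <> 0) by (apply Cmod_pos_nz; lra).
      rewrite !Cmod_mult, Cmod_inv, !Cmod_pow, Hw by now apply Cpow_nz.
      replace (M * (Cmod z / r) ^ N) with (Cmod z ^ N * (M * / r ^ N)).
      * apply Rmult_le_compat_l; [now apply pow_le|]. apply Rmult_le_compat_r; [|auto].
        left. apply Rinv_0_lt_compat, pow_lt. lra.
      * unfold Rdiv. rewrite Rpow_mult_distr, pow_inv. ring.
    + pose proof (cauchy_kernel_bound w z ltac:(lra)). rewrite Hw in *. auto.
Qed.

Lemma taylor_approx f z r M N : analytic f -> Cmod z < r -> r < 1 ->
  (forall w, Cmod w = r -> Cmod (f w) <= M) ->
  Cmod (f z - csum (taylor f) z N) <= M * (Cmod z / r) ^ N * (r / (r - Cmod z)).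
Proof.
  intros Hf Hz Hr HM. apply taylor_approx_param; auto.
  intros t _. apply HM, Cmod_circle. pose proof (Cmod_ge_0 z). lra.
Qed.

Lemma analytic_bound_param f z r M : analytic f -> Cmod z < r -> r < 1 ->
  (forall t, 0 <= t <= 2 * PI -> Cmod (f (RtoC r * cis t)%C) <= M) -> Cmod (f z) <= M * (r / (r - Cmod z)).
Proof.
  intros Hf Hz Hr HM. pose proof (taylor_approx_param f z r M 0 Hf Hz Hr HM) as H. simpl in H.
  replace (f z - 0)%C with (f z) in H by ring. now rewrite Rmult_1_r in H.
Qed.

(** Cauchy's formula on the circle of radius [s = (1 + r) / 2] bounds [f] inside by its maximum
    there, so compactness is needed only for an interval of angles. *)
Lemma analytic_bounded f r : analytic f -> r < 1 -> exists M, 0 < M /\ forall z, Cmod z <= r -> Cmod (f z) <= M.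
Proof.
  intros Hf Hr. destruct (Rlt_le_dec r 0) as [Hn|Hr0].
  { exists 1. split; [lra|]. intros z Hz. pose proof (Cmod_ge_0 z). lra. }
  set (s := (1 + r) / 2). assert (Hs : r < s < 1) by (unfold s; lra).
  assert (Hc : forall t, rcont (fun t => f (RtoC s * cis t)%C) t).
  { intros t. apply ccont_rcont_circle; [lra|]. rewrite analytic_cdl in Hf.
    eapply cdl_ccont, Hf. unfold inD. rewrite Cmod_circle; lra. }
  destruct (continuity_ab_maj (fun t => Cmod (f (RtoC s * cis t)%C)) 0 (2 * PI)) as [x [Hx _]].
  - pose proof two_PI_pos. lra.
  - intros t _ eps Heps. destruct (Hc t eps Heps) as [d [Hd1 Hd]]. exists d. split; auto.
    intros u [_ Hu]. specialize (Hd u Hu). simpl. unfold R_dist.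
    pose proof (Cmod_triang_rev (f (RtoC s * cis u)%C) (f (RtoC s * cis t)%C)) as T1.
    pose proof (Cmod_triang_rev (f (RtoC s * cis t)%C) (f (RtoC s * cis u)%C)) as T2.
    rewrite (Cmod_sym (f (RtoC s * cis t)%C)) in T2. apply Rabs_def1; lra.
  - set (M0 := Cmod (f (RtoC s * cis x)%C)) in *. assert (HM0 : 0 <= M0) by apply Cmod_ge_0.
    assert (HK : 0 <= s / (s - r)) by (apply Rle_mult_inv_pos; lra).
    exists (M0 * (s / (s - r)) + 1). split; [nra|]. intros z Hz.
    apply Rle_trans with (M0 * (s / (s - Cmod z))); [apply analytic_bound_param; auto; lra|].
    apply Rle_trans with (M0 * (s / (s - r))); [|lra].
    apply Rmult_le_compat_l; auto. apply Rmult_le_compat_l; [lra|]. apply Rinv_le_contravar; lra.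
Qed.

Lemma analytic_ccont f z : analytic f -> inD z -> ccont f z.
Proof. intros Hf Hz. rewrite analytic_cdl in Hf. eapply cdl_ccont, Hf, Hz. Qed.


Lemma cderiv_cdl f z : analytic f -> inD z -> cdl f z (cderiv f z).
Proof. intros Hf. now apply analytic_cdl. Qed.

(** The remainder after two terms is at most [8 M |w|^2] for [|w| < 1 / 4], which identifies the
    linear coefficient as the derivative. *)
Lemma cderiv_0_taylor f : analytic f -> cderiv f 0 = taylor f 1.
Proof.
  intros Hf. destruct (analytic_bounded f (1 / 2) Hf ltac:(lra)) as [M [HM0 HM]].
  assert (HM' : forall w, Cmod w = 1 / 2 -> Cmod (f w) <= M) by (intros w Hw; apply HM; lra).
  assert (H0 : f 0 = taylor f 0).
  { pose proof (taylor_approx f 0 (1 / 2) M 1 Hf ltac:(rewrite Cmod_0; lra) ltac:(lra) HM') as H.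
    rewrite Cmod_0 in H. simpl in H. apply Ceq_minus. apply Cmod_eps_0. intros e He.
    replace (f 0 - taylor f 0)%C with (f 0 - (0 + taylor f 0 * 1))%C by ring.
    eapply Rle_trans; [exact H|]. unfold Rdiv. nra. }
  apply cderiv_unique. intros eps Heps.
  exists (Rmin (1 / 4) (eps / (8 * M))). split; [apply Rmin_pos; [lra|apply Rdiv_lt_0_compat; lra]|].
  intros w Hw. replace (w - 0)%C with w in * by ring.
  pose proof (Rmin_l (1 / 4) (eps / (8 * M))). pose proof (Rmin_r (1 / 4) (eps / (8 * M))).
  pose proof (taylor_approx f w (1 / 2) M 2 Hf ltac:(lra) ltac:(lra) HM') as HT.
  pose proof (Cmod_ge_0 w). simpl in HT.
  replace (f w - (0 + taylor f 0 * 1 + taylor f 1 * (w * 1)))%C with (f w - f 0 - taylor f 1 * w)%C in HT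
    by (rewrite H0; ring).
  eapply Rle_trans; [exact HT|].
  set (h := Cmod w) in *.
  assert (K1 : 1 / 2 / (1 / 2 - h) <= 2).
  { apply Rmult_le_reg_r with (1 / 2 - h); [lra|]. unfold Rdiv at 1. rewrite Rmult_assoc, Rinv_l; lra. }
  replace (h / (1 / 2) * (h / (1 / 2) * 1)) with (4 * (h * h)) by field.
  apply Rle_trans with (M * (4 * (h * h)) * 2).
  - apply Rmult_le_compat_l; [|lra]. apply Rmult_le_pos; [lra|]. nra.
  - assert (8 * M * h <= eps).
    { apply Rle_trans with (8 * M * (eps / (8 * M))); [apply Rmult_le_compat_l; lra|]. right; field; lra. }
    nra.
Qed.

Lemma inD_rescale z0 rho w : 0 < rho -> Cmod z0 + rho <= 1 -> inD w -> inD (z0 + RtoC rho * w)%C.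
Proof.
  unfold inD. intros H1 H2 Hw. eapply Rle_lt_trans; [apply Cmod_triangle|].
  rewrite Cmod_mult, Cmod_R, Rabs_pos_eq by lra. nra.
Qed.

Lemma analytic_rescale f z0 rho : analytic f -> 0 < rho -> Cmod z0 + rho <= 1 ->
  analytic (fun w => f (z0 + RtoC rho * w)%C) /\
  forall w, inD w -> cderiv (fun w => f (z0 + RtoC rho * w)%C) w = (cderiv f (z0 + RtoC rho * w) * RtoC rho)%C.
Proof.
  intros Hf H1 H2. apply (analytic_intro _ (fun w => cderiv f (z0 + RtoC rho * w) * RtoC rho)%C).
  intros w Hw. apply (cdl_comp f (fun w => z0 + RtoC rho * w)%C); [|apply cdl_affine].
  apply cderiv_cdl; auto. now apply inD_rescale.
Qed.

Lemma inD_0 : inD 0.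
Proof. unfold inD. rewrite Cmod_0. lra. Qed.

(** Rescaling by [s = 1 - |z0|] carries the largest disk about [z0] to the unit disk, where the
    coefficient bound applies on the circle of radius [rho / s]. *)
Lemma cauchy_estimate f z0 rho M : analytic f -> 0 < rho -> Cmod z0 + rho < 1 ->
  (forall w, Cmod (w - z0) = rho -> Cmod (f w) <= M) -> Cmod (cderiv f z0) * rho <= M.
Proof.
  intros Hf Hrho H1 HM. pose proof (Cmod_ge_0 z0) as Hz0.
  set (s := 1 - Cmod z0). assert (Hs : rho < s) by (unfold s; lra).
  destruct (analytic_rescale f z0 s Hf ltac:(lra) ltac:(unfold s; lra)) as [Ha Hd].
  specialize (Hd 0 inD_0). rewrite cderiv_0_taylor in Hd by auto.
  replace (z0 + RtoC s * 0)%C with z0 in Hd by ring.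
  assert (Hr : 0 < rho / s < 1).
  { split; [apply Rdiv_lt_0_compat; lra|]. apply Rmult_lt_reg_r with s; [lra|].
    unfold Rdiv. rewrite Rmult_assoc, Rinv_l; lra. }
  pose proof (taylor_bound _ 1 (rho / s) M Ha Hr) as HT. rewrite Hd in HT.
  rewrite Cmod_mult, Cmod_R, Rabs_pos_eq, pow_1 in HT by lra.
  replace (Cmod (cderiv f z0) * rho) with (Cmod (cderiv f z0) * s * (rho / s)) by (field; lra).
  apply HT. intros w Hw. apply HM. replace (z0 + s * w - z0)%C with (s * w)%C by ring.
  rewrite Cmod_mult, Cmod_R, Rabs_pos_eq, Hw by lra. field. lra.
Qed.

(** * Locally uniform convergence *)

(** Taking the real part of [conj u * f] with [u = f b - f a] projects the increment onto its own
    direction, so the real mean value theorem applies without loss in the constant. *)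
Lemma mean_value_inequality f df (a b : C) K :
  (forall t : R, 0 <= t <= 1 -> cdl f (a + (b - a) * t)%C (df (a + (b - a) * t)%C) /\ Cmod (df (a + (b - a) * t)%C) <= K) ->
  Cmod (f b - f a) <= K * Cmod (b - a).
Proof.
  intros H. set (u := (f b - f a)%C). set (v := (b - a)%C) in *.
  set (phi := fun t : R => fst (Cconj u * f (a + v * RtoC t))%C).
  assert (Hphi : forall t, 0 <= t <= 1 -> is_derive phi t (fst (v * (Cconj u * df (a + v * t)))%C)).
  { intros t Ht. apply (rdl_fst (fun t => Cconj u * f (a + v * RtoC t))%C).
    apply (cdl_rdl_line (fun w => Cconj u * f w)%C). apply cdl_scal. now apply H. }
  destruct (MVT_gen phi 0 1 (fun t => fst (v * (Cconj u * df (a + v * RtoC t)))%C)) as [c [Hc HE]].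
  - intros t Ht. rewrite Rmin_left, Rmax_right in Ht by lra. apply Hphi. lra.
  - intros t Ht. rewrite Rmin_left, Rmax_right in Ht by lra. apply continuity_pt_filterlim.
    apply (@ex_derive_continuous R_AbsRing R_NormedModule). eexists. apply Hphi. lra.
  - rewrite Rmin_left, Rmax_right in Hc by lra. rewrite Rminus_0_r, Rmult_1_r in HE.
    assert (Hu : phi 1 - phi 0 = Cmod u ^ 2).
    { rewrite Cmod2_alt. unfold phi. replace (a + v * 1)%C with b by (unfold v; ring).
      replace (a + v * 0)%C with a by ring.
      unfold u, Re, Im, Cconj, Cmult, Cminus, Cplus, Copp. simpl. ring. }
    rewrite Hu in HE. destruct (H c Hc) as [_ HK].
    pose proof (Rle_trans _ _ _ (Rle_abs _) (Rabs_fst_le (v * (Cconj u * df (a + v * c)))%C)) as H1.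
    rewrite <- HE in H1. rewrite !Cmod_mult, Cmod_conj in H1.
    destruct (Req_dec (Cmod u) 0) as [H0|H0].
    + rewrite H0. apply Rmult_le_pos; [|apply Cmod_ge_0]. eapply Rle_trans; [apply Cmod_ge_0|exact HK].
    + assert (0 < Cmod u) by (pose proof (Cmod_ge_0 u); lra).
      apply Rmult_le_reg_l with (Cmod u); auto.
      replace (Cmod u * Cmod u) with (Cmod u ^ 2) by ring. eapply Rle_trans; [exact H1|].
      replace (Cmod u * (K * Cmod v)) with (Cmod v * (Cmod u * K)) by ring.
      apply Rmult_le_compat_l; [apply Cmod_ge_0|]. apply Rmult_le_compat_l; lra.
Qed.

Lemma segment_Cmod (a b : C) (t : R) : 0 <= t <= 1 -> Cmod (a + (b - a) * t)%C <= Cmod a + Cmod (b - a).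
Proof.
  intros Ht. eapply Rle_trans; [apply Cmod_triangle|]. rewrite Cmod_mult, Cmod_R, Rabs_pos_eq by lra.
  pose proof (Cmod_ge_0 (b - a)). nra.
Qed.

(* [luc]: locally uniform convergence in the disk *)
Definition luc (F : nat -> C -> C) (G : C -> C) : Prop :=
  forall r, r < 1 -> forall eps, 0 < eps -> exists N, forall n, (N <= n)%nat ->
    forall z, Cmod z <= r -> Cmod (F n z - G z) <= eps.

Definition luc_cauchy (F : nat -> C -> C) : Prop :=
  forall r, r < 1 -> forall eps, 0 < eps -> exists N, forall n m, (N <= n)%nat -> (N <= m)%nat ->
    forall z, Cmod z <= r -> Cmod (F n z - F m z) <= eps.

(** The mean value inequality bounds the increments of [F m - F n] by [2 e |w - z|] uniformly in
    [m]. Letting [m] tend to infinity compares [G] with the single function [F n], which is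
    differentiable. *)
Lemma luc_derivative F dF G dG :
  (forall n z, inD z -> cdl (F n) z (dF n z)) -> luc F G -> luc dF dG ->
  forall z, inD z -> cdl G z (dG z).
Proof.
  intros HF HG HdG z Hz eps Heps. unfold inD in Hz. pose proof (Cmod_ge_0 z).
  set (r := (1 + Cmod z) / 2). assert (Hr : Cmod z < r < 1) by (unfold r; lra).
  set (e := eps / 4). assert (He : 0 < e) by (unfold e; lra).
  destruct (HdG r (proj2 Hr) e He) as [n Hn].
  destruct (HF n z Hz e He) as [d [Hd1 Hd]].
  exists (Rmin d (r - Cmod z)). split; [apply Rmin_pos; lra|]. intros w Hw.
  pose proof (Rmin_l d (r - Cmod z)). pose proof (Rmin_r d (r - Cmod z)).
  specialize (Hd w ltac:(lra)).
  assert (Hwr : Cmod w <= r).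
  { replace w with (z + (w - z))%C by ring. eapply Rle_trans; [apply Cmod_triangle|]. lra. }
  assert (K : forall m, (n <= m)%nat -> Cmod ((F m w - F n w) - (F m z - F n z)) <= 2 * e * Cmod (w - z)).
  { intros m Hm. apply (mean_value_inequality (fun v => F m v - F n v)%C (fun v => dF m v - dF n v)%C).
    intros t Ht. pose proof (segment_Cmod z w t Ht) as Hs.
    set (v := (z + (w - z) * t)%C) in *. assert (Hv : Cmod v <= r) by lra.
    split; [apply cdl_minus; apply HF; unfold inD; lra|].
    replace (dF m v - dF n v)%C with ((dF m v - dG v) - (dF n v - dG v))%C by ring.
    eapply Rle_trans; [apply Cmod_triang_sub|]. pose proof (Hn m Hm v Hv). pose proof (Hn n (Nat.le_refl n) v Hv). lra. }
  assert (K' : Cmod ((G w - F n w) - (G z - F n z)) <= 2 * e * Cmod (w - z)).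
  { apply le_epsilon. intros eta Heta.
    destruct (HG r (proj2 Hr) (eta / 2) ltac:(lra)) as [m Hm].
    set (M := Nat.max n m). specialize (K M (Nat.le_max_l _ _)).
    pose proof (Hm M (Nat.le_max_r _ _) w Hwr) as A1. pose proof (Hm M (Nat.le_max_r _ _) z ltac:(lra)) as A2.
    replace (G w - F n w - (G z - F n z))%C with
      ((F M w - F n w - (F M z - F n z)) - (F M w - G w) + (F M z - G z))%C by ring.
    eapply Rle_trans; [apply Cmod_triangle|]. eapply Rle_trans; [apply Rplus_le_compat_r, Cmod_triang_sub|]. lra. }
  replace (G w - G z - dG z * (w - z))%C with
    ((G w - F n w - (G z - F n z)) + (F n w - F n z - dF n z * (w - z)) + (dF n z - dG z) * (w - z))%C by ring.
  eapply Rle_trans; [apply Cmod_triangle|]. eapply Rle_trans; [apply Rplus_le_compat_r, Cmod_triangle|].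
  rewrite Cmod_mult. pose proof (Hn n (Nat.le_refl n) z ltac:(lra)) as A3.
  pose proof (Cmod_ge_0 (w - z)).
  assert (Cmod (dF n z - dG z) * Cmod (w - z) <= e * Cmod (w - z)) by (apply Rmult_le_compat_r; lra).
  replace eps with (4 * e) by (unfold e; field). lra.
Qed.

Lemma C_complete (u : nat -> C) :
  (forall eps, 0 < eps -> exists N, forall n m, (N <= n)%nat -> (N <= m)%nat -> Cmod (u n - u m) <= eps) ->
  exists l, forall eps, 0 < eps -> exists N, forall n, (N <= n)%nat -> Cmod (u n - l) <= eps.
Proof.
  intros H.
  destruct (Rcomplete.R_complete (fun n => fst (u n))) as [x Hx].
  { intros eps Heps. destruct (H (eps / 2) ltac:(lra)) as [N HN]. exists N. intros n m Hn Hm.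
    eapply Rle_lt_trans; [apply (Rabs_fst_le (u n - u m)%C)|]. specialize (HN n m Hn Hm). lra. }
  destruct (Rcomplete.R_complete (fun n => snd (u n))) as [y Hy].
  { intros eps Heps. destruct (H (eps / 2) ltac:(lra)) as [N HN]. exists N. intros n m Hn Hm.
    eapply Rle_lt_trans; [apply (Rabs_snd_le (u n - u m)%C)|]. specialize (HN n m Hn Hm). lra. }
  exists (x, y). intros eps Heps.
  destruct (Hx (eps / 2) ltac:(lra)) as [N1 H1]. destruct (Hy (eps / 2) ltac:(lra)) as [N2 H2].
  exists (Nat.max N1 N2). intros n Hn. specialize (H1 n ltac:(lia)). specialize (H2 n ltac:(lia)).
  unfold R_dist in *. eapply Rle_trans; [apply Cmod_le_abs|]. simpl. unfold Rminus in *. lra.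
Qed.

Lemma luc_complete F : luc_cauchy F -> exists G, luc F G.
Proof.
  intros H.
  assert (HG : forall z, exists l, inD z -> forall eps, 0 < eps -> exists N, forall n, (N <= n)%nat -> Cmod (F n z - l) <= eps).
  { intros z. destruct (Rlt_le_dec (Cmod z) 1) as [Hz|Hz].
    - destruct (C_complete (fun n => F n z)) as [l Hl]; [|exists l; auto].
      intros eps Heps. destruct (H (Cmod z) Hz eps Heps) as [N HN]. exists N. intros n m Hn Hm. apply HN; auto. lra.
    - exists 0. unfold inD. lra. }
  apply (choice (fun z l => inD z -> forall eps, 0 < eps -> exists N, forall n, (N <= n)%nat -> Cmod (F n z - l) <= eps)) in HG.
  destruct HG as [G HG]. exists G.
  intros r Hr eps Heps. destruct (H r Hr eps Heps) as [N HN]. exists N. intros n Hn z Hz.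
  apply le_epsilon. intros e He. destruct (HG z ltac:(unfold inD; lra) e He) as [N2 HN2].
  eapply Rle_trans; [apply (Cmod_dist_triang _ (F (Nat.max N N2) z))|].
  apply Rplus_le_compat; [apply HN; auto; lia|apply HN2; lia].
Qed.

Lemma luc_luc_cauchy F G : luc F G -> luc_cauchy F.
Proof.
  intros H r Hr eps Heps. destruct (H r Hr (eps / 2) ltac:(lra)) as [N HN]. exists N. intros n m Hn Hm z Hz.
  eapply Rle_trans; [apply (Cmod_dist_triang _ (G z))|]. rewrite (Cmod_sym (G z)).
  pose proof (HN n Hn z Hz). pose proof (HN m Hm z Hz). lra.
Qed.

(** * Sums, products and locally uniform limits of analytic functions *)

Lemma cdl_congr f g z l : (forall w, inD w -> f w = g w) -> inD z -> cdl f z l -> cdl g z l.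
Proof.
  intros H Hz. apply (cdl_ext_loc f g z l (1 - Cmod z)); [unfold inD in Hz; lra|].
  intros w Hw. apply H. unfold inD. replace w with (z + (w - z))%C by ring.
  eapply Rle_lt_trans; [apply Cmod_triangle|]. lra.
Qed.

Lemma analytic_congr f g : (forall w, inD w -> f w = g w) -> analytic f ->
  analytic g /\ forall z, inD z -> cderiv g z = cderiv f z.
Proof.
  intros H Hf. apply (analytic_intro g (cderiv f)). intros z Hz.
  apply (cdl_congr f); auto. now apply cderiv_cdl.
Qed.

Lemma analytic_plus f g : analytic f -> analytic g -> analytic (fun z => f z + g z)%C /\
  forall z, inD z -> cderiv (fun z => f z + g z)%C z = (cderiv f z + cderiv g z)%C.
Proof. intros Hf Hg. apply (analytic_intro _ (fun z => cderiv f z + cderiv g z)%C). intros z Hz. apply cdl_plus; now apply cderiv_cdl. Qed.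

Lemma analytic_minus f g : analytic f -> analytic g -> analytic (fun z => f z - g z)%C /\
  forall z, inD z -> cderiv (fun z => f z - g z)%C z = (cderiv f z - cderiv g z)%C.
Proof. intros Hf Hg. apply (analytic_intro _ (fun z => cderiv f z - cderiv g z)%C). intros z Hz. apply cdl_minus; now apply cderiv_cdl. Qed.

Lemma analytic_mult f g : analytic f -> analytic g -> analytic (fun z => f z * g z)%C.
Proof.
  intros Hf Hg. apply (analytic_intro _ (fun z => cderiv f z * g z + f z * cderiv g z)%C).
  intros z Hz. apply cdl_mult; now apply cderiv_cdl.
Qed.

Lemma analytic_const c : analytic (fun _ => c) /\ forall z, inD z -> cderiv (fun _ => c) z = 0.
Proof. apply (analytic_intro _ (fun _ => 0)). intros z _. apply cdl_const. Qed.

(** Cauchy's estimate on circles of radius [(1 - r) / 2] about points of [|z| <= r], which stay in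
    [|z| <= (1 + r) / 2]. *)
Lemma luc_cauchy_deriv F : (forall n, analytic (F n)) -> luc_cauchy F -> luc_cauchy (fun n => cderiv (F n)).
Proof.
  intros HF H r Hr eps Heps.
  destruct (Rlt_le_dec r 0) as [Hn|Hr0].
  { exists 0%nat. intros n m _ _ z Hz. pose proof (Cmod_ge_0 z). lra. }
  set (rho := (1 - r) / 2). assert (Hrho : 0 < rho) by (unfold rho; lra).
  destruct (H (r + rho) ltac:(unfold rho; lra) (eps * rho)) as [N HN]; [now apply Rmult_lt_0_compat|].
  exists N. intros n m Hn Hm z Hz.
  destruct (analytic_minus (F n) (F m) (HF n) (HF m)) as [Ha Hd].
  rewrite <- Hd by (unfold inD; lra).
  apply Rmult_le_reg_r with rho; auto.
  apply (cauchy_estimate (fun z => F n z - F m z)%C z rho); auto; [unfold rho; lra|].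
  intros w Hw. apply HN; auto. replace w with (z + (w - z))%C by ring.
  eapply Rle_trans; [apply Cmod_triangle|]. lra.
Qed.

Lemma weierstrass F G : (forall n, analytic (F n)) -> luc F G ->
  analytic G /\ luc (fun n => cderiv (F n)) (cderiv G).
Proof.
  intros HF HG.
  destruct (luc_complete (fun n => cderiv (F n))) as [d Hd].
  { apply luc_cauchy_deriv; auto. now apply luc_luc_cauchy with G. }
  destruct (analytic_intro G d) as [Ha Hdd].
  { apply (luc_derivative F (fun n => cderiv (F n))); auto. intros n z Hz. now apply cderiv_cdl. }
  split; auto. intros r Hr eps Heps. destruct (Hd r Hr eps Heps) as [N HN]. exists N. intros n Hn z Hz.
  rewrite Hdd by (unfold inD; lra). auto.
Qed.

Lemma pow_eventually_small q K eps : 0 <= q < 1 -> 0 <= K -> 0 < eps ->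
  exists N, forall n, (N <= n)%nat -> K * q ^ n <= eps.
Proof.
  intros Hq HK Heps. destruct (pow_lt_1_zero q ltac:(rewrite Rabs_pos_eq; lra) (eps / (1 + K))) as [N HN].
  { apply Rdiv_lt_0_compat; lra. }
  exists N. intros n Hn. specialize (HN n Hn). rewrite Rabs_pos_eq in HN by (apply pow_le; lra).
  assert (0 <= q ^ n) by (apply pow_le; lra).
  apply Rle_trans with ((1 + K) * q ^ n); [nra|].
  apply Rle_trans with ((1 + K) * (eps / (1 + K))); [apply Rmult_le_compat_l; lra|right; field; lra].
Qed.

(** The index depends on [r], [s], [M] and [eps] but not on [f]; Montel's theorem rests on this
    uniformity. *)
Lemma taylor_uniform r s M eps : 0 <= r < s -> s < 1 -> 0 <= M -> 0 < eps ->
  exists N, forall n, (N <= n)%nat -> forall f, analytic f -> (forall w, Cmod w <= s -> Cmod (f w) <= M) ->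
  forall z, Cmod z <= r -> Cmod (f z - csum (taylor f) z n) <= eps.
Proof.
  intros Hr Hs HM0 Heps.
  destruct (pow_eventually_small (r / s) (M * (s / (s - r))) eps) as [N HN].
  - split; [apply Rle_mult_inv_pos; lra|]. apply Rmult_lt_reg_r with s; [lra|]. unfold Rdiv. rewrite Rmult_assoc, Rinv_l; lra.
  - apply Rmult_le_pos; [lra|apply Rle_mult_inv_pos; lra].
  - auto.
  - exists N. intros n Hn f Hf HM z Hz. pose proof (Cmod_ge_0 z).
    eapply Rle_trans; [apply (taylor_approx f z s M n Hf); [lra|lra|intros w Hw; apply HM; lra]|].
    eapply Rle_trans; [|apply (HN n Hn)].
    replace (M * (s / (s - r)) * (r / s) ^ n) with (M * (r / s) ^ n * (s / (s - r))) by ring.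
    apply Rmult_le_compat.
    + apply Rmult_le_pos; [lra|]. apply pow_le. apply Rle_mult_inv_pos; lra.
    + apply Rle_mult_inv_pos; lra.
    + apply Rmult_le_compat_l; [lra|]. apply pow_incr. split; [apply Rle_mult_inv_pos; lra|].
      apply Rmult_le_compat_r; [left; apply Rinv_0_lt_compat; lra|lra].
    + apply Rmult_le_compat_l; [lra|]. apply Rinv_le_contravar; lra.
Qed.

Lemma taylor_luc f : analytic f -> luc (fun N z => csum (taylor f) z N) f.
Proof.
  intros Hf r Hr eps Heps.
  destruct (Rlt_le_dec r 0) as [Hn|Hr0].
  { exists 0%nat. intros n _ z Hz. pose proof (Cmod_ge_0 z). lra. }
  set (s := (1 + r) / 2). assert (Hs : r < s < 1) by (unfold s; lra).
  destruct (analytic_bounded f s Hf ltac:(lra)) as [M [HM0 HM]].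
  destruct (taylor_uniform r s M eps) as [N HN]; try lra.
  exists N. intros n Hn z Hz. rewrite Cmod_sym. now apply HN.
Qed.

(** * Derivatives and primitives of analytic functions *)

Fixpoint dcsum (a : nat -> C) (z : C) (N : nat) : C :=
  match N with O => 0 | S n => (dcsum a z n + a n * (INR n * z ^ (n - 1)))%C end.

Lemma csum_cdl a N z : cdl (fun z => csum a z N) z (dcsum a z N).
Proof.
  induction N as [|n IH]; simpl; [apply cdl_const|]. apply cdl_plus; auto. apply cdl_scal, cdl_pow.
Qed.

Lemma dcsum_cdiff a N z : cdiff (fun z => dcsum a z N) z.
Proof.
  induction N as [|n IH]; simpl; [apply cdiff_const|]. apply cdiff_plus; auto.
  apply cdiff_mult; [apply cdiff_const|]. apply cdiff_mult; [apply cdiff_const|]. apply cdiff_pow, cdiff_id.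
Qed.

Lemma cdiff_analytic f : (forall z, inD z -> cdiff f z) -> analytic f.
Proof. intros H z Hz. destruct (H z Hz) as [l Hl]. exists l. now apply is_derive_cdl. Qed.

(** The Taylor polynomials converge locally uniformly, hence so do their derivatives, which are
    again polynomials; Weierstrass's theorem applies to the latter. *)
Lemma cderiv_analytic f : analytic f -> analytic (cderiv f).
Proof.
  intros Hf.
  assert (Hp : forall N, analytic (fun z => csum (taylor f) z N)).
  { intros N. apply (analytic_intro _ (fun z => dcsum (taylor f) z N)). intros z _. apply csum_cdl. }
  destruct (weierstrass _ f Hp (taylor_luc f Hf)) as [_ H].
  apply (weierstrass (fun N => cderiv (fun z => csum (taylor f) z N))); auto.
  intros N. apply (analytic_congr (fun z => dcsum (taylor f) z N)).
  - intros w _. symmetry. apply cderiv_unique, csum_cdl.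
  - apply cdiff_analytic. intros z _. apply dcsum_cdiff.
Qed.

Fixpoint icsum (a : nat -> C) (z : C) (N : nat) : C :=
  match N with O => 0 | S n => (icsum a z n + a n * RtoC (/ INR (S n)) * z ^ S n)%C end.

Lemma icsum_cdl a N z : cdl (fun z => icsum a z N) z (csum a z N).
Proof.
  induction N as [|n IH]; [simpl; apply cdl_const|]. cbn [icsum csum].
  apply cdl_plus; auto. eapply cdl_eq; [apply cdl_scal, cdl_pow|].
  replace (S n - 1)%nat with n by lia.
  replace (a n * RtoC (/ INR (S n)) * (RtoC (INR (S n)) * z ^ n))%C with
    (a n * z ^ n * (RtoC (/ INR (S n) * INR (S n))))%C by (rewrite RtoC_mult; ring).
  rewrite Rinv_l by (apply not_0_INR; lia). ring.
Qed.

Lemma icsum_0 a N : icsum a 0 N = 0.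
Proof. induction N as [|n IH]; [reflexivity|]. cbn [icsum]. rewrite IH, Cpow_S. ring. Qed.

(** The primitives of the Taylor polynomials that vanish at [0] form a locally uniform Cauchy
    sequence by the mean value inequality. *)
Lemma analytic_primitive f : analytic f -> exists P, forall z, inD z -> cdl P z (f z).
Proof.
  intros Hf. pose proof (taylor_luc f Hf) as HT.
  destruct (luc_complete (fun N z => icsum (taylor f) z N)) as [P HP].
  - intros r Hr eps Heps. destruct (luc_luc_cauchy _ _ HT r Hr eps Heps) as [N HN]. exists N. intros n m Hn Hm z Hz.
    pose proof (mean_value_inequality (fun z => icsum (taylor f) z n - icsum (taylor f) z m)%C
      (fun z => csum (taylor f) z n - csum (taylor f) z m)%C 0 z eps) as H.
    cbv beta in H. rewrite !icsum_0 in H.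
    replace (icsum (taylor f) z n - icsum (taylor f) z m - (0 - 0))%C with (icsum (taylor f) z n - icsum (taylor f) z m)%C in H by ring.
    replace (z - 0)%C with z in H by ring.
    apply Rle_trans with (eps * Cmod z); [|pose proof (Cmod_ge_0 z); nra].
    apply H. intros t Ht. split; [apply cdl_minus; apply icsum_cdl|]. apply HN; auto.
    replace (0 + z * t)%C with (z * t)%C by ring. rewrite Cmod_mult, Cmod_R, Rabs_pos_eq by lra.
    pose proof (Cmod_ge_0 z). nra.
  - exists P. apply (luc_derivative (fun N z => icsum (taylor f) z N) (fun N z => csum (taylor f) z N)); auto.
    intros n z _. apply icsum_cdl.
Qed.

Lemma inD_segment z t : inD z -> 0 <= t <= 1 -> inD (0 + z * RtoC t)%C.
Proof.
  unfold inD. intros Hz Ht. replace (0 + z * t)%C with (z * t)%C by ring.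
  rewrite Cmod_mult, Cmod_R, Rabs_pos_eq by lra. pose proof (Cmod_ge_0 z). nra.
Qed.

(** The segment integral in [Sg] equals [P z - P 0] for a primitive [P] of [f' g]. *)
Lemma Sg_spec g f : analytic g -> analytic f ->
  analytic (Sg g f) /\ (forall z, inD z -> cderiv (Sg g f) z = (cderiv f z * g z)%C) /\ Sg g f 0 = 0.
Proof.
  intros Hg Hf.
  assert (Hh : analytic (fun z => cderiv f z * g z)%C) by (apply analytic_mult; auto; now apply cderiv_analytic).
  destruct (analytic_primitive _ Hh) as [P HP].
  assert (HS : forall z, inD z -> (P z - P 0)%C = Sg g f z).
  { intros z Hz. pose proof (CInt_line P (fun z => cderiv f z * g z)%C 0 z 0 1 ltac:(lra)) as H.
    replace (0 + z * 1)%C with z in H by ring. replace (0 + z * 0)%C with (RtoC 0) in H by ring.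
    rewrite <- H.
    - change (Sg g f z) with (z * CInt (fun t => cderiv f (RtoC t * z) * g (RtoC t * z)) 0 1)%C.
      f_equal. apply CInt_ext; [lra|]. intros t _. replace (0 + z * t)%C with (t * z)%C by ring. reflexivity.
    - intros t Ht. apply HP. now apply inD_segment.
    - intros t Ht. apply analytic_ccont; auto. now apply inD_segment. }
  assert (Hd : forall z, inD z -> cdl (Sg g f) z (cderiv f z * g z)%C).
  { intros z Hz. apply (cdl_congr (fun z => P z - P 0)%C); auto.
    eapply cdl_eq; [apply cdl_minus; [now apply HP|apply cdl_const]|]. ring. }
  destruct (analytic_intro _ _ Hd) as [Ha Hc]. split; [auto|split; [auto|]].
  unfold Sg. ring.
Qed.

(** * Montel's theorem *)

Lemma bounded_cluster (x : nat -> R) B : (forall n, Rabs (x n) <= B) ->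
  exists l, forall eps, 0 < eps -> forall N, exists n, (N <= n)%nat /\ Rabs (x n - l) < eps.
Proof.
  intros H. destruct (Bolzano_Weierstrass x (fun c => - B <= c <= B) (compact_P3 (- B) B)) as [l Hl].
  { intros n. apply Rabs_le_between, H. }
  exists l. intros eps Heps N.
  destruct (Hl (disc l (mkposreal eps Heps)) N) as [p [Hp1 Hp2]].
  { exists (mkposreal eps Heps). intros y Hy. exact Hy. }
  exists p. split; auto.
Qed.

(** Simultaneous cluster values are built in place of nested subsequences: stage [K] appends a value
    for row [K] and never changes the earlier ones, so the diagonal [u (S k) k] is consistent with
    every stage. *)
Lemma diagonal_cluster (X : nat -> nat -> R) (B : nat -> R) : (forall k n, Rabs (X k n) <= B k) ->
  exists a : nat -> R, forall K eps N, 0 < eps -> exists n, (N <= n)%nat /\ forall k, (k < K)%nat -> Rabs (X k n - a k) < eps.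
Proof.
  intros HB.
  destruct (dependent_choice (nat -> R)
    (fun K a => forall eps N, 0 < eps -> exists n, (N <= n)%nat /\ forall k, (k < K)%nat -> Rabs (X k n - a k) < eps)
    (fun K a b => forall k, (k < K)%nat -> b k = a k) (fun _ => 0)) as [u [_ Hu]].
  - intros eps N _. exists N. split; [lia|]. intros k Hk. lia.
  - intros K a Ha.
    assert (Hn : forall j, exists n, (j <= n)%nat /\ forall k, (k < K)%nat -> Rabs (X k n - a k) < / INR (S j)).
    { intros j. apply Ha. apply Rinv_0_lt_compat, lt_0_INR. lia. }
    apply (choice (fun j n => (j <= n)%nat /\ forall k, (k < K)%nat -> Rabs (X k n - a k) < / INR (S j))) in Hn.
    destruct Hn as [s Hs].
    (* Row [K] is clustered only along indices [s j] at which the earlier rows are already within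
       [1 / (j + 1)] of their values. *)
    destruct (bounded_cluster (fun j => X K (s j)) (B K)) as [l Hl]; [intros; apply HB|].
    exists (fun k => if Nat.eq_dec k K then l else a k). split.
    + intros eps N Heps.
      destruct (archimed_cor1 eps Heps) as [M [HM1 HM2]].
      destruct (Hl eps Heps (Nat.max N M)) as [j [Hj1 Hj2]].
      destruct (Hs j) as [Hsj1 Hsj2]. exists (s j). split; [lia|].
      intros k Hk. destruct (Nat.eq_dec k K) as [->|Hne]; [exact Hj2|].
      apply Rlt_trans with (/ INR (S j)); [apply Hsj2; lia|]. eapply Rle_lt_trans; [|exact HM1].
      apply Rinv_le_contravar; [apply lt_0_INR; lia|]. apply le_INR. lia.
    + intros k Hk. destruct (Nat.eq_dec k K); [lia|reflexivity].
  - exists (fun k => u (S k) k).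
    assert (Hst : forall k d, u (S k + d)%nat k = u (S k) k).
    { intros k d. induction d as [|d IH]; [now rewrite Nat.add_0_r|].
      rewrite Nat.add_succ_r. rewrite (proj2 (Hu (S k + d)%nat)) by lia. exact IH. }
    intros K eps N Heps. destruct (proj1 (Hu K) eps N Heps) as [n [Hn1 Hn2]]. exists n. split; auto.
    intros k Hk. rewrite <- (Hst k (K - S k)%nat). replace (S k + (K - S k))%nat with K by lia. auto.
Qed.

Lemma csum_close a b z K d : Cmod z <= 1 -> (forall k, (k < K)%nat -> Cmod (a k - b k) <= d) ->
  Cmod (csum a z K - csum b z K) <= INR K * d.
Proof.
  intros Hz. induction K as [|K IH]; intros H.
  - simpl. replace (0 - 0)%C with (RtoC 0) by ring. rewrite Cmod_0. lra.
  - cbn [csum]. rewrite S_INR.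
    replace (csum a z K + a K * z ^ K - (csum b z K + b K * z ^ K))%C with
      ((csum a z K - csum b z K) + (a K - b K) * z ^ K)%C by ring.
    eapply Rle_trans; [apply Cmod_triangle|]. rewrite Cmod_mult, Cmod_pow.
    specialize (IH (fun k Hk => H k ltac:(lia))). specialize (H K ltac:(lia)).
    assert (0 <= Cmod z ^ K <= 1).
    { split; [apply pow_le, Cmod_ge_0|]. rewrite <- (pow1 K). apply pow_incr. pose proof (Cmod_ge_0 z). lra. }
    pose proof (Cmod_ge_0 (a K - b K)). nra.
Qed.

Lemma increasing_ge (phi : nat -> nat) : (forall n, (phi n < phi (S n))%nat) -> forall n, (n <= phi n)%nat.
Proof. intros H n. induction n as [|n IH]; [lia|]. specialize (H n). lia. Qed.

(** A subsequence is chosen along which every Taylor coefficient converges. On a smaller disk the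
    tails of the expansions are uniformly small, and finitely many coefficients control the rest. *)
Lemma montel (fs : nat -> C -> C) : (forall n, analytic (fs n)) ->
  (forall r, r < 1 -> exists M, forall n z, Cmod z <= r -> Cmod (fs n z) <= M) ->
  exists phi f, (forall n, (phi n < phi (S n))%nat) /\ analytic f /\ luc (fun n => fs (phi n)) f.
Proof.
  intros Hfs HM.
  destruct (HM (1 / 2) ltac:(lra)) as [M2 HM2].
  assert (Hb : forall k n, Cmod (taylor (fs n) k) <= M2 / (1 / 2) ^ k).
  { intros k n. assert (0 < (1 / 2) ^ k) by (apply pow_lt; lra).
    apply Rmult_le_reg_r with ((1 / 2) ^ k); auto. unfold Rdiv at 2. rewrite Rmult_assoc, Rinv_l, Rmult_1_r by lra.
    apply taylor_bound; auto; [lra|]. intros w Hw. apply HM2. lra. }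
  (* Even rows hold the real parts and odd rows the imaginary parts of the coefficients. *)
  set (X k n := if Nat.even k then fst (taylor (fs n) (Nat.div2 k)) else snd (taylor (fs n) (Nat.div2 k))).
  destruct (diagonal_cluster X (fun k => M2 / (1 / 2) ^ (Nat.div2 k))) as [a Ha].
  { intros k n. unfold X. destruct (Nat.even k); (eapply Rle_trans; [|apply Hb]); [apply Rabs_fst_le|apply Rabs_snd_le]. }
  set (b k := (a (2 * k)%nat, a (S (2 * k))) : C).
  assert (Hcl : forall K N, exists n, (N <= n)%nat /\ forall k, (k < K)%nat -> Cmod (taylor (fs n) k - b k) <= 2 / INR (S K)).
  { intros K N. destruct (Ha (2 * K)%nat (/ INR (S K)) N) as [n [Hn1 Hn2]].
    { apply Rinv_0_lt_compat, lt_0_INR. lia. }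
    exists n. split; auto. intros k Hk. eapply Rle_trans; [apply Cmod_le_abs|].
    pose proof (Hn2 (2 * k)%nat ltac:(lia)) as A1. pose proof (Hn2 (S (2 * k)) ltac:(lia)) as A2.
    unfold X in A1, A2.
    rewrite Nat.div2_succ_double in A2. rewrite Nat.div2_double in A1.
    rewrite Nat.even_succ, <- Nat.negb_even, Nat.even_mul in A2. rewrite Nat.even_mul in A1.
    unfold b. set (T := taylor (fs n) k) in *. clearbody T.
    change (Nat.even 2) with true in A1, A2. cbn [orb negb] in A1, A2.
    change (Rabs (fst T - a (2 * k)%nat) + Rabs (snd T - a (S (2 * k))) <= 2 / INR (S K)). unfold Rdiv. lra. }
  (* Stage [j] controls the first [j] coefficients up to [2 / (j + 1)]; at stage [0] nothing is
     asked, so any index may start. *)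
  destruct (dependent_choice nat (fun j n => forall k, (k < j)%nat -> Cmod (taylor (fs n) k - b k) <= 2 / INR (S j))
    (fun _ n m => (n < m)%nat) 0%nat) as [phi [_ Hphi]].
  { intros k Hk. lia. }
  { intros j n _. destruct (Hcl (S j) (S n)) as [m [Hm1 Hm2]]. exists m. split; auto. }
  assert (Hcau : luc_cauchy (fun n => fs (phi n))).
  { intros r Hr eps Heps. destruct (Rlt_le_dec r 0) as [Hn|Hr0].
    { exists 0%nat. intros n m _ _ z Hz. pose proof (Cmod_ge_0 z). lra. }
    set (s := (1 + r) / 2). assert (Hs : r < s < 1) by (unfold s; lra).
    destruct (HM s (proj2 Hs)) as [M HMs].
    assert (HM0 : 0 <= M) by (eapply Rle_trans; [apply Cmod_ge_0|apply (HMs 0%nat 0); rewrite Cmod_0; lra]).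
    destruct (taylor_uniform r s M (eps / 4)) as [K HK]; try lra.
    assert (Htail : forall n z, Cmod z <= r -> Cmod (fs n z - csum (taylor (fs n)) z K) <= eps / 4).
    { intros n z Hz. apply HK; auto. }
    assert (He : 0 < eps / (8 * (1 + INR K))) by (apply Rdiv_lt_0_compat; [lra|pose proof (pos_INR K); lra]).
    destruct (archimed_cor1 _ He) as [N [HN1 HN2]].
    exists (Nat.max N K).
    assert (Hco : forall n z, (Nat.max N K <= n)%nat -> Cmod z <= r -> Cmod (csum (taylor (fs (phi n))) z K - csum b z K) <= eps / 4).
    { intros n z Hn Hz. pose proof (pos_INR K).
      eapply Rle_trans; [apply (csum_close _ _ _ _ (2 / INR (S n))); [lra|]|].
      - intros k Hk. apply Hphi. lia.
      - assert (/ INR (S n) <= eps / (8 * (1 + INR K))).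
        { left. eapply Rle_lt_trans; [|exact HN1]. apply Rinv_le_contravar; [now apply lt_0_INR|]. apply le_INR. lia. }
        apply Rle_trans with (INR K * (2 * (eps / (8 * (1 + INR K))))).
        + apply Rmult_le_compat_l; [lra|]. unfold Rdiv at 1. lra.
        + replace (INR K * (2 * (eps / (8 * (1 + INR K))))) with (eps / 4 * (INR K / (1 + INR K))) by (field; lra).
          rewrite <- (Rmult_1_r (eps / 4)) at 2. apply Rmult_le_compat_l; [lra|].
          apply Rmult_le_reg_r with (1 + INR K); [lra|]. unfold Rdiv. rewrite Rmult_assoc, Rinv_l; lra. }
    intros n m Hn Hm z Hz.
    pose proof (Htail (phi n) z Hz) as T1. pose proof (Htail (phi m) z Hz) as T2.
    pose proof (Hco n z Hn Hz) as C1. pose proof (Hco m z Hm Hz) as C2.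
    match type of T1 with Cmod ?A <= _ => match type of T2 with Cmod ?B <= _ =>
    match type of C1 with Cmod ?D <= _ => match type of C2 with Cmod ?E <= _ =>
      replace (fs (phi n) z - fs (phi m) z)%C with ((A - B) + (D - E))%C by ring;
      eapply Rle_trans; [apply Cmod_triangle|];
      pose proof (Cmod_triang_sub A B); pose proof (Cmod_triang_sub D E); lra
    end end end end. }
  destruct (luc_complete _ Hcau) as [f Hf].
  exists phi, f. split; [intros n; apply Hphi|]. split; auto.
  apply (weierstrass (fun n => fs (phi n))); auto.
Qed.

(** * The gliding hump *)

(** A geometric sum. The starting index [K] is a parameter because, in the hump argument, the
    increments at a given point become small only after the hump there has been passed. *)
Lemma telescope (w c : R) (x : nat -> C) (K : nat) : 0 <= w ->
  (forall k, (K <= k)%nat -> w * Cmod (x (S k) - x k) <= c * (1 / 2) ^ k) ->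
  forall n m, (K <= n)%nat -> (n <= m)%nat -> w * Cmod (x m - x n) <= 2 * c * (1 / 2) ^ n.
Proof.
  intros Hw H.
  (* The subtracted power makes the induction on [d] close. *)
  assert (HK : forall n d, (K <= n)%nat -> w * Cmod (x (n + d)%nat - x n) <= 2 * c * (1 / 2) ^ n - 2 * c * (1 / 2) ^ (n + d)).
  { intros n d Hn. induction d as [|d IH].
    - rewrite Nat.add_0_r. replace (x n - x n)%C with (RtoC 0) by ring. rewrite Cmod_0. lra.
    - rewrite Nat.add_succ_r. specialize (H (n + d)%nat ltac:(lia)). cbn [pow].
      pose proof (Cmod_dist_triang (x (S (n + d))) (x (n + d)%nat) (x n)) as T.
      apply (Rmult_le_compat_l w) in T; auto. rewrite Rmult_plus_distr_l in T. lra. }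
  assert (Hc : (K <= K)%nat -> 0 <= c).
  { intros HKK. specialize (H K HKK). assert (0 < (1 / 2) ^ K) by (apply pow_lt; lra).
    assert (0 <= w * Cmod (x (S K) - x K)) by (apply Rmult_le_pos; [auto|apply Cmod_ge_0]).
    apply Rmult_le_reg_r with ((1 / 2) ^ K); lra. }
  specialize (Hc (Nat.le_refl K)).
  intros n m Hn Hm. replace m with (n + (m - n))%nat by lia. eapply Rle_trans; [now apply HK|].
  assert (0 < (1 / 2) ^ (n + (m - n))) by (apply pow_lt; lra). nra.
Qed.

Lemma luc_weighted_limit (X : nat -> C -> C) (l : C -> C) (z a : C) (w b : R) n :
  luc X l -> inD z -> 0 <= w -> (forall m, (n <= m)%nat -> w * Cmod (X m z - a) <= b) -> w * Cmod (l z - a) <= b.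
Proof.
  intros HX Hz Hw H. apply le_epsilon. intros e He.
  destruct (HX (Cmod z) Hz (e / (1 + w))) as [N HN]; [apply Rdiv_lt_0_compat; lra|].
  specialize (HN (Nat.max n N) ltac:(lia) z ltac:(lra)). specialize (H (Nat.max n N) ltac:(lia)).
  pose proof (Cmod_dist_triang (l z) (X (Nat.max n N) z) a) as T. rewrite (Cmod_sym (l z) (X (Nat.max n N) z)) in T.
  apply (Rmult_le_compat_l w) in T; auto. rewrite Rmult_plus_distr_l in T.
  assert (w * Cmod (X (Nat.max n N) z - l z) <= e); [|lra].
  apply Rle_trans with ((1 + w) * (e / (1 + w))); [|right; field; lra].
  apply Rmult_le_compat; try lra. apply Cmod_ge_0.
Qed.

Lemma half_pow_le_1 k : (1 / 2) ^ k <= 1.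
Proof.
  induction k as [|k IH]; simpl; [lra|]. assert (0 < (1 / 2) ^ k) by (apply pow_lt; lra). lra.
Qed.

Lemma half_pow_eventually r : r < 1 -> exists K, forall k, (K <= k)%nat -> r <= 1 - (1 / 2) ^ k.
Proof.
  intros Hr. destruct (pow_eventually_small (1 / 2) 1 (1 - r)) as [K HK]; try lra.
  exists K. intros k Hk. specialize (HK k Hk). lra.
Qed.

Lemma lim_bdry0_add (w : R -> R) (f g h : C -> C) : (forall r, 0 <= r < 1 -> 0 <= w r) ->
  (forall z, inD z -> h z = (f z + g z)%C) ->
  lim_bdry0 (fun z => wt w z * Cmod (f z)) -> lim_bdry0 (fun z => wt w z * Cmod (g z)) ->
  lim_bdry0 (fun z => wt w z * Cmod (h z)).
Proof.
  intros Hw Hh Hf Hg eps Heps.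
  destruct (Hf (eps / 2) ltac:(lra)) as [r1 [Hr1 K1]]. destruct (Hg (eps / 2) ltac:(lra)) as [r2 [Hr2 K2]].
  exists (Rmax r1 r2). split; [now apply Rmax_lub_lt|]. intros z Hz Hrz.
  pose proof (Rmax_l r1 r2). pose proof (Rmax_r r1 r2).
  specialize (K1 z Hz ltac:(lra)). specialize (K2 z Hz ltac:(lra)).
  assert (Hwz : 0 <= wt w z) by (apply Hw; split; [apply Cmod_ge_0|exact Hz]).
  rewrite Rabs_pos_eq in * by (apply Rmult_le_pos; [auto|apply Cmod_ge_0]).
  rewrite Hh by auto. pose proof (Cmod_triangle (f z) (g z)) as T.
  apply (Rmult_le_compat_l (wt w z)) in T; auto. lra.
Qed.

Lemma lim_bdry0_zero (w : R -> R) (f : C -> C) : (forall z, inD z -> f z = 0) ->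
  lim_bdry0 (fun z => wt w z * Cmod (f z)).
Proof.
  intros H eps Heps. exists 0. split; [lra|]. intros z Hz _.
  rewrite H, Cmod_0, Rmult_0_r, Rabs_R0; auto.
Qed.

(** The properties shared by the identity and by differentiation that the hump argument uses; either
    can stand on either side of the inclusion. *)
Definition luc_operator (L : (C -> C) -> C -> C) : Prop :=
  (forall F G, analytic F -> analytic G -> forall z, inD z -> L (fun w => F w + G w)%C z = (L F z + L G z)%C) /\
  (forall z, inD z -> L (fun _ => 0) z = 0) /\
  (forall F G, (forall n, analytic (F n)) -> luc F G -> luc (fun n => L (F n)) (L G)).

Lemma luc_operator_id : luc_operator (fun f => f).
Proof. split; [|split]; auto. Qed.

Lemma luc_operator_cderiv : luc_operator cderiv.
Proof.
  split; [|split].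
  - intros F G HF HG. now apply analytic_plus.
  - apply analytic_const.
  - intros F G HF HG. now apply weierstrass.
Qed.

(* Gliding hump: the inclusion [incl] of weighted spaces is automatically continuous
   along sequences that tend to zero locally uniformly. *)
Lemma gliding_hump (w1 w2 : R -> R) (W : R) (L1 L2 : (C -> C) -> C -> C) (G : nat -> C -> C) :
  luc_operator L1 -> luc_operator L2 ->
  (forall r, 0 <= r < 1 -> 0 <= w1 r) -> (forall r, 0 <= r < 1 -> 0 <= w2 r <= W) ->
  (forall F, analytic F -> lim_bdry0 (fun z => wt w1 z * Cmod (L1 F z)) -> lim_bdry0 (fun z => wt w2 z * Cmod (L2 F z))) ->
  (forall n, analytic (G n)) ->
  (forall n, lim_bdry0 (fun z => wt w1 z * Cmod (L1 (G n) z))) ->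
  (forall eps, 0 < eps -> exists N, forall n, (N <= n)%nat -> forall z, inD z -> wt w1 z * Cmod (L1 (G n) z) <= eps) ->
  luc G (fun _ => 0) ->
  forall eps, 0 < eps -> exists N, forall n, (N <= n)%nat -> forall z, inD z -> wt w2 z * Cmod (L2 (G n) z) <= eps.
Proof.
  intros [A1 [Z1 U1]] [A2 [Z2 U2]] Hw1 Hw2 incl HG HlimG HG0 HGl eps Heps.
  apply NNPP. intros Hcontra.
  assert (Hbad : forall N, exists n, (N <= n)%nat /\ exists z, inD z /\ eps < wt w2 z * Cmod (L2 (G n) z)).
  { intros N. apply NNPP. intros HN. apply Hcontra. exists N. intros n Hn z Hz.
    apply Rnot_lt_le. intros Hlt. apply HN. exists n. split; auto. exists z. auto. }
  clear Hcontra.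
  assert (Hr01 : forall z, inD z -> 0 <= Cmod z < 1) by (intros z Hz; split; [apply Cmod_ge_0|exact Hz]).
  assert (Hq : forall k, 0 < (1 / 2) ^ k) by (intros; apply pow_lt; lra).
  assert (HW : 0 <= W) by (specialize (Hw2 0 ltac:(lra)); lra).
  (* The state is a partial sum and a radius beyond which its second weighted modulus is at most
     [eps / 4]. A step adds a term [D] of the sequence that is tiny up to this radius and exceeds
     [eps] somewhere beyond it. *)
  destruct (dependent_choice ((C -> C) * R)
    (fun k u => analytic (fst u) /\ lim_bdry0 (fun z => wt w1 z * Cmod (L1 (fst u) z)) /\
      0 <= snd u < 1 /\ 1 - (1 / 2) ^ k <= snd u /\
      forall z, inD z -> snd u < Cmod z -> wt w2 z * Cmod (L2 (fst u) z) <= eps / 4)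
    (fun k u v => snd u <= snd v /\ exists D, analytic D /\ fst v = (fun z => fst u z + D z)%C /\
      (forall z, inD z -> wt w1 z * Cmod (L1 D z) <= (1 / 2) ^ k) /\
      (forall z, Cmod z <= snd u -> Cmod (D z) <= (1 / 2) ^ k) /\
      (forall z, Cmod z <= snd u -> wt w2 z * Cmod (L2 D z) <= eps / 8 * (1 / 2) ^ k) /\
      exists z, inD z /\ snd u < Cmod z <= snd v /\ eps < wt w2 z * Cmod (L2 D z))
    ((fun _ : C => RtoC 0), 0)) as [u [_ Hu]].
  { simpl. split; [apply analytic_const|]. split; [apply lim_bdry0_zero; auto|].
    split; [lra|]. split; [lra|]. intros z Hz _. rewrite Z2, Cmod_0 by auto. lra. }
  { intros k [S0 R0] [HS [HlS [HR [HkR HS2]]]]. simpl in *.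
    destruct (HG0 _ (Hq k)) as [N1 HN1].
    destruct (HGl R0 (proj2 HR) _ (Hq k)) as [N2 HN2].
    destruct (U2 G (fun _ => 0) HG HGl R0 (proj2 HR) (eps / 8 * (1 / 2) ^ k / (1 + W))) as [N3 HN3].
    { apply Rdiv_lt_0_compat; [apply Rmult_lt_0_compat; [lra|apply Hq]|lra]. }
    destruct (Hbad (Nat.max N1 (Nat.max N2 N3))) as [n [Hn [z0 [Hz0 Hbz]]]].
    specialize (HN1 n ltac:(lia)). specialize (HN2 n ltac:(lia)). specialize (HN3 n ltac:(lia)).
    assert (HD2 : forall z, Cmod z <= R0 -> wt w2 z * Cmod (L2 (G n) z) <= eps / 8 * (1 / 2) ^ k).
    { intros z Hz. assert (HzD : inD z) by (unfold inD; lra). specialize (HN3 z Hz).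
      rewrite Z2 in HN3 by auto. replace (L2 (G n) z - 0)%C with (L2 (G n) z) in HN3 by ring.
      pose proof (Hw2 _ (Hr01 z HzD)) as Hwz.
      apply Rle_trans with ((1 + W) * (eps / 8 * (1 / 2) ^ k / (1 + W))); [|right; field; lra].
      apply Rmult_le_compat; [apply Hwz|apply Cmod_ge_0|unfold wt; lra|auto]. }
    destruct (analytic_plus S0 (G n) HS (HG n)) as [HS' _].
    assert (HlS' : lim_bdry0 (fun z => wt w1 z * Cmod (L1 (fun z => S0 z + G n z)%C z))).
    { apply (lim_bdry0_add w1 (L1 S0) (L1 (G n))); auto. }
    destruct (incl _ HS' HlS' (eps / 4) ltac:(lra)) as [r' [Hr' Hbd]].
    (* The new radius encloses the hump at [z0] and the region where the new sum is not yet small;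
       the term [1 - (1 / 2) ^ S k] drives the radii to [1]. *)
    exists ((fun z => S0 z + G n z)%C, Rmax (Rmax R0 (Cmod z0)) (Rmax (1 - (1 / 2) ^ S k) r')). simpl.
    pose proof (Rmax_l (Rmax R0 (Cmod z0)) (Rmax (1 - (1 / 2) ^ S k) r')).
    pose proof (Rmax_r (Rmax R0 (Cmod z0)) (Rmax (1 - (1 / 2) ^ S k) r')).
    pose proof (Rmax_l R0 (Cmod z0)). pose proof (Rmax_r R0 (Cmod z0)).
    pose proof (Rmax_l (1 - (1 / 2) ^ S k) r'). pose proof (Rmax_r (1 - (1 / 2) ^ S k) r').
    pose proof (Hq (S k)).
    assert (Rmax (Rmax R0 (Cmod z0)) (Rmax (1 - (1 / 2) ^ S k) r') < 1).
    { apply Rmax_lub_lt; apply Rmax_lub_lt; try lra. exact Hz0. }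
    cbn [pow] in *.
    split.
    - split; [auto|]. split; [auto|]. split; [lra|]. split; [lra|].
      intros z Hz Hzr. specialize (Hbd z Hz ltac:(lra)). left. eapply Rle_lt_trans; [apply Rle_abs|exact Hbd].
    - split; [lra|]. exists (G n). split; [auto|]. split; [reflexivity|]. split; [auto|].
      split; [|split; [auto|]].
      + intros z Hz. specialize (HN2 z Hz). now replace (G n z - 0)%C with (G n z) in HN2 by ring.
      + exists z0. split; [auto|]. split; [|auto]. split; [|lra].
        (* The hump lies beyond [R0], since up to [R0] the added term is at most [eps / 8]. *)
        apply Rnot_le_lt. intros Hle. specialize (HD2 z0 Hle).
        assert ((1 / 2) ^ k <= 1) by apply half_pow_le_1.
        assert (eps / 8 * (1 / 2) ^ k <= eps / 8 * 1) by (apply Rmult_le_compat_l; lra). lra. }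
  set (Sq k := fst (u k)). set (Rq k := snd (u k)).
  assert (HSa : forall k, analytic (Sq k)) by (intros k; apply Hu).
  assert (HRm : forall k d, Rq k <= Rq (k + d)%nat).
  { intros k d. induction d as [|d IH]; [rewrite Nat.add_0_r; lra|]. rewrite Nat.add_succ_r.
    eapply Rle_trans; [exact IH|]. apply (proj2 (Hu (k + d)%nat)). }
  assert (HR1 : forall k, 1 - (1 / 2) ^ k <= Rq k) by (intros k; apply (Hu k)).
  assert (HSD : forall k, exists D, analytic D /\ Sq (S k) = (fun z => Sq k z + D z)%C /\
      (forall z, inD z -> wt w1 z * Cmod (L1 D z) <= (1 / 2) ^ k) /\
      (forall z, Cmod z <= Rq k -> Cmod (D z) <= (1 / 2) ^ k) /\
      (forall z, Cmod z <= Rq k -> wt w2 z * Cmod (L2 D z) <= eps / 8 * (1 / 2) ^ k) /\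
      exists z, inD z /\ Rq k < Cmod z <= Rq (S k) /\ eps < wt w2 z * Cmod (L2 D z)).
  { intros k. apply (Hu k). }
  assert (Hcau : luc_cauchy Sq).
  { intros r Hr e He. destruct (half_pow_eventually r Hr) as [K HK].
    destruct (pow_eventually_small (1 / 2) 4 e) as [K2 HK2]; try lra.
    exists (Nat.max K K2). intros n m Hn Hm z Hz.
    assert (Hst : forall n m, (K <= n)%nat -> (n <= m)%nat -> 1 * Cmod (Sq m z - Sq n z) <= 2 * 1 * (1 / 2) ^ n).
    { apply telescope; [lra|]. intros k Hk. destruct (HSD k) as [D [_ [-> [_ [HD _]]]]].
      replace (Sq k z + D z - Sq k z)%C with (D z) by ring. rewrite !Rmult_1_l. apply HD.
      specialize (HK k Hk). specialize (HR1 k). lra. }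
    set (p := Nat.max K K2).
    pose proof (Hst p n ltac:(unfold p; lia) Hn). pose proof (Hst p m ltac:(unfold p; lia) Hm).
    specialize (HK2 p ltac:(unfold p; lia)).
    eapply Rle_trans; [apply (Cmod_dist_triang _ (Sq p z))|]. rewrite (Cmod_sym (Sq p z)). lra. }
  destruct (luc_complete Sq Hcau) as [F HF].
  destruct (weierstrass Sq F HSa HF) as [HFa _].
  pose proof (U1 Sq F HSa HF) as HF1. pose proof (U2 Sq F HSa HF) as HF2.
  (* The partial sums approximate [F] in the first weighted norm with error [2 (1 / 2)^n], so decay
     at the boundary passes to [F]. *)
  assert (HlF : lim_bdry0 (fun z => wt w1 z * Cmod (L1 F z))).
  { intros e He. destruct (pow_eventually_small (1 / 2) 2 (e / 2)) as [n Hn]; try lra.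
    specialize (Hn n (Nat.le_refl n)).
    destruct (proj1 (Hu n)) as [_ [HlS _]]. destruct (HlS (e / 2) ltac:(lra)) as [r [Hr Hrr]].
    exists r. split; auto. intros z Hz Hrz. specialize (Hrr z Hz Hrz). fold (Sq n) in Hrr.
    pose proof (Hw1 _ (Hr01 z Hz)) as Hwz. fold (wt w1 z) in Hwz.
    rewrite Rabs_pos_eq in * by (apply Rmult_le_pos; [auto|apply Cmod_ge_0]).
    assert (Hd : wt w1 z * Cmod (L1 F z - L1 (Sq n) z) <= 2 * 1 * (1 / 2) ^ n).
    { apply (luc_weighted_limit (fun k => L1 (Sq k)) (L1 F) z (L1 (Sq n) z) _ _ n); auto.
      intros m Hm. apply (telescope (wt w1 z) 1 (fun k => L1 (Sq k) z) 0); auto; [|lia].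
      intros k _. destruct (HSD k) as [D [HDa [-> [HD _]]]]. rewrite A1 by auto.
      replace (L1 (Sq k) z + L1 D z - L1 (Sq k) z)%C with (L1 D z) by ring. rewrite Rmult_1_l. auto. }
    pose proof (Cmod_triang_rev (L1 F z) (L1 (Sq n) z)) as T.
    apply (Rmult_le_compat_l (wt w1 z)) in T; auto. rewrite Rmult_minus_distr_l in T. lra. }
  (* At a hump [z] beyond [r] the sum [F], the earlier partial sum and the later tail each
     contribute at most [eps / 4], which contradicts a term exceeding [eps]. *)
  destruct (incl F HFa HlF (eps / 4) ltac:(lra)) as [r [Hr Hrr]].
  destruct (half_pow_eventually r Hr) as [k Hk]. specialize (Hk k (Nat.le_refl k)).
  destruct (HSD k) as [D [HDa [ES [_ [_ [_ [z [Hz [Hzk Hbz]]]]]]]]].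
  pose proof (HR1 k). specialize (Hrr z Hz ltac:(lra)).
  pose proof (proj1 (Hw2 _ (Hr01 z Hz))) as Hwz. fold (wt w2 z) in Hwz.
  rewrite Rabs_pos_eq in Hrr by (apply Rmult_le_pos; [auto|apply Cmod_ge_0]).
  (* The hump lies within [Rq (S k)], and all later terms are small up to that radius. *)
  assert (Hd : wt w2 z * Cmod (L2 F z - L2 (Sq (S k)) z) <= 2 * (eps / 8) * (1 / 2) ^ S k).
  { apply (luc_weighted_limit (fun k => L2 (Sq k)) (L2 F) z (L2 (Sq (S k)) z) _ _ (S k)); auto.
    intros m Hm. apply (telescope (wt w2 z) (eps / 8) (fun k => L2 (Sq k) z) (S k)); auto.
    intros j Hj. destruct (HSD j) as [D' [HDa' [-> [_ [_ [HD' _]]]]]]. rewrite A2 by auto.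
    replace (L2 (Sq j) z + L2 D' z - L2 (Sq j) z)%C with (L2 D' z) by ring. apply HD'.
    pose proof (HRm (S k) (j - S k)%nat) as Hm2. replace (S k + (j - S k))%nat with j in Hm2 by lia. lra. }
  assert (HSk : wt w2 z * Cmod (L2 (Sq k) z) <= eps / 4).
  { destruct (proj1 (Hu k)) as [_ [_ [_ [_ H2]]]]. apply H2; auto. apply Hzk. }
  assert (Hq1 : (1 / 2) ^ S k <= 1) by apply half_pow_le_1.
  assert (2 * (eps / 8) * (1 / 2) ^ S k <= 2 * (eps / 8) * 1) by (apply Rmult_le_compat_l; lra).
  rewrite ES, A2 in Hd by auto.
  replace (L2 D z) with (L2 F z - L2 (Sq k) z - (L2 F z - (L2 (Sq k) z + L2 D z)))%C in Hbz by ring.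
  pose proof (Cmod_triang_sub (L2 F z - L2 (Sq k) z) (L2 F z - (L2 (Sq k) z + L2 D z))) as T1.
  pose proof (Cmod_triang_sub (L2 F z) (L2 (Sq k) z)) as T2.
  apply (Rmult_le_compat_l (wt w2 z)) in T1; auto. apply (Rmult_le_compat_l (wt w2 z)) in T2; auto.
  rewrite Rmult_plus_distr_l in T1, T2. lra.
Qed.

(** * Quasi-normal weights *)

Lemma inD_bounds z : inD z -> 0 <= Cmod z < 1.
Proof. intros Hz. split; [apply Cmod_ge_0|exact Hz]. Qed.

Lemma weight_pos nu z : weight nu -> inD z -> 0 < wt nu z.
Proof. intros [H _] Hz. apply H. now apply inD_bounds. Qed.

Lemma weight_le nu r s : weight nu -> 0 <= r -> r <= s -> s < 1 -> nu s <= nu r.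
Proof. intros [_ [_ H]]. apply H. Qed.

Lemma weight_le_0 nu z : weight nu -> inD z -> wt nu z <= nu 0.
Proof. intros H Hz. apply inD_bounds in Hz. apply weight_le; auto; lra. Qed.

Lemma w1_pos mu r : weight mu -> 0 <= r < 1 -> 0 < w1 mu r.
Proof. intros [H _] Hr. unfold w1. apply Rmult_lt_0_compat; [auto|nra]. Qed.

Lemma w1_le mu r s : weight mu -> 0 <= r -> r <= s -> s < 1 -> w1 mu s <= w1 mu r.
Proof.
  intros H Hr Hs Hs1. unfold w1. assert (0 < mu s) by (apply H; lra).
  apply Rmult_le_compat; [lra|nra|apply weight_le; auto|nra].
Qed.

(* the constant function 1 lies in the little Bloch-type space *)
Lemma quasi_normal_typical mu : weight mu -> quasi_normal mu ->
  forall eps, 0 < eps -> exists r, r < 1 /\ forall z, inD z -> r < Cmod z -> wt mu z < eps.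
Proof.
  intros Hmu Hqn eps Heps.
  destruct (proj2 (Hqn (fun _ => 1))) as [_ H].
  - split; [apply analytic_const|]. apply lim_bdry0_zero. intros z Hz. now apply analytic_const.
  - destruct (H eps Heps) as [r [Hr K]]. exists r. split; auto. intros z Hz Hrz. specialize (K z Hz Hrz).
    rewrite Cmod_1, Rmult_1_r in K. eapply Rle_lt_trans; [apply Rle_abs|exact K].
Qed.

Lemma analytic_le_derivative G r K z : analytic G -> G 0 = 0 -> Cmod z <= r -> r < 1 ->
  (forall w, Cmod w <= r -> Cmod (cderiv G w) <= K) -> Cmod (G z) <= K * r.
Proof.
  intros HG H0 Hz Hr HK. pose proof (Cmod_ge_0 z).
  pose proof (mean_value_inequality G (cderiv G) 0 z K) as H1.
  rewrite H0 in H1. replace (G z - 0)%C with (G z) in H1 by ring. replace (z - 0)%C with z in H1 by ring.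
  assert (0 <= K) by (eapply Rle_trans; [apply Cmod_ge_0|apply (HK 0); rewrite Cmod_0; lra]).
  apply Rle_trans with (K * Cmod z); [|now apply Rmult_le_compat_l].
  apply H1. intros t Ht.
  assert (Hin : Cmod (0 + z * t)%C <= r).
  { replace (0 + z * t)%C with (z * t)%C by ring. rewrite Cmod_mult, Cmod_R, Rabs_pos_eq by lra. nra. }
  split; [apply cderiv_cdl; auto; unfold inD; lra|auto].
Qed.

Lemma luc_zero_of_deriv G : (forall n, analytic (G n)) -> (forall n, G n 0 = 0) ->
  luc (fun n => cderiv (G n)) (fun _ => 0) -> luc G (fun _ => 0).
Proof.
  intros HG H0 H r Hr eps Heps. destruct (H r Hr eps Heps) as [N HN]. exists N. intros n Hn z Hz.
  replace (G n z - 0)%C with (G n z) by ring. pose proof (Cmod_ge_0 z).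
  apply Rle_trans with (eps * r); [|nra].
  apply analytic_le_derivative; auto. intros w Hw. specialize (HN n Hn w Hw).
  now replace (cderiv (G n) w - 0)%C with (cderiv (G n) w) in HN by ring.
Qed.

(** On [|z| <= r] a decreasing positive weight is at least [w r], so weighted smallness is locally
    uniform smallness. *)
Lemma luc_zero_of_weighted (w : R -> R) (X : nat -> C -> C) :
  (forall r, 0 <= r < 1 -> 0 < w r) -> (forall r s, 0 <= r -> r <= s -> s < 1 -> w s <= w r) ->
  (forall eps, 0 < eps -> exists N, forall n, (N <= n)%nat -> forall z, inD z -> wt w z * Cmod (X n z) <= eps) ->
  luc X (fun _ => 0).
Proof.
  intros Hp Hm H r Hr eps Heps. destruct (Rlt_le_dec r 0) as [Hn|Hr0].
  { exists 0%nat. intros n _ z Hz. pose proof (Cmod_ge_0 z). lra. }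
  specialize (Hp r ltac:(lra)).
  destruct (H (w r * eps)) as [N HN]; [now apply Rmult_lt_0_compat|].
  exists N. intros n Hn z Hz. replace (X n z - 0)%C with (X n z) by ring.
  pose proof (Cmod_ge_0 z).
  apply Rmult_le_reg_l with (w r); auto. eapply Rle_trans; [|apply (HN n Hn z); unfold inD; lra].
  apply Rmult_le_compat_r; [apply Cmod_ge_0|]. apply Hm; lra.
Qed.

(** The hump argument for the inclusion of [B0 (w1 mu)] in [H0 mu]. The condition [G n 0 = 0] turns
    smallness of the derivatives into the locally uniform convergence that it requires. *)
Lemma quasi_normal_integrate mu G : weight mu -> quasi_normal mu ->
  (forall n, B0 (w1 mu) (G n)) -> (forall n, G n 0 = 0) ->
  (forall eps, 0 < eps -> exists N, forall n, (N <= n)%nat -> forall z, inD z -> wt (w1 mu) z * Cmod (cderiv (G n) z) <= eps) ->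
  forall eps, 0 < eps -> exists N, forall n, (N <= n)%nat -> forall z, inD z -> wt mu z * Cmod (G n z) <= eps.
Proof.
  intros Hmu Hqn HG H0 H.
  apply (gliding_hump (w1 mu) mu (mu 0) cderiv (fun f => f)); auto.
  - apply luc_operator_cderiv.
  - apply luc_operator_id.
  - intros r Hr. left. now apply w1_pos.
  - intros r Hr. split; [left; now apply Hmu|apply weight_le; auto; lra].
  - intros F HF HlF. apply Hqn. split; auto.
  - intros n. apply HG.
  - intros n. apply HG.
  - apply luc_zero_of_deriv; auto; [intros n; apply HG|].
    apply (luc_zero_of_weighted (w1 mu)); auto.
    + intros r Hr. now apply w1_pos.
    + intros r s ? ? ?. now apply w1_le.
Qed.

(* A function of finite weighted norm need not lie in [H0 mu]; its dilations do. *)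
Lemma dilation_witness mu G eps : weight mu -> quasi_normal mu -> analytic G -> 0 < eps ->
  exists G', analytic G' /\ lim_bdry0 (fun z => wt mu z * Cmod (G' z)) /\
    (forall c, (forall z, inD z -> wt mu z * Cmod (G z) <= c) -> forall z, inD z -> wt mu z * Cmod (G' z) <= c) /\
    ((exists z, inD z /\ eps < wt (w1 mu) z * Cmod (cderiv G z)) ->
      exists z, inD z /\ eps < wt (w1 mu) z * Cmod (cderiv G' z)).
Proof.
  intros Hmu Hqn HG Heps.
  destruct (classic (exists z, inD z /\ eps < wt (w1 mu) z * Cmod (cderiv G z))) as [[z [Hz Hbz]]|Hn].
  (* There is no large value of the derivative to preserve, so the zero function serves. *)
  2:{ exists (fun _ => 0). split; [apply analytic_const|]. split; [now apply lim_bdry0_zero|].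
      split; [|intros Hy; contradiction].
      intros c Hc w Hw. rewrite Cmod_0, Rmult_0_r. eapply Rle_trans; [|apply (Hc w Hw)].
      apply Rmult_le_pos; [left; now apply weight_pos|apply Cmod_ge_0]. }
  set (A := wt (w1 mu) z) in *. set (B := Cmod (cderiv G z)) in *.
  assert (HA : 0 < A) by (apply w1_pos; auto; now apply inD_bounds).
  assert (HB : 0 <= B) by apply Cmod_ge_0.
  (* A loss of [eta (1 + B)] in the derivative costs at most half of the excess of [A B] over
     [eps]. *)
  set (eta := Rmin (1 / 2) ((A * B - eps) / (2 * A * (1 + B)))).
  assert (HAB : 0 < 2 * A * (1 + B)) by (apply Rmult_lt_0_compat; lra).
  assert (Heta : 0 < eta) by (apply Rmin_pos; [lra|apply Rdiv_lt_0_compat; lra]).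
  assert (Heta1 : eta <= 1 / 2) by apply Rmin_l.
  assert (Heta2 : eta * (2 * A * (1 + B)) <= A * B - eps).
  { apply Rle_trans with ((A * B - eps) / (2 * A * (1 + B)) * (2 * A * (1 + B))).
    - apply Rmult_le_compat_r; [lra|apply Rmin_r].
    - right. field. split; lra. }
  destruct (analytic_ccont (cderiv G) z (cderiv_analytic G HG) Hz eta Heta) as [d [Hd1 Hd]].
  (* Both [r z] must be within [d] of [z] and the chain rule factor [r] must be at least
     [1 - eta]. *)
  set (r := 1 - Rmin eta (d / 2)).
  assert (Hm : 0 < Rmin eta (d / 2)) by (apply Rmin_pos; lra).
  pose proof (Rmin_l eta (d / 2)). pose proof (Rmin_r eta (d / 2)).
  assert (Hr : 1 / 2 <= r < 1) by (unfold r; lra).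
  pose proof (Cmod_ge_0 z) as Hz0. assert (Hz1 : Cmod z < 1) by exact Hz.
  destruct (analytic_rescale G 0 r HG ltac:(lra) ltac:(rewrite Cmod_0; lra)) as [Ha Hdd].
  exists (fun w => G (0 + r * w)%C).
  assert (Hmod : forall w, Cmod (0 + r * w)%C = r * Cmod w).
  { intros w. replace (0 + r * w)%C with (r * w)%C by ring. rewrite Cmod_mult, Cmod_R, Rabs_pos_eq; lra. }
  split; [auto|]. split; [|split].
  (* The dilation is bounded on the whole disk, and [mu] tends to zero at the boundary. *)
  - intros e He. destruct (analytic_bounded G r HG ltac:(lra)) as [M [HM0 HM]].
    destruct (quasi_normal_typical mu Hmu Hqn (e / M)) as [s [Hs Hss]]; [now apply Rdiv_lt_0_compat|].
    exists s. split; auto. intros w Hw Hsw. specialize (Hss w Hw Hsw).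
    pose proof (weight_pos mu w Hmu Hw). pose proof (Cmod_ge_0 w). assert (Cmod w < 1) by exact Hw.
    rewrite Rabs_pos_eq by (apply Rmult_le_pos; [lra|apply Cmod_ge_0]).
    apply Rle_lt_trans with (wt mu w * M).
    + apply Rmult_le_compat_l; [lra|]. apply HM. rewrite Hmod. nra.
    + apply Rlt_le_trans with (e / M * M); [now apply Rmult_lt_compat_r|right; field; lra].
  - intros c Hc w Hw. pose proof (Cmod_ge_0 w). assert (Cmod w < 1) by exact Hw.
    eapply Rle_trans; [|apply (Hc (0 + r * w)%C)].
    + apply Rmult_le_compat_r; [apply Cmod_ge_0|]. unfold wt. rewrite Hmod. apply weight_le; auto; nra.
    + unfold inD. rewrite Hmod. nra.
  - intros _. exists z. split; auto. fold A. rewrite Hdd by auto. rewrite Cmod_mult, Cmod_R, Rabs_pos_eq by lra.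
    assert (Hclose : Cmod (cderiv G (0 + r * z) - cderiv G z) < eta).
    { apply Hd. replace (0 + r * z - z)%C with (RtoC (r - 1) * z)%C by (rewrite RtoC_minus; ring).
      rewrite Cmod_mult, Cmod_R, Rabs_left by lra.
      apply Rle_lt_trans with ((1 - r) * 1); [|unfold r; lra].
      replace (- (r - 1)) with (1 - r) by ring. apply Rmult_le_compat_l; lra. }
    pose proof (Cmod_triang_rev (cderiv G z) (cderiv G (0 + r * z))) as T.
    rewrite Cmod_sym in T. fold B in T.
    set (B' := Cmod (cderiv G (0 + r * z))) in *.
    assert (HB' : 0 <= B') by apply Cmod_ge_0.
    assert (H1 : B - eta * (1 + B) <= B' * r).
    { assert (1 - eta <= r) by (unfold r; lra).
      destruct (Rle_lt_dec B eta); [nra|].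
      apply Rle_trans with ((B - eta) * (1 - eta)); [nra|]. apply Rmult_le_compat; lra. }
    apply (Rmult_le_compat_l A) in H1; [|lra].
    assert (0 < A * (eta * (1 + B))) by (apply Rmult_lt_0_compat; [exact HA|apply Rmult_lt_0_compat; lra]). lra.
Qed.

(** The [G n] need not decay at the boundary. For the given [eps] the hump argument is applied to
    witnesses in [H0 mu] whose norms are no larger and which exceed [eps] somewhere whenever [G n]
    does. *)
Lemma quasi_normal_differentiate mu G : weight mu -> quasi_normal mu -> (forall n, analytic (G n)) ->
  (forall eps, 0 < eps -> exists N, forall n, (N <= n)%nat -> forall z, inD z -> wt mu z * Cmod (G n z) <= eps) ->
  forall eps, 0 < eps -> exists N, forall n, (N <= n)%nat -> forall z, inD z -> wt (w1 mu) z * Cmod (cderiv (G n) z) <= eps.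
Proof.
  intros Hmu Hqn HG H eps Heps.
  pose proof (fun n => dilation_witness mu (G n) eps Hmu Hqn (HG n) Heps) as HD.
  apply choice in HD. destruct HD as [D HD].
  assert (HD0 : forall e, 0 < e -> exists N, forall n, (N <= n)%nat -> forall z, inD z -> wt mu z * Cmod (D n z) <= e).
  { intros e He. destruct (H e He) as [N HN]. exists N. intros n Hn. destruct (HD n) as [_ [_ [K _]]]. apply K. auto. }
  destruct (gliding_hump mu (w1 mu) (mu 0) (fun f => f) cderiv D) with (eps := eps) as [N HN]; auto.
  - apply luc_operator_id.
  - apply luc_operator_cderiv.
  - intros r Hr. left. now apply Hmu.
  - intros r Hr. split; [left; now apply w1_pos|].
    apply Rle_trans with (w1 mu 0); [apply w1_le; auto; lra|]. unfold w1. right. ring.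
  - intros F HF HlF. apply Hqn. split; auto.
  - intros n. apply HD.
  - intros n. apply HD.
  - apply (luc_zero_of_weighted mu); auto; [apply Hmu|]. intros r s ? ? ?. now apply weight_le.
  - exists N. intros n Hn z Hz. apply Rnot_lt_le. intros Hlt.
    destruct (HD n) as [_ [_ [_ K]]]. destruct K as [z' [Hz' Hb]]; [now exists z|].
    specialize (HN n Hn z' Hz'). lra.
Qed.

(** * Property (U) *)

Lemma Rpower_decr x a b : 0 < x <= 1 -> a <= b -> Rpower x b <= Rpower x a.
Proof.
  intros Hx Hab. unfold Rpower.
  assert (Hl : ln x <= 0).
  { rewrite <- ln_1. destruct (Req_dec x 1) as [->|Hn]; [lra|]. left. apply ln_increasing; lra. }
  destruct (Req_dec (b * ln x) (a * ln x)) as [->|Hn]; [lra|]. left. apply exp_increasing. nra.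
Qed.

Lemma Rpower_incr x y a : 0 < x <= y -> 0 <= a -> Rpower x a <= Rpower y a.
Proof. intros Hx Ha. apply Rle_Rpower_l; lra. Qed.

Lemma pow_le_Rpower x a n : 0 < x <= 1 -> a <= INR n -> x ^ n <= Rpower x a.
Proof. intros Hx Ha. rewrite <- Rpower_pow by lra. now apply Rpower_decr. Qed.

Lemma Rpower_pos x a : 0 < Rpower x a.
Proof. apply exp_pos. Qed.

Lemma propU_cross nu alpha K r s : weight nu -> 0 <= r -> r <= s -> s < 1 ->
  nu r / Rpower (1 - r ^ 2) alpha <= K * (nu s / Rpower (1 - s ^ 2) alpha) ->
  nu r * Rpower (1 - s ^ 2) alpha <= K * nu s * Rpower (1 - r ^ 2) alpha.
Proof.
  intros Hnu Hr Hrs Hs H.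
  set (P := Rpower (1 - r ^ 2) alpha) in *. set (Q := Rpower (1 - s ^ 2) alpha) in *.
  assert (HP : 0 < P) by apply Rpower_pos. assert (HQ : 0 < Q) by apply Rpower_pos.
  apply (Rmult_le_compat_r (P * Q)) in H; [|nra].
  replace (nu r / P * (P * Q)) with (nu r * Q) in H by (field; lra).
  replace (K * (nu s / Q) * (P * Q)) with (K * nu s * P) in H by (field; lra). exact H.
Qed.

(** Cauchy's estimate on the circle of radius [(1 - |z|) / 2] about [z]. Property (U) compares [nu]
    at [t = |z|] and at [s = (1 + t) / 2], where [1 - t^2 <= 4 (1 - s^2)]; this is the source of
    [Rpower 4 alpha]. *)
Lemma weighted_derivative_bound nu : weight nu -> propU nu -> exists C0, 0 < C0 /\
  forall f M, analytic f -> (forall z, inD z -> wt nu z * Cmod (f z) <= M) ->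
  forall z, inD z -> wt nu z * ((1 - Cmod z ^ 2) * Cmod (cderiv f z)) <= C0 * M.
Proof.
  intros Hnu [alpha [Ha [K [HK HU]]]].
  assert (H4 : 0 < Rpower 4 alpha) by apply Rpower_pos.
  exists (4 * (K * Rpower 4 alpha)). split; [apply Rmult_lt_0_compat; [lra|now apply Rmult_lt_0_compat]|].
  intros f M Hf HM z Hz. pose proof (inD_bounds z Hz) as Hzb.
  unfold wt. set (t := Cmod z) in *.
  set (rho := (1 - t) / 2). set (s := (1 + t) / 2).
  assert (Hs : t <= s < 1) by (unfold s; lra). assert (Hrho : 0 < rho) by (unfold rho; lra).
  assert (Hnus : 0 < nu s) by (apply Hnu; lra). assert (Hnut : 0 < nu t) by (apply Hnu; lra).
  assert (HM0 : 0 <= M).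
  { eapply Rle_trans; [|apply (HM z Hz)]. apply Rmult_le_pos; [left; now apply weight_pos|apply Cmod_ge_0]. }
  assert (Hce : Cmod (cderiv f z) * rho <= M / nu s).
  { apply cauchy_estimate; auto; [fold t; unfold rho; lra|]. intros w Hw.
    assert (Hws : Cmod w <= s).
    { replace w with (z + (w - z))%C by ring. eapply Rle_trans; [apply Cmod_triangle|].
      rewrite Hw. fold t. unfold rho, s. lra. }
    assert (HwD : inD w) by (unfold inD; lra).
    apply Rmult_le_reg_r with (nu s); auto. unfold Rdiv. rewrite Rmult_assoc, Rinv_l, Rmult_1_r by lra.
    rewrite Rmult_comm. eapply Rle_trans; [|apply (HM w HwD)].
    apply Rmult_le_compat_r; [apply Cmod_ge_0|]. apply weight_le; auto; [apply Cmod_ge_0|lra]. }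
  assert (Hratio : nu t <= K * Rpower 4 alpha * nu s).
  { pose proof (propU_cross nu alpha K t s Hnu (proj1 Hzb) (proj1 Hs) (proj2 Hs) (HU t s (proj1 Hzb) (proj1 Hs) (proj2 Hs))) as H.
    set (Q := Rpower (1 - s ^ 2) alpha) in *. assert (HQ : 0 < Q) by apply Rpower_pos.
    assert (HP : Rpower (1 - t ^ 2) alpha <= Rpower 4 alpha * Q).
    { unfold Q. rewrite Rpower_mult_distr; [|lra|nra]. apply Rpower_incr; [|lra]. split; [nra|]. unfold s. nra. }
    apply Rmult_le_reg_r with Q; auto. eapply Rle_trans; [exact H|].
    replace (K * Rpower 4 alpha * nu s * Q) with (K * nu s * (Rpower 4 alpha * Q)) by ring.
    apply Rmult_le_compat_l; [|exact HP]. left. now apply Rmult_lt_0_compat. }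
  pose proof (Cmod_ge_0 (cderiv f z)) as HD. set (D := Cmod (cderiv f z)) in *.
  assert (H1 : (1 - t ^ 2) * D <= 4 * (M / nu s)).
  { replace ((1 - t ^ 2) * D) with (2 * (1 + t) * (D * rho)) by (unfold rho; field).
    apply Rmult_le_compat; [lra|apply Rmult_le_pos; lra|lra|exact Hce]. }
  assert (HMs : 0 <= M / nu s) by now apply Rle_mult_inv_pos.
  apply Rle_trans with (nu t * (4 * (M / nu s))); [apply Rmult_le_compat_l; lra|].
  apply Rle_trans with (K * Rpower 4 alpha * nu s * (4 * (M / nu s))); [apply Rmult_le_compat_r; lra|].
  right. field. lra.
Qed.

(** * Test functions for weights with property (U) *)

Lemma Cmod_one_minus_ge a z : Cmod a < 1 -> Cmod z < 1 ->
  1 - Cmod a <= Cmod (1 + - Cconj a * z)%C /\ 1 - Cmod z <= Cmod (1 + - Cconj a * z)%C.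
Proof.
  intros Ha Hz. pose proof (Cmod_triang_rev 1 (Cconj a * z)) as H.
  rewrite Cmod_1, Cmod_mult, Cmod_conj in H.
  replace (1 + - Cconj a * z)%C with (1 - Cconj a * z)%C by ring.
  pose proof (Cmod_ge_0 a). pose proof (Cmod_ge_0 z). nra.
Qed.

(* The test function at [a] is a multiple of
   [(1 / nu a) ((1 - |a|^2) / (1 - conj a z)) ^ N] with [N >= alpha + 1], [alpha] from (U). *)
Lemma test_functions nu : weight nu -> propU nu -> exists c E N, 0 < c /\ 0 < E /\
  forall a, inD a -> exists f, analytic f /\ (exists B, 0 < B /\ forall z, inD z -> Cmod (f z) <= B) /\
    (forall z, inD z -> wt nu z * Cmod (f z) <= 1) /\
    c * Cmod a <= wt nu a * ((1 - Cmod a ^ 2) * Cmod (cderiv f a)) /\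
    (forall z, inD z -> Cmod (f z) <= E * (1 - Cmod a) / (1 - Cmod z) ^ N).
Proof.
  intros Hnu [alpha [Halpha [K [HK HU]]]].
  destruct (INR_unbounded alpha) as [n Hn]. set (N := S n).
  assert (H2N : 0 < 2 ^ N) by (apply pow_lt; lra).
  (* The two cases below bound the weighted modulus before normalisation by [K 2^N] and by [2^N];
     their sum covers both. *)
  set (C0 := (K + 1) * 2 ^ N). assert (HC0 : 0 < C0) by (apply Rmult_lt_0_compat; lra).
  assert (Hnu0 : 0 < nu 0) by (apply Hnu; lra).
  exists (INR N / C0), (2 * K / (nu 0 * C0)), N.
  split; [apply Rdiv_lt_0_compat; [apply lt_0_INR; unfold N; lia|auto]|].
  split; [apply Rdiv_lt_0_compat; [lra|now apply Rmult_lt_0_compat]|].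
  intros a Ha. pose proof (inD_bounds a Ha) as Hab. unfold wt. set (s := Cmod a) in *.
  assert (Hnua : 0 < nu s) by now apply Hnu.
  assert (HA : 0 < 1 - s ^ 2 <= 1) by nra.
  set (A := 1 - s ^ 2) in *.
  assert (HAN : 0 < A ^ N) by (apply pow_lt; lra).
  set (k := A ^ N / (C0 * nu s)).
  assert (HCn : 0 < C0 * nu s) by now apply Rmult_lt_0_compat.
  assert (Hk : 0 < k) by now apply Rdiv_lt_0_compat.
  set (d := fun z : C => (1 + - Cconj a * z)%C).
  assert (Hd : forall z, inD z -> 1 - s <= Cmod (d z) /\ 1 - Cmod z <= Cmod (d z)) by (intros z Hz; now apply Cmod_one_minus_ge).
  assert (Hd0 : forall z, inD z -> d z <> 0).
  { intros z Hz. apply Cmod_pos_nz. specialize (Hd z Hz). lra. }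
  set (f := fun z : C => (RtoC k * (/ d z) ^ N)%C).
  assert (Hfmod : forall z, inD z -> Cmod (f z) = k * (/ Cmod (d z)) ^ N).
  { intros z Hz. unfold f. rewrite Cmod_mult, Cmod_R, Rabs_pos_eq, Cmod_pow, Cmod_inv by (auto; lra). reflexivity. }
  assert (Hfd : forall z, inD z -> cdl f z (RtoC k * (INR N * (/ d z) ^ n * (- / (d z * d z) * - Cconj a)))%C).
  { intros z Hz. unfold f. apply cdl_scal. replace n with (N - 1)%nat by (unfold N; lia).
    apply (cdl_comp (fun w => w ^ N)%C); [apply cdl_pow|].
    apply (cdl_comp Cinv); [apply cdl_inv; auto|apply cdl_affine]. }
  destruct (analytic_intro _ _ Hfd) as [Hfa Hfder].
  assert (Hinv : forall z u, inD z -> 0 < u <= Cmod (d z) -> 0 <= / Cmod (d z) <= / u).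
  { intros z u Hz Hu. split; [left; apply Rinv_0_lt_compat; lra|apply Rinv_le_contravar; lra]. }
  exists f. split; [auto|]. split; [|split; [|split]].
  - exists (k * (/ (1 - s)) ^ N). split; [apply Rmult_lt_0_compat; [auto|apply pow_lt, Rinv_0_lt_compat; lra]|].
    intros z Hz. rewrite Hfmod by auto. apply Rmult_le_compat_l; [lra|].
    apply pow_incr. apply Hinv; auto. specialize (Hd z Hz). lra.
  - intros z Hz. rewrite Hfmod by auto. pose proof (inD_bounds z Hz) as Hzb. unfold wt. set (t := Cmod z) in *.
    assert (Hnut : 0 < nu t) by now apply Hnu.
    set (q := A * / Cmod (d z)).
    assert (Hmain : nu t * q ^ N <= C0 * nu s).
    { specialize (Hd z Hz). fold t in Hd.
      assert (Hq0 : 0 <= q) by (apply Rmult_le_pos; [lra|apply (Hinv z (1 - s)); auto; lra]).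
      (* For [|z| <= |a|] the quotient [q' = (1 - |a|^2) / (1 - |z|^2)] is at most [1], so
         [q'^N <= q'^alpha], and (U) pays for the growth of [nu t] over [nu s]. For [|z| > |a|] the
         monotonicity of [nu] and [q <= 2] suffice. *)
      destruct (Rle_lt_dec t s) as [Hts|Hts].
      - set (T := 1 - t ^ 2). assert (HT : 0 < T) by (unfold T; nra).
        set (q' := A / T).
        assert (Hq' : 0 < q' <= 1).
        { split; [apply Rdiv_lt_0_compat; lra|]. apply Rmult_le_reg_r with T; auto.
          unfold q', Rdiv. rewrite Rmult_assoc, Rinv_l by lra. unfold A, T. nra. }
        assert (Hqq : q <= 2 * q').
        { unfold q, q', Rdiv. replace (2 * (A * / T)) with (A * / (T / 2)) by (field; lra).
          apply Rmult_le_compat_l; [lra|]. apply (Hinv z (T / 2)); auto. split; [lra|].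
          assert (T <= 2 * (1 - t)) by (unfold T; nra). lra. }
        assert (HqN : q ^ N <= 2 ^ N * Rpower q' alpha).
        { apply Rle_trans with ((2 * q') ^ N); [apply pow_incr; lra|]. rewrite Rpow_mult_distr.
          apply Rmult_le_compat_l; [lra|]. apply pow_le_Rpower; auto. unfold N. rewrite S_INR. lra. }
        pose proof (propU_cross nu alpha K t s Hnu (proj1 Hzb) Hts (proj2 Hab) (HU t s (proj1 Hzb) Hts (proj2 Hab))) as H.
        fold A T in H.
        assert (HPq : Rpower A alpha = Rpower q' alpha * Rpower T alpha).
        { rewrite Rpower_mult_distr by lra. f_equal. unfold q'. field. lra. }
        pose proof (Rpower_pos T alpha) as HPT. rewrite HPq, <- Rmult_assoc in H.
        apply Rmult_le_reg_r in H; auto.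
        apply Rle_trans with (2 ^ N * (nu t * Rpower q' alpha)).
        + replace (2 ^ N * (nu t * Rpower q' alpha)) with (nu t * (2 ^ N * Rpower q' alpha)) by ring.
          apply Rmult_le_compat_l; lra.
        + apply Rle_trans with (2 ^ N * (K * nu s)); [apply Rmult_le_compat_l; lra|]. unfold C0.
          replace ((K + 1) * 2 ^ N * nu s) with (2 ^ N * (K * nu s) + 2 ^ N * nu s) by ring.
          assert (0 < 2 ^ N * nu s) by now apply Rmult_lt_0_compat. lra.
      - assert (Hq2 : q <= 2).
        { unfold q. apply Rle_trans with (A * / (1 - s)).
          - apply Rmult_le_compat_l; [lra|]. apply (Hinv z (1 - s)); auto; lra.
          - unfold A. replace ((1 - s ^ 2) * / (1 - s)) with (1 + s) by (field; lra). lra. }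
        assert (q ^ N <= 2 ^ N) by (apply pow_incr; lra).
        assert (nu t <= nu s) by (apply weight_le; auto; lra).
        apply Rle_trans with (nu s * 2 ^ N); [apply Rmult_le_compat; try lra; now apply pow_le|].
        unfold C0. assert (0 < K * (2 ^ N * nu s)) by (apply Rmult_lt_0_compat; [lra|apply Rmult_lt_0_compat; lra]). lra. }
    unfold q in Hmain. rewrite Rpow_mult_distr in Hmain. unfold k.
    apply Rmult_le_reg_r with (C0 * nu s); auto.
    replace (nu t * (A ^ N / (C0 * nu s) * (/ Cmod (d z)) ^ N) * (C0 * nu s))
      with (nu t * (A ^ N * (/ Cmod (d z)) ^ N)) by (field; lra).
    lra.
  - rewrite Hfder by auto.
    (* At [z = a] the denominator is [A] itself, the powers of [A] cancel up to one, and the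
       derivative has modulus [N |a| / (C0 nu(a) A)]. *)
    assert (Eda : d a = RtoC A).
    { unfold d, A, s. rewrite RtoC_minus, Cmod2_conj. ring. }
    rewrite Eda. rewrite !Cmod_mult, !Cmod_opp, Cmod_inv, Cmod_pow, Cmod_inv, Cmod_mult, Cmod_conj, !Cmod_R, (Rabs_pos_eq k), (Rabs_pos_eq A), Rabs_pos_eq; try lra.
    + fold s. unfold k, N. cbn [pow]. rewrite pow_inv.
      right. field. repeat split; try lra. apply pow_nonzero. lra.
    + apply pos_INR.
    + intros H0. apply (f_equal fst) in H0. simpl in H0. lra.
    + intros H0. apply Cmod_eq_0 in H0 || idtac. apply (f_equal fst) in H0. simpl in H0. nra.
  - intros z Hz. rewrite Hfmod by auto. pose proof (inD_bounds z Hz) as Hzb. specialize (Hd z Hz).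
    set (t := Cmod z) in *. assert (Htp : 0 < (1 - t) ^ N) by (apply pow_lt; lra).
    (* Property (U) between [0] and [|a|] gives [nu 0 A^alpha <= K nu(a)]. Since [N = n + 1] with
       [n > alpha], one factor [A <= 2 (1 - |a|)] is left over, and it yields the locally uniform
       decay. *)
    assert (Hk2 : k <= 2 * K / (nu 0 * C0) * (1 - s)).
    { pose proof (propU_cross nu alpha K 0 s Hnu ltac:(lra) (proj1 Hab) (proj2 Hab) (HU 0 s ltac:(lra) (proj1 Hab) (proj2 Hab))) as H.
      fold A in H. replace (1 - 0 ^ 2) with 1 in H by ring.
      unfold Rpower in H at 2. rewrite ln_1, Rmult_0_r, exp_0, Rmult_1_r in H.
      assert (HAn : A ^ n <= Rpower A alpha) by (apply pow_le_Rpower; lra).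
      assert (HA2 : A <= 2 * (1 - s)) by (unfold A; nra).
      assert (0 < A ^ n) by (apply pow_lt; lra).
      unfold k. apply Rmult_le_reg_r with (C0 * nu s * nu 0); [now apply Rmult_lt_0_compat|].
      replace (A ^ N / (C0 * nu s) * (C0 * nu s * nu 0)) with (A * (nu 0 * A ^ n)) by (unfold N; simpl; field; lra).
      replace (2 * K / (nu 0 * C0) * (1 - s) * (C0 * nu s * nu 0)) with (2 * (1 - s) * (K * nu s)) by (field; lra).
      apply Rmult_le_compat; [lra|apply Rmult_le_pos; lra|lra|].
      eapply Rle_trans; [|exact H]. apply Rmult_le_compat_l; lra. }
    unfold Rdiv at 1. rewrite <- pow_inv. apply Rmult_le_compat; [lra| |exact Hk2|].
    + apply pow_le. apply (Hinv z (1 - t)); auto. lra.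
    + apply pow_incr. apply Hinv; auto. lra.
Qed.

(** * Compactness *)

(** Differentiation preserves locally uniform convergence, [g] is bounded on smaller disks, and all
    images vanish at [0]. *)
Lemma Sg_luc_zero g fs : analytic g -> (forall n, analytic (fs n)) -> luc fs (fun _ => 0) ->
  luc (fun n => Sg g (fs n)) (fun _ => 0).
Proof.
  intros Hg Hfs H. apply luc_zero_of_deriv; try (intros n; now apply Sg_spec).
  destruct (weierstrass fs (fun _ => 0) Hfs H) as [_ Hd].
  intros r Hr eps Heps. destruct (analytic_bounded g r Hg Hr) as [M [HM0 HM]].
  destruct (Hd r Hr (eps / M)) as [N HN]; [now apply Rdiv_lt_0_compat|].
  exists N. intros n Hn z Hz. assert (HzD : inD z) by (unfold inD; lra).
  destruct (Sg_spec g (fs n) Hg (Hfs n)) as [_ [-> _]]; auto.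
  specialize (HN n Hn z Hz). rewrite (proj2 (analytic_const 0) z HzD) in HN.
  replace (cderiv (fs n) z - 0)%C with (cderiv (fs n) z) in HN by ring.
  replace (cderiv (fs n) z * g z - 0)%C with (cderiv (fs n) z * g z)%C by ring.
  rewrite Cmod_mult. apply Rle_trans with (eps / M * M); [|right; field; lra].
  apply Rmult_le_compat; try apply Cmod_ge_0; auto.
Qed.

(** Convergence in the weighted norm implies pointwise convergence, and the images tend to zero
    pointwise, so the limit [h] supplied by compactness vanishes on the disk. *)
Lemma Sg_compact_null_sequence g X nu Y mu fs : analytic g -> (forall z, inD z -> 0 < wt mu z) ->
  Sg_compact g X nu Y mu ->
  (forall n, X (fs n)) -> (forall n, analytic (fs n)) ->
  (forall n z, inD z -> wt nu z * Cmod (fs n z) <= 1) -> luc fs (fun _ => 0) ->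
  exists phi : nat -> nat, (forall n, (phi n < phi (S n))%nat) /\
    forall eps, 0 < eps -> exists N, forall n, (N <= n)%nat -> forall z, inD z -> wt mu z * Cmod (Sg g (fs (phi n)) z) <= eps.
Proof.
  intros Hg Hmu [_ HC] HX Hfs Hball Hluc.
  destruct (HC fs HX Hball) as [phi [h [Hphi [_ Hh]]]]. exists phi. split; auto.
  pose proof (Sg_luc_zero g fs Hg Hfs Hluc) as HS.
  assert (Hh0 : forall z, inD z -> h z = 0).
  { intros z Hz. apply Cmod_eps_0. intros eps Heps. specialize (Hmu z Hz).
    destruct (Hh (wt mu z * (eps / 2))) as [N1 K1]; [apply Rmult_lt_0_compat; lra|].
    destruct (HS (Cmod z) Hz (eps / 2) ltac:(lra)) as [N2 K2].
    set (n := Nat.max N1 N2). specialize (K1 n ltac:(unfold n; lia) z Hz).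
    pose proof (increasing_ge phi Hphi n). specialize (K2 (phi n) ltac:(unfold n in *; lia) z ltac:(lra)).
    apply Rmult_le_reg_l in K1; auto.
    replace (h z) with ((Sg g (fs (phi n)) z - 0) - (Sg g (fs (phi n)) z - h z))%C by ring.
    eapply Rle_trans; [apply Cmod_triang_sub|]. lra. }
  intros eps Heps. destruct (Hh eps Heps) as [N HN]. exists N. intros n Hn z Hz.
  specialize (HN n Hn z Hz). rewrite Hh0 in HN by auto.
  now replace (Sg g (fs (phi n)) z - 0)%C with (Sg g (fs (phi n)) z) in HN by ring.
Qed.

Lemma Sg_zero_symbol (g f : C -> C) z : (forall w, inD w -> g w = 0) -> inD z -> Sg g f z = 0.
Proof.
  intros H Hz. change (Sg g f z) with (z * CInt (fun t => cderiv f (RtoC t * z) * g (RtoC t * z)) 0 1)%C.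
  rewrite (CInt_ext _ (fun t => 0 * RtoC 0)%C); [|lra|].
  - unfold CInt. rewrite !(RInt_const (V := R_CompleteNormedModule)).
    unfold scal; simpl; unfold mult; simpl. unfold Cmult, RtoC. simpl. f_equal; ring.
  - intros t Ht. rewrite H; [ring|]. replace (t * z)%C with (0 + z * t)%C by ring. now apply inD_segment.
Qed.

Lemma Sg_compact_zero_symbol (g : C -> C) X nu Y mu : (forall z, inD z -> g z = 0) ->
  (forall h : C -> C, (forall z, inD z -> h z = 0) -> Y h) -> Sg_compact g X nu Y mu.
Proof.
  intros Hg HY. split.
  - intros f _. apply HY. intros z Hz. now apply Sg_zero_symbol.
  - intros fs _ _. exists (fun n => n), (fun _ => 0). split; [lia|]. split; [now apply HY|].
    intros eps Heps. exists 0%nat. intros n _ z Hz. rewrite Sg_zero_symbol by auto.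
    replace (0 - 0)%C with (RtoC 0) by ring. rewrite Cmod_0. lra.
Qed.

Lemma Hinf_zero nu (h : C -> C) : (forall z, inD z -> h z = 0) -> Hinf nu h.
Proof.
  intros H. split.
  - apply (analytic_congr (fun _ => 0)); [intros; symmetry; auto|apply analytic_const].
  - exists 0. intros z Hz. rewrite H, Cmod_0 by auto. lra.
Qed.

Lemma bernoulli x n : 0 <= x <= 1 -> 1 - INR n * x <= (1 - x) ^ n.
Proof.
  intros Hx. induction n as [|n IH]; [simpl; lra|]. rewrite S_INR. cbn [pow].
  assert (0 <= INR n * (x * x)) by (apply Rmult_le_pos; [apply pos_INR|nra]).
  assert ((1 - x) * (1 - INR n * x) <= (1 - x) * (1 - x) ^ n) by (apply Rmult_le_compat_l; lra). nra.
Qed.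

(* Tested on the monomials [z ^ n / nu 0], at [|z| = 1 - 1/(2n)], where [(1 - |z|) n |z| ^ (n-1) >= 1/4]. *)
Lemma Sg_compact_bounded g nu : analytic g -> weight nu ->
  Sg_compact g (Hinf nu) nu (Hinf one_w) one_w -> forall z, inD z -> g z = 0.
Proof.
  intros Hg Hnu HC.
  assert (Hnu0 : 0 < nu 0) by (apply Hnu; lra).
  set (fs := fun (n : nat) (z : C) => (RtoC (/ nu 0) * z ^ n)%C).
  assert (Hfd : forall n z, inD z -> cdl (fs n) z (RtoC (/ nu 0) * (INR n * z ^ (n - 1)))%C).
  { intros n z _. apply cdl_scal, cdl_pow. }
  assert (Hinv : 0 < / nu 0) by now apply Rinv_0_lt_compat.
  assert (Hmod : forall n z, Cmod (fs n z) = / nu 0 * Cmod z ^ n).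
  { intros n z. unfold fs. rewrite Cmod_mult, Cmod_pow, Cmod_R, Rabs_pos_eq; lra. }
  assert (Hball : forall n z, inD z -> wt nu z * Cmod (fs n z) <= 1).
  { intros n z Hz. rewrite Hmod. pose proof (inD_bounds z Hz).
    assert (0 <= Cmod z ^ n <= 1). { split; [apply pow_le; lra|]. rewrite <- (pow1 n). apply pow_incr. lra. }
    apply Rle_trans with (nu 0 * (/ nu 0 * 1)); [|right; field; lra].
    apply Rmult_le_compat; [left; now apply weight_pos|apply Rmult_le_pos; lra|now apply weight_le_0|].
    apply Rmult_le_compat_l; lra. }
  assert (Hfa : forall n, analytic (fs n)) by (intros n; apply (analytic_intro _ _ (Hfd n))).
  assert (Hluc : luc fs (fun _ => 0)).
  { intros r Hr eps Heps. destruct (Rlt_le_dec r 0) as [Hn|Hr0].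
    { exists 0%nat. intros n _ z Hz. pose proof (Cmod_ge_0 z). lra. }
    destruct (pow_eventually_small r (/ nu 0) eps) as [N HN]; try lra.
    exists N. intros n Hn z Hz. replace (fs n z - 0)%C with (fs n z) by ring. rewrite Hmod.
    eapply Rle_trans; [|apply (HN n Hn)]. apply Rmult_le_compat_l; [lra|]. apply pow_incr. split; [apply Cmod_ge_0|lra]. }
  destruct (Sg_compact_null_sequence g (Hinf nu) nu (Hinf one_w) one_w fs) as [phi [Hphi HS]]; auto.
  { intros z _. unfold wt, one_w. lra. }
  { intros n. split; [auto|]. exists 1. auto. }
  intros z Hz. apply Cmod_eps_0. intros eps Heps. pose proof (inD_bounds z Hz) as Hzb.
  (* Chosen so that the final bound [8 nu(0) e * 2 / (1 - |z|)] equals [eps]. *)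
  set (e := eps * (1 - Cmod z) / (16 * nu 0)).
  assert (He : 0 < e) by (apply Rdiv_lt_0_compat; [apply Rmult_lt_0_compat; lra|lra]).
  destruct (HS e He) as [N HN].
  destruct (INR_unbounded (1 / (1 - Cmod z))) as [N2 HN2].
  set (m := phi (Nat.max N (S N2))).
  specialize (HN (Nat.max N (S N2)) ltac:(lia)). fold m in HN.
  assert (Hm : (S N2 <= m)%nat) by (pose proof (increasing_ge phi Hphi (Nat.max N (S N2))); unfold m; lia).
  assert (HmR : 1 <= INR m) by (apply (le_INR 1); lia).
  assert (HmN : INR N2 <= INR m) by (apply le_INR; lia).
  (* With [m x = 1 / 2] Bernoulli's inequality gives [r ^ (m - 1) >= 1 / 2], and circles of radius
     [x / 2] about points of [|w| = r] stay in the disk. *)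
  set (x := / (2 * INR m)). set (r := 1 - x).
  assert (Hx : 0 < x <= 1 / 2).
  { unfold x. split; [apply Rinv_0_lt_compat; lra|]. replace (1 / 2) with (/ 2) by field. apply Rinv_le_contravar; lra. }
  assert (Hmx : INR m * x = 1 / 2) by (unfold x; field; lra).
  assert (Hrz : (1 + Cmod z) / 2 <= r).
  { unfold r. assert (2 * x <= 1 - Cmod z); [|lra].
    replace (2 * x) with (/ INR m) by (unfold x; field; lra).
    replace (1 - Cmod z) with (/ (1 / (1 - Cmod z))) by (field; lra).
    apply Rinv_le_contravar; [apply Rdiv_lt_0_compat; lra|lra]. }
  assert (Hr : 0 < r < 1) by (unfold r; lra).
  pose proof (bernoulli x (m - 1) ltac:(lra)) as Hber. fold r in Hber.
  rewrite minus_INR in Hber by lia. simpl (INR 1) in Hber.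
  assert (Hrm : 1 / 2 <= r ^ (m - 1)) by nra.
  destruct (Sg_spec g (fs m) Hg (Hfa m)) as [HSa [HSd _]].
  assert (HM : forall w, Cmod w = r -> Cmod (g w) <= 8 * nu 0 * e).
  { intros w Hw. assert (HwD : inD w) by (unfold inD; lra).
    assert (Hce : Cmod (cderiv (Sg g (fs m)) w) * (x / 2) <= e).
    { apply cauchy_estimate; auto; [lra|rewrite Hw; unfold r; lra|]. intros v Hv.
      assert (HvD : inD v).
      { unfold inD. replace v with (w + (v - w))%C by ring. eapply Rle_lt_trans; [apply Cmod_triangle|].
        rewrite Hv, Hw. unfold r. lra. }
      specialize (HN v HvD). unfold wt, one_w in HN. lra. }
    rewrite HSd in Hce by auto. rewrite (cderiv_unique _ _ _ (Hfd m w HwD)) in Hce.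
    rewrite !Cmod_mult, !Cmod_R, Cmod_pow, Hw, Rabs_pos_eq, Rabs_pos_eq in Hce by lra.
    pose proof (Cmod_ge_0 (g w)) as Hgw.
    apply Rmult_le_reg_r with (/ (8 * nu 0)); [apply Rinv_0_lt_compat; lra|].
    replace (8 * nu 0 * e * / (8 * nu 0)) with e by (field; lra).
    eapply Rle_trans; [|exact Hce].
    replace (/ nu 0 * (INR m * r ^ (m - 1)) * Cmod (g w) * (x / 2)) with
      (Cmod (g w) * (/ nu 0 * (INR m * x * r ^ (m - 1) / 2))) by (field; lra).
    apply Rmult_le_compat_l; [auto|]. rewrite Hmx.
    replace (/ (8 * nu 0)) with (/ nu 0 * (1 / 8)) by (field; lra).
    apply Rmult_le_compat_l; lra. }
  pose proof (taylor_approx g z r _ 0 Hg ltac:(lra) ltac:(lra) HM) as HT. simpl in HT.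
  replace (g z - 0)%C with (g z) in HT by ring. eapply Rle_trans; [exact HT|].
  assert (Hrr : r / (r - Cmod z) <= 2 / (1 - Cmod z)).
  { apply Rmult_le_reg_r with ((r - Cmod z) * (1 - Cmod z)); [apply Rmult_lt_0_compat; lra|].
    replace (r / (r - Cmod z) * ((r - Cmod z) * (1 - Cmod z))) with (r * (1 - Cmod z)) by (field; lra).
    replace (2 / (1 - Cmod z) * ((r - Cmod z) * (1 - Cmod z))) with (2 * (r - Cmod z)) by (field; lra). nra. }
  apply Rle_trans with (8 * nu 0 * e * (2 / (1 - Cmod z))).
  - rewrite Rmult_1_r. apply Rmult_le_compat_l; [|exact Hrr]. apply Rmult_le_pos; lra.
  - unfold e. right. field. split; lra.
Qed.

(** Where the symbol condition fails along points [a n], the images of the test functions tend to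
    zero along a subsequence. Then [mu (1 - |z|^2) |f' g|] also tends to zero uniformly, while at
    [a n] it is at least [c |a n|] times the value at which the condition fails. *)
Lemma Sg_compact_symbol_decay g nu mu X Y : analytic g -> weight nu -> propU nu -> weight mu -> quasi_normal mu ->
  (forall f, analytic f -> (exists B, 0 < B /\ forall z, inD z -> Cmod (f z) <= B) ->
     (forall z, inD z -> wt nu z * Cmod (f z) <= 1) -> X f) ->
  Sg_compact g X nu Y mu -> lim_bdry0 (fun z => wt mu z / wt nu z * Cmod (g z)).
Proof.
  intros Hg Hnu HU Hmu Hqn HX HC. apply NNPP. intros Hcontra.
  assert (Hbad : exists eps, 0 < eps /\ forall r, r < 1 -> exists z, inD z /\ r < Cmod z /\ eps <= wt mu z / wt nu z * Cmod (g z)).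
  { apply NNPP. intros H1. apply Hcontra. intros eps Heps. apply NNPP. intros H2. apply H1.
    exists eps. split; auto. intros r Hr. apply NNPP. intros H3. apply H2. exists r. split; auto.
    intros z Hz Hrz. apply Rnot_le_lt. intros H4. apply H3. exists z. split; auto. split; auto.
    rewrite Rabs_pos_eq in H4; auto. apply Rmult_le_pos; [|apply Cmod_ge_0].
    apply Rle_mult_inv_pos; [left|]; now apply weight_pos. }
  destruct Hbad as [eps [Heps Hbad]].
  destruct (test_functions nu Hnu HU) as [c [E [P [Hc [HE Htest]]]]].
  (* The exponent [S n] keeps every point above modulus [1 / 2], and the geometric rate feeds the
     bound by [1 - |a|] of the test functions. *)
  assert (Hseq : forall n : nat, exists zf : C * (C -> C), inD (fst zf) /\ 1 - (1 / 2) ^ S n < Cmod (fst zf) /\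
    eps <= wt mu (fst zf) / wt nu (fst zf) * Cmod (g (fst zf)) /\
    analytic (snd zf) /\ (exists B, 0 < B /\ forall z, inD z -> Cmod (snd zf z) <= B) /\
    (forall z, inD z -> wt nu z * Cmod (snd zf z) <= 1) /\
    c * Cmod (fst zf) <= wt nu (fst zf) * ((1 - Cmod (fst zf) ^ 2) * Cmod (cderiv (snd zf) (fst zf))) /\
    (forall z, inD z -> Cmod (snd zf z) <= E * (1 - Cmod (fst zf)) / (1 - Cmod z) ^ P)).
  { intros n. assert (0 < (1 / 2) ^ S n) by (apply pow_lt; lra).
    destruct (Hbad (1 - (1 / 2) ^ S n) ltac:(lra)) as [a [Ha [Ha1 Ha2]]].
    destruct (Htest a Ha) as [f Hf]. exists (a, f). simpl fst. simpl snd. tauto. }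
  apply choice in Hseq. destruct Hseq as [zf Hzf].
  set (a n := fst (zf n)). set (fs n := snd (zf n)).
  assert (Hluc : luc fs (fun _ => 0)).
  { intros r Hr e He. destruct (Rlt_le_dec r 0) as [Hn|Hr0].
    { exists 0%nat. intros n _ z Hz. pose proof (Cmod_ge_0 z). lra. }
    assert (HrP : 0 < (1 - r) ^ P) by (apply pow_lt; lra).
    destruct (pow_eventually_small (1 / 2) (E / (1 - r) ^ P) e) as [N HN]; try lra.
    { apply Rle_mult_inv_pos; lra. }
    exists N. intros n Hn z Hz. replace (fs n z - 0)%C with (fs n z) by ring.
    destruct (Hzf n) as (Ha & Ha1 & _ & _ & _ & _ & _ & Hdec). fold (a n) in *. fold (fs n) in *.
    assert (HzD : inD z) by (unfold inD; lra). specialize (Hdec z HzD). pose proof (inD_bounds _ Ha).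
    eapply Rle_trans; [exact Hdec|]. eapply Rle_trans; [|apply (HN (S n) ltac:(lia))].
    replace (E / (1 - r) ^ P * (1 / 2) ^ S n) with (E * (1 / 2) ^ S n / (1 - r) ^ P) by (unfold Rdiv; ring).
    unfold Rdiv at 1 2. apply Rmult_le_compat.
    - apply Rmult_le_pos; lra.
    - left. apply Rinv_0_lt_compat, pow_lt. lra.
    - apply Rmult_le_compat_l; lra.
    - apply Rinv_le_contravar; auto. apply pow_incr. lra. }
  destruct (Sg_compact_null_sequence g X nu Y mu fs) as [phi [Hphi HS]]; auto.
  { intros z Hz. now apply weight_pos. }
  { intros n. apply HX; apply (Hzf n). }
  { intros n. apply (Hzf n). }
  { intros n. apply (Hzf n). }
  assert (Hfa : forall n, analytic (fs n)) by (intros n; apply (Hzf n)).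
  (* The lower bound at the test point is at least [c eps / 2], so [c eps / 4] contradicts it. *)
  destruct (quasi_normal_differentiate mu (fun n => Sg g (fs (phi n))) Hmu Hqn) with (eps := c * eps / 4) as [N HN]; auto.
  { intros n. now apply Sg_spec. }
  { apply Rdiv_lt_0_compat; [now apply Rmult_lt_0_compat|lra]. }
  specialize (HN N (Nat.le_refl N)). set (m := phi N) in *.
  destruct (Hzf m) as (Ha & Ha1 & Hge & _ & _ & _ & Hder & _). fold (a m) in *. fold (fs m) in *.
  specialize (HN (a m) Ha). destruct (Sg_spec g (fs m) Hg (Hfa m)) as [_ [HSd _]].
  rewrite HSd, Cmod_mult in HN by auto.
  assert (Ha2 : 1 / 2 < Cmod (a m)).
  { pose proof (half_pow_le_1 m). cbn [pow] in Ha1. lra. }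
  pose proof (weight_pos nu (a m) Hnu Ha) as Hnp. pose proof (weight_pos mu (a m) Hmu Ha) as Hmp.
  change (wt (w1 mu) (a m)) with (wt mu (a m) * (1 - Cmod (a m) ^ 2)) in HN.
  set (D := Cmod (cderiv (fs m) (a m))) in *. set (Gm := Cmod (g (a m))) in *.
  assert (HG0 : 0 <= wt mu (a m) / wt nu (a m) * Gm).
  { apply Rmult_le_pos; [apply Rle_mult_inv_pos; lra|apply Cmod_ge_0]. }
  replace (wt mu (a m) * (1 - Cmod (a m) ^ 2) * (D * Gm)) with
    ((wt mu (a m) / wt nu (a m) * Gm) * (wt nu (a m) * ((1 - Cmod (a m) ^ 2) * D))) in HN by (field; lra).
  assert (K1 : (wt mu (a m) / wt nu (a m) * Gm) * (c * Cmod (a m)) <= c * eps / 4).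
  { eapply Rle_trans; [|exact HN]. now apply Rmult_le_compat_l. }
  assert (K2 : eps * (c * (1 / 2)) <= (wt mu (a m) / wt nu (a m) * Gm) * (c * Cmod (a m))).
  { apply Rmult_le_compat; [lra|lra|exact Hge|]. apply Rmult_le_compat_l; lra. }
  assert (0 < c * eps) by now apply Rmult_lt_0_compat. lra.
Qed.

Lemma H0_Hinf nu f : weight nu -> H0 nu f -> Hinf nu f.
Proof.
  intros Hnu [Hf Hl]. split; auto. destruct (Hl 1 Rlt_0_1) as [r [Hr K]].
  destruct (analytic_bounded f r Hf Hr) as [M [HM0 HM]].
  assert (0 < nu 0) by (apply Hnu; lra).
  exists (1 + nu 0 * M). intros z Hz. assert (0 <= nu 0 * M) by (apply Rmult_le_pos; lra).
  destruct (Rlt_le_dec r (Cmod z)) as [Hz1|Hz1].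
  - specialize (K z Hz Hz1). pose proof (Rle_abs (wt nu z * Cmod (f z))). lra.
  - apply Rle_trans with (nu 0 * M); [|lra]. apply Rmult_le_compat; auto.
    + left. now apply weight_pos.
    + apply Cmod_ge_0.
    + now apply weight_le_0.
Qed.

(* (2.2) and the bound on [nu (1 - |z|^2) |f'|] make [mu (1 - |z|^2) |f' g|] small near the circle. *)
Lemma weighted_Sg_derivative_decay (g : C -> C) (nu mu : R -> R) M : weight nu -> propU nu -> weight mu ->
  lim_bdry0 (fun z => wt mu z / wt nu z * Cmod (g z)) -> 0 <= M -> forall eps, 0 < eps -> exists r, r < 1 /\
  forall f, analytic f -> (forall z, inD z -> wt nu z * Cmod (f z) <= M) ->
  forall z, inD z -> r < Cmod z -> wt (w1 mu) z * Cmod (cderiv f z * g z) < eps.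
Proof.
  intros Hnu HU Hmu Hdecay HM eps Heps. destruct (weighted_derivative_bound nu Hnu HU) as [C0 [HC0 HB]].
  assert (HCM : 0 <= C0 * M) by (apply Rmult_le_pos; lra).
  destruct (Hdecay (eps / (1 + C0 * M))) as [r [Hr K]]; [apply Rdiv_lt_0_compat; lra|].
  exists r. split; auto. intros f Hf HfM z Hz Hrz. specialize (K z Hz Hrz).
  specialize (HB f M Hf HfM z Hz).
  pose proof (weight_pos nu z Hnu Hz) as Hnp. pose proof (weight_pos mu z Hmu Hz) as Hmp.
  change (wt (w1 mu) z) with (wt mu z * (1 - Cmod z ^ 2)). rewrite Cmod_mult.
  replace (wt mu z * (1 - Cmod z ^ 2) * (Cmod (cderiv f z) * Cmod (g z))) with
    (wt nu z * ((1 - Cmod z ^ 2) * Cmod (cderiv f z)) * (wt mu z / wt nu z * Cmod (g z))) by (field; lra).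
  assert (HG0 : 0 <= wt mu z / wt nu z * Cmod (g z)).
  { apply Rmult_le_pos; [apply Rle_mult_inv_pos; lra|apply Cmod_ge_0]. }
  rewrite Rabs_pos_eq in K by auto.
  apply Rle_lt_trans with ((C0 * M) * (wt mu z / wt nu z * Cmod (g z))); [now apply Rmult_le_compat_r|].
  apply Rle_lt_trans with ((1 + C0 * M) * (wt mu z / wt nu z * Cmod (g z))); [nra|].
  apply Rlt_le_trans with ((1 + C0 * M) * (eps / (1 + C0 * M))); [apply Rmult_lt_compat_l; lra|].
  right. field. lra.
Qed.

Lemma Sg_little_Bloch g nu mu f : analytic g -> weight nu -> propU nu -> weight mu ->
  lim_bdry0 (fun z => wt mu z / wt nu z * Cmod (g z)) -> Hinf nu f -> B0 (w1 mu) (Sg g f).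
Proof.
  intros Hg Hnu HU Hmu Hdecay [Hf [M HM]]. destruct (Sg_spec g f Hg Hf) as [Ha [Hd _]]. split; auto.
  assert (HM0 : 0 <= M).
  { eapply Rle_trans; [|apply (HM 0 inD_0)].
    apply Rmult_le_pos; [left; apply weight_pos; auto; exact inD_0|apply Cmod_ge_0]. }
  intros eps Heps. destruct (weighted_Sg_derivative_decay g nu mu M Hnu HU Hmu Hdecay HM0 eps Heps) as [r [Hr K]].
  exists r. split; auto. intros z Hz Hrz. rewrite Hd by auto.
  rewrite Rabs_pos_eq; [now apply K|]. apply Rmult_le_pos; [|apply Cmod_ge_0].
  left. apply w1_pos; auto. now apply inD_bounds.
Qed.

(** The Montel limit [f] of a sequence in [X] is only known to lie in [Hinf nu]. This is harmless:
    under the symbol condition [S_g] maps all of [Hinf nu] into [H0 mu], hence into [Y]. *)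
Lemma Sg_compact_of_symbol_decay g nu mu X Y :
  analytic g -> weight nu -> propU nu -> weight mu -> quasi_normal mu ->
  lim_bdry0 (fun z => wt mu z / wt nu z * Cmod (g z)) ->
  (forall f, X f -> Hinf nu f) -> (forall f, H0 mu f -> Y f) -> Sg_compact g X nu Y mu.
Proof.
  intros Hg Hnu HU Hmu Hqn Hdecay HX HY.
  assert (HSg : forall f, Hinf nu f -> Y (Sg g f)) by (intros f Hf; apply HY, Hqn, (Sg_little_Bloch g nu); auto).
  split; [intros f Hf; now apply HSg, HX|].
  intros fs HfX Hball.
  assert (Hfa : forall n, analytic (fs n)) by (intros n; apply (HX _ (HfX n))).
  destruct (montel fs Hfa) as [phi [f [Hphi [Hf Hluc]]]].
  { intros r Hr. destruct (Rlt_le_dec r 0) as [Hn|Hr0].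
    { exists 0. intros n z Hz. pose proof (Cmod_ge_0 z). lra. }
    assert (Hnr : 0 < nu r) by (apply Hnu; lra).
    exists (/ nu r). intros n z Hz. pose proof (Cmod_ge_0 z).
    apply Rmult_le_reg_l with (nu r); auto. rewrite Rinv_r by lra.
    eapply Rle_trans; [|apply (Hball n z); unfold inD; lra].
    apply Rmult_le_compat_r; [apply Cmod_ge_0|]. apply weight_le; auto; lra. }
  assert (Hfball : forall z, inD z -> wt nu z * Cmod (f z) <= 1).
  { intros z Hz. replace (f z) with (f z - 0)%C by ring.
    apply (luc_weighted_limit (fun n => fs (phi n)) f z 0 _ _ 0); auto.
    - left. now apply weight_pos.
    - intros m _. replace (fs (phi m) z - 0)%C with (fs (phi m) z) by ring. auto. }
  assert (HfH : Hinf nu f) by (split; [auto|now exists 1]).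
  exists phi, (Sg g f). split; [auto|]. split; [now apply HSg|].
  set (D := fun n z => (fs (phi n) z - f z)%C).
  assert (HDa : forall n, analytic (D n)) by (intros n; now apply analytic_minus).
  assert (HDball : forall n z, inD z -> wt nu z * Cmod (D n z) <= 2).
  { intros n z Hz. pose proof (Cmod_triang_sub (fs (phi n) z) (f z)) as T.
    apply (Rmult_le_compat_l (wt nu z)) in T; [|left; now apply weight_pos].
    specialize (Hball (phi n) z Hz). specialize (Hfball z Hz). unfold D. lra. }
  assert (HDd : forall n z, inD z -> cderiv (D n) z = (cderiv (fs (phi n)) z - cderiv f z)%C).
  { intros n z Hz. now apply analytic_minus. }
  destruct (weierstrass (fun n => fs (phi n)) f (fun n => Hfa (phi n)) Hluc) as [_ Hlucd].
  set (G := fun n z => (Sg g (fs (phi n)) z - Sg g f z)%C).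
  assert (HGd : forall n z, inD z -> cderiv (G n) z = (cderiv (D n) z * g z)%C).
  { intros n z Hz. destruct (Sg_spec g f Hg Hf) as [A1 [B1 _]].
    destruct (Sg_spec g (fs (phi n)) Hg (Hfa (phi n))) as [A2 [B2 _]].
    unfold G. rewrite (proj2 (analytic_minus _ _ A2 A1)), B1, B2, HDd by auto. ring. }
  assert (HGa : forall n, analytic (G n)).
  { intros n. apply analytic_minus; apply Sg_spec; auto. }
  assert (Hw1p : forall z, inD z -> 0 < wt (w1 mu) z).
  { intros z Hz. apply w1_pos; auto. now apply inD_bounds. }
  change (forall eps, 0 < eps -> exists N, forall n, (N <= n)%nat -> forall z, inD z -> wt mu z * Cmod (G n z) <= eps).
  apply quasi_normal_integrate; auto.
  - intros n. split; auto. intros eps Heps.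
    destruct (weighted_Sg_derivative_decay g nu mu 2 Hnu HU Hmu Hdecay ltac:(lra) eps Heps) as [r [Hr K]].
    exists r. split; auto. intros z Hz Hrz. rewrite HGd by auto.
    rewrite Rabs_pos_eq; [apply K; auto|]. apply Rmult_le_pos; [left; auto|apply Cmod_ge_0].
  - intros n. unfold G. destruct (Sg_spec g f Hg Hf) as [_ [_ ->]].
    destruct (Sg_spec g (fs (phi n)) Hg (Hfa (phi n))) as [_ [_ ->]]. ring.
  (* Beyond [r] the estimate is uniform in [n] because the differences have norm at most [2]; up to
     [r] the derivatives converge uniformly and [g] is bounded. *)
  - intros eps Heps.
    destruct (weighted_Sg_derivative_decay g nu mu 2 Hnu HU Hmu Hdecay ltac:(lra) eps Heps) as [r [Hr K]].
    destruct (analytic_bounded g r Hg Hr) as [M [HM0 HM]].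
    assert (Hmu0 : 0 < mu 0) by (apply Hmu; lra).
    destruct (Hlucd r Hr (eps / (mu 0 * M))) as [N HN]; [apply Rdiv_lt_0_compat; [auto|now apply Rmult_lt_0_compat]|].
    exists N. intros n Hn z Hz. rewrite HGd by auto.
    destruct (Rlt_le_dec r (Cmod z)) as [Hrz|Hrz]; [left; apply K; auto|].
    rewrite Cmod_mult, HDd by auto. specialize (HN n Hn z Hrz). specialize (HM z Hrz).
    pose proof (inD_bounds z Hz).
    assert (Hw : wt (w1 mu) z <= mu 0).
    { apply Rle_trans with (w1 mu 0); [apply w1_le; auto; lra|unfold w1; right; ring]. }
    apply Rle_trans with (mu 0 * (eps / (mu 0 * M) * M)); [|right; field; split; lra].
    apply Rmult_le_compat; auto.
    + left. auto.
    + apply Rmult_le_pos; apply Cmod_ge_0.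
    + apply Rmult_le_compat; auto; apply Cmod_ge_0.
Qed.

Lemma bounded_Hinf_typical nu f : weight nu -> typical nu -> analytic f ->
  (exists B, 0 < B /\ forall z, inD z -> Cmod (f z) <= B) -> H0 nu f.
Proof.
  intros Hnu Hty Hf [B [HB Hb]]. split; auto. intros eps Heps.
  destruct (Hty (eps / B)) as [r [Hr K]]; [now apply Rdiv_lt_0_compat|].
  exists r. split; auto. intros z Hz Hrz. specialize (K (Cmod z) (conj Hrz Hz)).
  pose proof (weight_pos nu z Hnu Hz) as Hp. fold (wt nu z) in K. rewrite Rabs_pos_eq in K by lra.
  rewrite Rabs_pos_eq by (apply Rmult_le_pos; [lra|apply Cmod_ge_0]).
  apply Rle_lt_trans with (wt nu z * B); [apply Rmult_le_compat_l; auto; lra|].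
  apply Rlt_le_trans with (eps / B * B); [now apply Rmult_lt_compat_r|right; field; lra].
Qed.

Theorem theorem9 (g : C -> C) (nu : R -> R) :
  analytic g -> weight nu ->
  (Sg_compact g (Hinf nu) nu (Hinf one_w) one_w <-> (forall z, inD z -> g z = 0))
  /\
  (forall mu : R -> R, propU nu -> weight mu -> quasi_normal mu ->
     (Sg_compact g (Hinf nu) nu (Hinf mu) mu <->
        lim_bdry0 (fun z => wt mu z / wt nu z * Cmod (g z)))
     /\
     (typical nu ->
        (Sg_compact g (Hinf nu) nu (Hinf mu) mu <-> Sg_compact g (H0 nu) nu (H0 mu) mu))).
Proof.
  intros Hg Hnu. split.
  - split; [now apply Sg_compact_bounded|].
    intros H. apply Sg_compact_zero_symbol; auto. apply Hinf_zero.
  - intros mu HU Hmu Hqn.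
    assert (Hiff : Sg_compact g (Hinf nu) nu (Hinf mu) mu <-> lim_bdry0 (fun z => wt mu z / wt nu z * Cmod (g z))).
    { split.
      - apply Sg_compact_symbol_decay; auto. intros f Hf _ Hb. split; auto. now exists 1.
      - intros H. apply Sg_compact_of_symbol_decay; auto. intros f. now apply H0_Hinf. }
    split; [exact Hiff|]. intros Hty. rewrite Hiff. split.
    + intros H. apply Sg_compact_of_symbol_decay; auto. intros f. now apply H0_Hinf.
    (* Typicality puts the bounded test functions into [H0 nu]. *)
    + apply Sg_compact_symbol_decay; auto. intros f Hf HB _. now apply bounded_Hinf_typical.
Qed.
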